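(* Let $\chi=\sum_s m_s$ be an admissible untangled $qq$-character (specialized at $q=1$), taken with a graph which has a supplement $a$ and no incomplete squares, and let $u\in\tilde R$ be non-zero. Let $M_{\chi,u}$ be the $\tilde R$-vector space with basis $\{v_{m_s}\}$ labelled by the monomials of $\chi$, and for an edge $m\xrightarrow{i,\tau}n$ of the graph put $$b(m,n)=a(m,n)^{-1}\operatorname*{res}_{z=\tau u}f_i(m;u/z)\frac{dz}{z}.$$ Then the formulas $$K_i^{\pm}(z)v_{m_j}=f_i^{\pm}(m_j;u/z)\,v_{m_j},$$ $$F_i(z)v_{m_j}=\sum_{s:\ m_j\xrightarrow{i,\tau_s}m_s}a(m_j,m_s)\,\delta(\tau_su/z)\,v_{m_s},$$ $$E_i(z)v_{m_j}=\sum_{s:\ m_s\xrightarrow{i,\tau_s}m_j}b(m_s,m_j)\,\delta(\tau_su/z)\,v_{m_s}$$ (sums over all edges of color $i$ of the graph starting, respectively ending, at $m_j$) define a $U_C$-module structure on $M_{\chi,u}$.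
   Context: **Cartan matrices.** Let $R$ be the ring of Laurent polynomials with integer coefficients in independent variables $q$ and finitely many others $q_1,q_2,\dots$; a *monomial* in $R$ is $q^a\prod_iq_i^{a_i}$, $a,a_i\in\mathbb{Z}$ (coefficient one). Let $I$ be a finite set (of ''colors''). A *(deformed) Cartan matrix* (of fermionic type) is a symmetric non-degenerate matrix $C=(\sigma_{ij}-\sigma_{ij}^{-1})_{i,j\in I}$ with $\sigma_{ij}=\sigma_{ji}$ monomials in $R$ and $\sigma_{ii}=q$. Fix such a $C$, and assume it remains non-degenerate after the specialization $q=1$. **Monomials.** $\mathcal Y$ is the ring of Laurent polynomials with integer coefficients in commuting variables $Y_{i,\sigma}$ ($i\in I$, $\sigma\in R$ a monomial). A monomial in $\mathcal Y$ is a finite product of the $Y_{i,\sigma}^{\pm1}$. $\tilde{\mathcal Y}\supset\mathcal Y$ is the space of formal sums of countably many monomials. The degree $\deg_i$ is defined by $\deg_iY_{j,\sigma}^{\pm1}=\pm\delta_{ij}$; degree zero means $\deg_i=0$ for all $i$. The shift $\tau_{\sigma_0}$ sends $Y_{i,\sigma}^{\pm1}$ to $Y_{i,\sigma_0\sigma}^{\pm1}$. Affine roots: $A_j=\prod_{i\in I}Y_{i,\sigma_{ij}}Y_{i,\sigma_{ij}^{-1}}^{-1}$, $A_{j,\sigma}=\tau_\sigma A_j$. A monomial is *generic* if every $Y_{i,\sigma}$ appears in it with power $-1,0$ or $1$; an element of $\tilde{\mathcal Y}$ is generic if all its monomials are. Two monomials are *mutually generic* if both are generic and no variable occurring in one occurs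 in the other; two series are mutually generic if every monomial of one is mutually generic with every monomial of the other. **Blocks and $qq$-characters.** An *elementary block of color $i$ and length $k+1$* ($k\ge0$) is a sum $B_i^{(k)}=m_0+\dots+m_k$ of monomials $m_j=\bar m\,\bar m_j\prod_{0\le s\le k,\,s\ne j}Y_{i,q^{-k+2s}}$, where $\bar m_j$ is a generic monomial in variables $Y_{t,\sigma}^{\pm1}$, $t\ne i$, $\bar m$ is a generic monomial in variables $Y_{i,\sigma}^{-1}$, $\sigma\notin\{q^{-k},q^{-k+2},\dots,q^k\}$, and $m_{j+1}=m_jA^{-1}_{i,q^{-k+2j+1}}$. Shifted elementary blocks are the $\tau_\sigma B_i^{(k)}$. A variable $Y_{i,\sigma}$ in a monomial $m$ of a block of color $i$ is $i$-dominant (resp. $i$-anti-dominant) if $mA_{i,\sigma q^{-1}}^{-1}$ (resp. $mA_{i,\sigma q}$) is also in that block. A series $\chi\in\tilde{\mathcal Y}$ is a *(tame) $qq$-character* if for every $i\in I$ it is a sum of products of mutually generic shifted elementary blocks of color $i$. A variable in a monomial of $\chi$ is $i$-dominant (resp. $i$-anti-dominant) if it is so in one of the blocks of color $i$. **Graph.** A graph of $\chi$ (for a chosen way of writing $\chi$ as sums of products of blocks, for each color) is the colored directed graph whose vertices are the monomials of $\chi$, with an edge $m\xrightarrow{i,\sigma}m'$ of color $i$ if $m,m'$ belong to the same product of blocks of color $i$, $m'=mA_{i,\sigma}^{-1}$, $m$ contains the $i$-dominant variable $Y_{i,\sigma q}$ and $m'$ contains the $i$-anti-dominant variable $Y_{i,\sigma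 q^{-1}}$. **Admissible.** A degree zero $qq$-character is *admissible* if after the specialization $q=1$ it remains generic with all non-zero coefficients equal to one, and no cancellations of variables occur. From here on $\chi$ is admissible and everything (including $C$, $\sigma_{ij}$, the monomials, $A_{i,\sigma}$, and the graph with its edge labels and dominant/anti-dominant variables) is specialized at $q=1$; in particular $\sigma_{ii}=1$. **Field.** $\tilde R$ is the field of rational functions with complex coefficients in $q_1,q_2,\dots$, with the square roots $q_i^{1/2}$ adjoined. **Untangled.** Let $i,j\in I$ and let $\nu,\tau$ be monomials of $R$ with $\nu\ne\tau\sigma_{ij}^{\pm1}$. A *square* in $\chi$ associated to $i,j,\nu,\tau$ is a set of four distinct monomials $m_1,m_2,m_3,m_4$ with edges $m_1\xrightarrow{i,\nu}m_2$, $m_1\xrightarrow{j,\tau}m_3$, $m_2\xrightarrow{j,\tau}m_4$, $m_3\xrightarrow{i,\nu}m_4$ in the graph. Its constant is $c^{ij}_{\nu\tau}=\dfrac{\nu-\sigma_{ij}\tau}{\tau-\sigma_{ij}\nu}$. A *supplement* is a map $a$ from the set of edges of the graph to $\tilde R\setminus\{0\}$ such that for every such square $a(m_1,m_3)a(m_3,m_4)=c^{ij}_{\nu\tau}\,a(m_1,m_2)a(m_2,m_4)$. For $i\neq j$ and $\nu\ne\tau\sigma_{ij}^{\pm1}$, the graph has an *incomplete square* if it contains exactly three of the four monomials $m_1,\ m_2=m_1A_{i,\nu}^{-1},\ m_3=m_1A_{j,\tau}^{-1},\ m_4=m_1A_{i,\nu}^{-1}A_{j,\tau}^{-1}$, connected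 by two of the four arrows listed above. $\chi$ is *untangled* if it has a graph which has a supplement and no incomplete squares. **Algebra $U_C$.** Let $g_{ij}(z,w)=z-\sigma_{ij}w$ and $\delta(z)=\sum_{n\in\mathbb{Z}}z^n$. $U_C$ is the $\tilde R$-(super)algebra generated by the coefficients of $E_i(z)=\sum_{j\in\mathbb{Z}}E_{i,j}z^{-j}$, $F_i(z)=\sum_{j\in\mathbb{Z}}F_{i,j}z^{-j}$ (odd), $K_i^\pm(z)=\sum_{\pm j\ge0}K^{\pm}_{i,j}z^{-j}$ (even), $i\in I$, with relations (for all $i,j\in I$; no Serre relations): - all coefficients of $K_i^\pm(z)$, $K_j^\pm(w)$, $K_j^{\mp}(w)$ commute with each other, and $K_{i,0}^+K_{i,0}^-=1$; - $g_{ij}(z,w)K_i^\pm(z)E_j(w)+g_{ij}(w,z)E_j(w)K_i^\pm(z)=0$; - $g_{ij}(w,z)K_i^\pm(z)F_j(w)+g_{ij}(z,w)F_j(w)K_i^\pm(z)=0$; - $g_{ij}(z,w)E_i(z)E_j(w)-g_{ij}(w,z)E_j(w)E_i(z)=0$; - $g_{ij}(w,z)F_i(z)F_j(w)-g_{ij}(z,w)F_j(w)F_i(z)=0$; - $E_i(z)E_i(w)+E_i(w)E_i(z)=0$, $F_i(z)F_i(w)+F_i(w)F_i(z)=0$; - $E_i(z)F_j(w)+F_j(w)E_i(z)=\delta_{ij}\delta(z/w)(K_i^+(z)-K_i^-(w))$. **Functions $f_i$.** For $u\in\tilde R$ non-zero, $f_i$ is the multiplicative homomorphism from monomials of $\mathcal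 Y$ to rational functions in $z$ with $f_i(Y_{i,\sigma})=\dfrac{1}{\sigma^{-1/2}z-\sigma^{1/2}u}$ and $f_i(Y_{j,\sigma})=1$ for $j\ne i$. For degree zero $m$, $f_i(m)$ is a function of $u/z$, written $f_i(m;u/z)$; $f_i^{\pm}(m;u/z)$ denotes its expansion at $z^{\mp1}=0$.
   Formalization: In the definitions of square and incomplete square, the case i≠j, σ_ij=1, ν=τ (excluded by ν≠τσ_ij^{±1}) is included, with constant c=-1; without it the claim is false, since a supplement unconstrained on such squares can violate E_iF_j+F_jE_i=0. *)

(* Defs.v *)
From HB Require Import structures.
From mathcomp Require Import all_boot all_order all_algebra.
From mathcomp Require Import finmap.
From mathcomp Require Import generic_quotient ring_quotient fraction.
From mathcomp Require Import boolp classical_sets functions fsbigop.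
From mathcomp Require Import reals complex.
From mathcomp Require mpoly.
From mathcomp Require Import monalg.

Set Implicit Arguments.
Unset Strict Implicit.
Unset Printing Implicit Defensive.

Import Order.TTheory GRing.Theory Num.Theory.

Local Open Scope ring_scope.

(** * Monomials of R and the Cartan matrix *)

(* Monomials are written additively, by their exponents: [e : mon r] stands for
   prod_i q_i ^ (e i), and [(a, e) : qmon r] for q ^ a * prod_i q_i ^ (e i).
   So the product of monomials is [+], the inverse is [-], the monomial 1 is [0],
   and the specialization q = 1 is [snd]. *)
Notation mon r := {ffun 'I_r -> int}.
Notation qmon r := (int * {ffun 'I_r -> int})%type.

Definition qexp {r} (n : int) : qmon r := (n, 0).

Section Cartan.
Context (I : finType) (r : nat) (F : fieldType) (q : F) (x : 'I_r -> F).

Definition qmonval (e : qmon r) : F := q ^ e.1 * \prod_i x i ^ e.2 i.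

Definition cartan_mx (sigma : I -> I -> qmon r) : 'M[F]_#|I| :=
  \matrix_(s, t) (qmonval (sigma (enum_val s) (enum_val t)) -
                  (qmonval (sigma (enum_val s) (enum_val t)))^-1).
End Cartan.

(* The Laurent polynomials of R are viewed inside the fraction field of
   Z[q, q_1, .., q_r]; the variable of index 0 is q. *)
Section Fields.
Import mpoly.

Definition fracR (r : nat) : fieldType := {fraction (mpoly r.+1 int)}.
Definition fracR_var (r : nat) (i : 'I_r.+1) : fracR r := tofrac 'X_i.

(* The rational functions in q_1, q_2, .. with the square roots of the q_i
   adjoined are the rational functions in those square roots. *)
Definition Rtilde (R : realType) (r : nat) : fieldType :=
  {fraction (mpoly r R[i])}.
Definition Rtilde_sqrt (R : realType) (r : nat) (i : 'I_r) : Rtilde R r :=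
  tofrac 'X_i.
End Fields.

Definition is_cartan (I : finType) (r : nat) (sigma : I -> I -> qmon r) : Prop :=
  [/\ forall i j, sigma i j = sigma j i,
      forall i, sigma i i = qexp 1,
      \det (cartan_mx (fracR_var ord0) (fun i => fracR_var (lift ord0 i)) sigma)
        != 0
    & \det (cartan_mx 1 (fun i => fracR_var (lift ord0 i)) sigma) != 0].

(** * Monomials in the Y_{i,sigma} *)

(* Also written additively: [m@_(i, s)] is the power of Y_{i,s} in [m].  [G] is
   the group of monomials of R, before ([qmon r]) or after ([mon r]) the
   specialization q = 1. *)
Notation ymon I G := {malg int[(I * G)%type]}.

Section YMonomials.
Context (I : finType) (G : zmodType).
Implicit Types (i j : I) (s : G) (m : ymon I G).

Definition Y i s : ymon I G := << (i, s) >>.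

Definition ymap (H : zmodType) (f : G -> H) m : ymon I H :=
  \sum_(p <- msupp m) << m@_p *g (p.1, f p.2) >>.

Definition yshift s m := ymap (fun t => s + t) m.

Definition ydeg i m : int := \sum_(p <- msupp m | p.1 == i) m@_p.

Definition generic m : Prop := forall p, m@_p \in [:: -1; 0; 1].

Definition mutually_generic m m' : Prop :=
  [/\ generic m, generic m' & forall p, m@_p = 0 \/ m'@_p = 0].

(* The affine root A_{j,s}. *)
Definition root (sigma : I -> I -> G) j s : ymon I G :=
  yshift s (\sum_i (Y i (sigma i j) - Y i (- sigma i j))).

(* Formal sums of monomials, by their coefficients; [ymon I G] is countable for
   both values of [G], so that no condition on the support is needed. *)
Definition series := ymon I G -> int.

End YMonomials.

(* [c] has finite support and [v] is the sum of its values. *)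
Definition is_fin_sum (T : eqType) (c : T -> int) (v : int) : Prop :=
  exists s : seq T,
    [/\ uniq s, forall t, c t != 0 -> t \in s & v = \sum_(t <- s) c t].

(** * Blocks, qq-characters and their graphs *)

Section Blocks.
Context (I : finType) (r : nat) (sigma : I -> I -> qmon r).
Local Notation ymon := (ymon I (qmon r)).
Implicit Types (i : I) (s : qmon r) (m : ymon) (B : seq ymon).

(* A block is given by the list m_0, .., m_k of its monomials. *)
Definition elementary_block i B : Prop :=
  exists k (mb : ymon) (mbj : nat -> ymon),
  let Yq (l : nat) := Y i (qexp (2 * l%:Z - k%:Z)) : ymon in
  [/\ size B = k.+1,
      generic mb /\
        (forall p, mb@_p != 0 -> [/\ p.1 = i, mb@_p < 0 &
           forall l : nat, (l <= k)%N -> p.2 <> qexp (2 * l%:Z - k%:Z)]),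
      forall j, (j <= k)%N ->
        generic (mbj j) /\ (forall p, (mbj j)@_p != 0 -> p.1 <> i),
      forall j, (j <= k)%N ->
        nth 0 B j = mb + mbj j + \sum_(0 <= l < k.+1 | l != j) Yq l
    & forall j, (j < k)%N ->
        nth 0 B j.+1 = nth 0 B j - root sigma i (qexp (2 * j%:Z + 1 - k%:Z))].

Definition block i B : Prop :=
  exists s B0, elementary_block i B0 /\ B = map (yshift s) B0.

(* The variable Y_{i,s} of m, a monomial of the block B of color i. *)
Definition block_dominant i B m s : Prop :=
  [/\ 0 < m@_(i, s), m \in B & m - root sigma i (s - qexp 1) \in B].
Definition block_antidominant i B m s : Prop :=
  [/\ 0 < m@_(i, s), m \in B & m + root sigma i (s + qexp 1) \in B].

(* A product of blocks is given by the list of its factors. *)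
Definition block_product i (P : seq (seq ymon)) : Prop :=
  (forall B, B \in P -> block i B) /\
  (forall b b', (b < b' < size P)%N ->
     forall m m', m \in nth [::] P b -> m' \in nth [::] P b' ->
       mutually_generic m m').

(* The ways to choose one monomial in each factor: the monomials of the expanded
   product are the [ymonof c], [c] in [choices P]. *)
Definition choices (P : seq (seq ymon)) : seq (seq ymon) :=
  foldr (fun B cs => [seq m :: c | m <- B, c <- cs]) [:: [::]] P.
Definition ymonof (c : seq ymon) : ymon := \sum_(m <- c) m.

Definition product_coef (P : seq (seq ymon)) m : int :=
  (count (fun c => ymonof c == m) (choices P))%:Z.

Definition dominant i P c s : Prop :=
  0 < (ymonof c)@_(i, s) /\
  exists2 b, (b < size P)%N & block_dominant i (nth [::] P b) (nth 0 c b) s.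
Definition antidominant i P c s : Prop :=
  0 < (ymonof c)@_(i, s) /\
  exists2 b, (b < size P)%N & block_antidominant i (nth [::] P b) (nth 0 c b) s.

(* A way of writing chi as a sum of products of blocks of color i. *)
Record decomposition (chi : series I (qmon r)) i := Decomposition {
  dec_index : countType;
  dec_product : dec_index -> seq (seq ymon);
  dec_productP : forall t, block_product i (dec_product t);
  dec_sum : forall m,
    is_fin_sum (fun t => product_coef (dec_product t) m) (chi m)
}.

Definition qq_character (chi : series I (qmon r)) : Prop :=
  forall i, inhabited (decomposition chi i).

(* The edge m --> m' of color i and label s, before specialization. *)
Definition qedge chi (D : forall i, decomposition chi i) i s m m' : Prop :=
  exists (t : dec_index (D i)) c c', let P := dec_product t in
  [/\ c \in choices P /\ c' \in choices P,
      m = ymonof c /\ m' = ymonof c',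
      m' = m - root sigma i s,
      dominant i P c (s + qexp 1)
    & antidominant i P c' (s - qexp 1)].

End Blocks.

(** * Specialization q = 1 *)

Section Admissible.
Context (I : finType) (r : nat) (sigma : I -> I -> qmon r).
Context (chi : series I (qmon r)) (chi1 : series I (mon r)).

Definition yspec (m : ymon I (qmon r)) : ymon I (mon r) := ymap snd m.

(* chi1 is the specialization of chi. *)
Definition specializes : Prop :=
  forall m1, is_fin_sum (fun m => if yspec m == m1 then chi m else 0) (chi1 m1).

Definition admissible : Prop :=
  [/\ qq_character sigma chi,
      forall m i, chi m != 0 -> ydeg i m = 0,
      specializes,
      forall m1, chi1 m1 != 0 -> generic m1 /\ chi1 m1 = 1
    & forall m i s s', chi m != 0 -> 0 < m@_(i, s) -> m@_(i, s') < 0 ->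
        s.2 <> s'.2].
End Admissible.

Section Untangled.
Context (I : finType) (r : nat) (sigma : I -> I -> qmon r).
Context (chi : series I (qmon r)) (chi1 : series I (mon r)).
Context (D : forall i, decomposition sigma chi i).
Implicit Types (i j : I) (nu tau : mon r) (m n : ymon I (mon r)).

Definition sigma1 i j : mon r := (sigma i j).2.

Definition vertex m : bool := chi1 m != 0.

Definition edge i tau m n : Prop :=
  exists s (M N : ymon I (qmon r)),
    [/\ qedge D i s M N, s.2 = tau, yspec M = m & yspec N = n].

(* The condition nu <> tau sigma_ij^(+-1) says that the numerator and the
   denominator of c^ij_(nu,tau) are non-zero.  If sigma_ij = 1, the fraction is
   identically -1, and -1 is taken as its value for nu = tau too: squares of two
   different colors with equal labels do occur in that case, and E_i F_j + F_j E_i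
   can only vanish on them if they are complete and have constant -1. *)
Definition regular i j nu tau : Prop :=
  sigma1 i j = 0 \/ (nu <> tau + sigma1 i j /\ nu <> tau - sigma1 i j).

Definition square i j nu tau m1 m2 m3 m4 : Prop :=
  [/\ regular i j nu tau, uniq [:: m1; m2; m3; m4],
      edge i nu m1 m2 /\ edge j tau m1 m3
    & edge j tau m2 m4 /\ edge i nu m3 m4].

Definition incomplete_square i j nu tau m1 : Prop :=
  let m2 := m1 - root sigma1 i nu in
  let m3 := m1 - root sigma1 j tau in
  let m4 := m1 - root sigma1 i nu - root sigma1 j tau in
  [/\ i <> j, regular i j nu tau,
      (vertex m1 + vertex m2 + vertex m3 + vertex m4 = 3)%N
    & (`[< edge i nu m1 m2 >] + `[< edge j tau m1 m3 >]
       + `[< edge j tau m2 m4 >] + `[< edge i nu m3 m4 >] = 2)%N].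

Definition no_incomplete_squares : Prop :=
  forall i j nu tau m1, ~ incomplete_square i j nu tau m1.

(* [x i] is the square root of q_i; [monval] and [hmonval] give the value of a
   monomial and of its square root. *)
Context (K : fieldType) (x : 'I_r -> K).

Definition monval (e : mon r) : K := \prod_i (x i ^+ 2) ^ e i.
Definition hmonval (e : mon r) : K := \prod_i x i ^ e i.

Definition square_const i j nu tau : K :=
  if sigma1 i j == 0 then -1 else
  (monval nu - monval (sigma1 i j) * monval tau) /
  (monval tau - monval (sigma1 i j) * monval nu).

(* Only the values of [a] on pairs of monomials joined by an edge matter; an edge
   is determined by its two ends, the A_{i,tau} being independent. *)
Definition supplement (a : ymon I (mon r) -> ymon I (mon r) -> K) : Prop :=
  (forall i tau m n, edge i tau m n -> a m n != 0) /\
  (forall i j nu tau m1 m2 m3 m4, square i j nu tau m1 m2 m3 m4 ->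
     a m1 m3 * a m3 m4 = square_const i j nu tau * (a m1 m2 * a m2 m4)).

End Untangled.

(** * Rational functions in z and their expansions *)

Section Expansions.
Context (K : fieldType).
Implicit Types (P Q : {poly K}) (f : {fraction {poly K}}) (c : int -> K).

(* The Laurent series [\sum_n c n * z ^ n] times Q is equal to P. *)
Definition quotient_series P Q c : Prop :=
  forall n : int, \sum_(k < size Q) Q`_k * c (n - k%:Z) =
    if n is Posz p then P`_p else 0.

(* Laurent expansion of f in the powers of z - w. *)
Definition is_expansion_at (w : K) f c : Prop :=
  (exists N : int, forall n, n < N -> c n = 0) /\
  (exists P Q, [/\ Q != 0, f = tofrac P / tofrac Q
     & quotient_series (P \Po ('X + w%:P)) (Q \Po ('X + w%:P)) c]).

(* Laurent expansion of f at z^-1 = 0; [c n] is still the coefficient of z^n. *)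
Definition is_expansion_oo f c : Prop :=
  (exists N : int, forall n, N < n -> c n = 0) /\
  (exists P Q, [/\ Q != 0, f = tofrac P / tofrac Q & quotient_series P Q c]).

Definition expansion_at (w : K) f : int -> K :=
  xget (fun=> 0) [set c | is_expansion_at w f c]%classic.
Definition expansion_oo f : int -> K :=
  xget (fun=> 0) [set c | is_expansion_oo f c]%classic.

(* The residue of f dz at z = w. *)
Definition residue (w : K) f : K := expansion_at w f (-1).

Context (I : finType) (r : nat) (x : 'I_r -> K) (u : K).

Definition fY (i : I) (m : ymon I (mon r)) : {fraction {poly K}} :=
  \prod_(p <- msupp m | p.1 == i)
    (tofrac ((hmonval x p.2)^-1 *: 'X - (hmonval x p.2 * u)%:P))^-1 ^ m@_p.

(* The coefficients of the expansions at z^-1 = 0 (b = true) and z = 0. *)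
Definition fpm (b : bool) (i : I) (m : ymon I (mon r)) : int -> K :=
  if b then expansion_oo (fY i m) else expansion_at 0 (fY i m).

End Expansions.

(** * The algebra U_C *)

(* [UK i true n] is K^+_{i,n} and [UK i false n] is K^-_{i,-n}. *)
Inductive ugen (I : Type) : Type :=
  UE of I & int | UF of I & int | UK of I & bool & nat.

Section UGenChoice.
Context (I : choiceType).
Definition ugen_code (g : ugen I) : I * (int + int + bool * nat) :=
  match g with
  | UE i n => (i, inl (inl n))
  | UF i n => (i, inl (inr n))
  | UK i b n => (i, inr (b, n))
  end.
Definition ugen_decode (t : I * (int + int + bool * nat)) : ugen I :=
  match t with
  | (i, inl (inl n)) => UE i n
  | (i, inl (inr n)) => UF i n
  | (i, inr (b, n)) => UK i b n
  end.
Lemma ugen_codeK : cancel ugen_code ugen_decode.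
Proof. by case. Qed.
HB.instance Definition _ := Choice.copy (ugen I) (can_type ugen_codeK).
End UGenChoice.

(* Formal distributions in z and w are given by the coefficients d m n of
   z^-m w^-n. *)
Section Distributions.
Context (K : fieldType) (A : lalgType K).
Implicit Types (X Y : int -> A) (d : int -> int -> A).

Definition prod_zw X Y : int -> int -> A := fun m n => X m * Y n. (* X(z) Y(w) *)
Definition prod_wz Y X : int -> int -> A := fun m n => Y n * X m. (* Y(w) X(z) *)

(* Multiplication by z - s w and by w - s z. *)
Definition gzw (s : K) d : int -> int -> A :=
  fun m n => d (m + 1) n - s *: d m (n + 1).
Definition gwz (s : K) d : int -> int -> A :=
  fun m n => d m (n + 1) - s *: d (m + 1) n.

(* Multiplication of X(z), or equally of X(w), by delta(z/w). *)
Definition delta_zw X : int -> int -> A := fun m n => X (m + n).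

End Distributions.

Section UAlgebra.
Context (K : fieldType) (I : finType) (s : I -> I -> K).

Definition ufree := {malg K[{fmonom (ugen I)}]}.
HB.instance Definition _ := GRing.Lalgebra.on ufree.

Definition uvar (g : ugen I) : ufree := << fmu g >>.

Definition Eser (i : I) : int -> ufree := fun n => uvar (UE i n).
Definition Fser (i : I) : int -> ufree := fun n => uvar (UF i n).
Definition Kser (b : bool) (i : I) : int -> ufree := fun n =>
  if b then (if n is Posz p then uvar (UK i true p) else 0)
  else (if - n is Posz p then uvar (UK i false p) else 0).

Inductive urel : ufree -> Prop :=
| urel_KK b b' i j m n :
    urel (prod_zw (Kser b i) (Kser b' j) m n - prod_wz (Kser b' j) (Kser b i) m n)
| urel_K0 i : urel (Kser true i 0 * Kser false i 0 - 1)
| urel_KE b i j m n :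
    urel (gzw (s i j) (prod_zw (Kser b i) (Eser j)) m n +
          gwz (s i j) (prod_wz (Eser j) (Kser b i)) m n)
| urel_KF b i j m n :
    urel (gwz (s i j) (prod_zw (Kser b i) (Fser j)) m n +
          gzw (s i j) (prod_wz (Fser j) (Kser b i)) m n)
| urel_EE i j m n :
    urel (gzw (s i j) (prod_zw (Eser i) (Eser j)) m n -
          gwz (s i j) (prod_wz (Eser j) (Eser i)) m n)
| urel_FF i j m n :
    urel (gwz (s i j) (prod_zw (Fser i) (Fser j)) m n -
          gzw (s i j) (prod_wz (Fser j) (Fser i)) m n)
| urel_EE0 i m n :
    urel (prod_zw (Eser i) (Eser i) m n + prod_wz (Eser i) (Eser i) m n)
| urel_FF0 i m n :
    urel (prod_zw (Fser i) (Fser i) m n + prod_wz (Fser i) (Fser i) m n)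
| urel_EF i j m n :
    urel (prod_zw (Eser i) (Fser j) m n + prod_wz (Fser j) (Eser i) m n -
          (if i == j then delta_zw (Kser true i) m n - delta_zw (Kser false i) m n
           else 0)).

(* The two-sided ideal generated by the relations. *)
Inductive in_uideal : ufree -> Prop :=
| in_uideal_rel a of urel a : in_uideal a
| in_uideal0 : in_uideal 0
| in_uidealB a b of in_uideal a & in_uideal b : in_uideal (a - b)
| in_uidealM a b c of in_uideal b : in_uideal (a * b * c).

Definition uideal : {pred ufree} := fun a => `[< in_uideal a >].

Lemma uideal_zmod : zmod_closed uideal.
Proof.
split=> [|a b]; first by apply/asboolP; exact: in_uideal0.
by move=> /asboolP ha /asboolP hb; apply/asboolP; exact: in_uidealB.
Qed.
HB.instance Definition _ := GRing.isZmodClosed.Build ufree uideal uideal_zmod.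

Lemma uideal_mull a b : b \in uideal -> a * b \in uideal.
Proof.
by move=> /asboolP h; apply/asboolP; rewrite -[a * b]mulr1; exact: in_uidealM.
Qed.
Lemma uideal_mulr a b : a \in uideal -> a * b \in uideal.
Proof.
by move=> /asboolP h; apply/asboolP; rewrite -[a]mul1r; exact: in_uidealM.
Qed.
Lemma uideal_scale c a : a \in uideal -> c *: a \in uideal.
Proof. by move=> h; rewrite -[a]mul1r scalerAl uideal_mull. Qed.

Definition UC : Type := ring_quotient.Quotient.quot uideal.
HB.instance Definition _ := GRing.Zmodule.on UC.
HB.instance Definition _ := EqQuotient.on UC.

Definition upi (a : ufree) : UC := \pi_(ring_quotient.Quotient.quot uideal)%qT a.

Lemma upi_eq a b : upi a = upi b <-> a - b \in uideal.
Proof. by rewrite ring_quotient.Quotient.idealrBE; split=> /eqP. Qed.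

Lemma upi_repr (y : UC) : upi (repr y) = y.
Proof. exact: reprK. Qed.

Lemma repr_upi a : repr (upi a) - a \in uideal.
Proof. by apply/upi_eq; rewrite upi_repr. Qed.

Lemma upiD a b : upi (a + b) = upi a + upi b.
Proof. exact: (ring_quotient.Quotient.pi_add uideal a b). Qed.

Definition uone : UC := upi 1.
Definition umul (y z : UC) : UC := upi (repr y * repr z).
Definition uscale (c : K) (y : UC) : UC := upi (c *: repr y).

Lemma upiM a b : upi (a * b) = umul (upi a) (upi b).
Proof.
symmetry; rewrite /umul; apply/upi_eq.
have [ha hb] := (repr_upi a, repr_upi b).
move: (repr (upi a)) (repr (upi b)) ha hb => a' b' ha hb.
have -> : a' * b' - a * b = (a' - a) * b' + a * (b' - b).
  by rewrite mulrBl mulrBr addrA subrK.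
by apply: rpredD; [exact: uideal_mulr | exact: uideal_mull].
Qed.

Lemma upiZ c a : upi (c *: a) = uscale c (upi a).
Proof.
symmetry; rewrite /uscale; apply/upi_eq.
by rewrite -scalerBr; exact/uideal_scale/repr_upi.
Qed.

Lemma umulA : associative umul.
Proof.
by move=> a b c; rewrite -(upi_repr a) -(upi_repr b) -(upi_repr c) -!upiM mulrA.
Qed.
Lemma umul1 : left_id uone umul.
Proof. by move=> a; rewrite -(upi_repr a) -upiM mul1r. Qed.
Lemma umulr1 : right_id uone umul.
Proof. by move=> a; rewrite -(upi_repr a) -upiM mulr1. Qed.
Lemma umulDl : left_distributive umul +%R.
Proof.
move=> a b c; rewrite -(upi_repr a) -(upi_repr b) -(upi_repr c).
by rewrite -upiD -!upiM mulrDl upiD.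
Qed.
Lemma umulDr : right_distributive umul +%R.
Proof.
move=> a b c; rewrite -(upi_repr a) -(upi_repr b) -(upi_repr c).
by rewrite -upiD -!upiM mulrDr upiD.
Qed.
HB.instance Definition _ :=
  GRing.Zmodule_isPzRing.Build UC umulA umul1 umulr1 umulDl umulDr.

Lemma uscaleA c d y : uscale c (uscale d y) = uscale (c * d) y.
Proof. by rewrite -(upi_repr y) -!upiZ scalerA. Qed.
Lemma uscale1 : left_id 1 uscale.
Proof. by move=> y; rewrite -(upi_repr y) -upiZ scale1r. Qed.
Lemma uscaleDr : right_distributive uscale +%R.
Proof.
move=> c y z; rewrite -(upi_repr y) -(upi_repr z).
by rewrite -upiD -!upiZ scalerDr upiD.
Qed.
Lemma uscaleDl y : {morph uscale^~ y : c d / c + d}.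
Proof. by move=> c d; rewrite -(upi_repr y) -!upiZ scalerDl upiD. Qed.
HB.instance Definition _ :=
  GRing.Zmodule_isLmodule.Build K UC uscaleA uscale1 uscaleDr uscaleDl.

(* The coefficients of z^-n in E_i(z), F_i(z) and K_i^+-(z). *)
Definition UCE (i : I) (n : int) : UC := upi (Eser i n).
Definition UCF (i : I) (n : int) : UC := upi (Fser i n).
Definition UCK (b : bool) (i : I) (n : int) : UC := upi (Kser b i n).

(* [act] makes the vector space M a left U_C-module. *)
Definition UC_module (M : lmodType K) (act : UC -> M -> M) : Prop :=
  [/\ forall y, linear (act y),
      forall v, act 1 v = v,
      forall y z v, act (y * z) v = act y (act z v),
      forall y z v, act (y + z) v = act y v + act z v
    & forall c y v, act (c *: y) v = c *: act y v].

End UAlgebra.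

(* Main.v *)
(* Write F_i(z) as the sum over tau of delta(tau u/z) F_{i,tau}, where F_{i,tau}
   moves along the edges of label (i, tau), and similarly for E_i(z). Then every
   relation of U_C reduces to identities between the weights a, b along the paths
   of length two with given labels. Two such paths with the same ends and the
   same two labels bound a square, and the identity is the defining property of
   the supplement combined with f_j(m A_{i,tau}^{-1}) = f_j(m) times
   (z - s_{ij} tau u) / (s_{ij} z - tau u). A missing fourth vertex is
   excluded by the absence of incomplete squares when the two labels are in
   general position, and by genericity otherwise. For a single color the squares
   come from the products of blocks, whose factors have at most two monomials at
   q = 1, because a longer block contains the square of a variable. What is left
   is the diagonal part of the relation between E_i and F_i: since f_i(m) has
   simple poles, its two expansions differ by a sum of delta functions weighted
   by the residues, and each pole is the i-dominant or i-anti-dominant variable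
   of exactly one edge at m. *)
Require Import Defs.
From HB Require Import structures.
From mathcomp Require Import all_boot all_order all_algebra.
From mathcomp Require Import finmap fraction.
From mathcomp Require Import boolp classical_sets functions fsbigop.
From mathcomp Require Import reals monalg.
From mathcomp Require mpoly.
From mathcomp Require Import ring zify.

Set Implicit Arguments.
Unset Strict Implicit.
Unset Printing Implicit Defensive.

Import Order.TTheory GRing.Theory Num.Theory.

Local Open Scope ring_scope.

(** Genericity excludes every special position of the labels in E_i F_j and F_j E_i, but not in F_i
    F_j and E_i E_j. There one special position survives, and the square is not completed at all:
    the factor in front of that product, such as g_ij(w,z), vanishes on its delta functions. Edges
    are defined before the specialization and used after it. The bridge is the uniqueness of lifts:
    all multiplicities are nonnegative and equal to one at q = 1, so that a vertex comes from a
    single choice of one monomial in each factor, and an edge replaces the upper monomial of one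
    factor by the lower one. A fourth vertex does not yet give the two missing edges. They are
    recovered from exponents: a variable with exponent one at a vertex always carries an edge,
    outgoing or incoming. The diagonal of C vanishes at q = 1, so that A_i has no variable of color
    i. Moves of color i are therefore detected through another color l with sigma_li different from
    1, which exists by non-degeneracy. Around a square the supplement contributes p/q, and each
    passage of a residue along an edge contributes -q/p, where p/q is the constant of the square;
    the E_i F_j and E_i E_j relations follow. *)

Local Notation root := Defs.root.

(** * Modules over U_C given by series of operators *)

Section UnbundledLinear.
Context (K : fieldType) (U W : lmodType K) (f : U -> W).
Hypothesis lf : linear f.

Lemma linD : {morph f : y z / y + z}.
Proof. by move=> y z; rewrite -[y]scale1r lf !scale1r. Qed.
Lemma lin0 : f 0 = 0.
Proof. by apply: (addrI (f 0)); rewrite -linD !addr0. Qed.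
Lemma linZ c : {morph f : y / c *: y}.
Proof. by move=> y; rewrite -[c *: y in LHS]addr0 lf lin0 addr0. Qed.
Lemma linN : {morph f : y / - y}.
Proof. by move=> y; rewrite -!scaleN1r linZ. Qed.
Lemma linB : {morph f : y z / y - z}.
Proof. by move=> y z; rewrite linD linN. Qed.
Lemma lin_sum (T : Type) (s : seq T) (P : pred T) (g : T -> U) :
  f (\sum_(t <- s | P t) g t) = \sum_(t <- s | P t) f (g t).
Proof. exact: (big_morph f linD lin0). Qed.

End UnbundledLinear.

Section LinearCombinators.
Context (K : fieldType) (U V W : lmodType K).
Implicit Types (f g : U -> V).

Lemma linear_add f g : linear f -> linear g -> linear (fun v => f v + g v).
Proof. by move=> lf lg c v v'; rewrite lf lg scalerDr addrACA. Qed.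

Lemma linear_scale d f : linear f -> linear (fun v => d *: f v).
Proof. by move=> lf c v v'; rewrite lf scalerDr !scalerA mulrC. Qed.

Lemma linear_sub f g : linear f -> linear g -> linear (fun v => f v - g v).
Proof.
move=> lf lg; rewrite (_ : (fun v => _) = fun v => f v + (-1) *: g v).
  exact/linear_add/linear_scale.
by apply/funext => v; rewrite scaleN1r.
Qed.

Lemma linear_comp (h : V -> W) f : linear h -> linear f -> linear (h \o f).
Proof. by move=> lh lf c v v' /=; rewrite lf lh. Qed.

End LinearCombinators.

Lemma malgZU (K : fieldType) (G : choiceType) (c : K) (g : G) :
  << c *g g >> = c *: << g >> :> {malg K[G]}.
Proof. by apply/malgP => g'; rewrite mcoeffZ !mcoeffU mulrnAr mulr1. Qed.

Lemma malgMUU (K : fieldType) (G : monomType) (c c' : K) (g g' : G) :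
  << c *g g >> * << c' *g g' >> = (c * c') *: << mmul g g' >> :> {malg K[G]}.
Proof. by rewrite malgM_def -malgZU; apply: etrans (fgmulUU _ _ _ _) _. Qed.

Section LinearExtension.
Context (K : fieldType) (G : choiceType) (W : lmodType K).
Implicit Types (f : G -> W) (y z : {malg K[G]}).

Definition lext f y : W := \sum_(g <- msupp y) y@_g *: f g.

Lemma lextEw (d : {fset G}) f y : (msupp y `<=` d)%fset ->
  lext f y = \sum_(g <- d) y@_g *: f g.
Proof.
move=> le; rewrite /lext (big_fset_incl _ le) // => g _ /mcoeff_outdom ->.
by rewrite scale0r.
Qed.

Lemma lext_linear f : linear (lext f).
Proof.
move=> c y z; pose d := (msupp y `|` msupp z `|` msupp (c *: y + z))%fset.
have hy : (msupp y `<=` d)%fset by rewrite /d -fsetUA fsubsetUl.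
have hz : (msupp z `<=` d)%fset by rewrite /d fsubsetU // fsubsetUr.
have hyz : (msupp (c *: y + z) `<=` d)%fset by rewrite /d fsubsetUr.
rewrite (lextEw _ hy) (lextEw _ hz) (lextEw _ hyz) scaler_sumr -big_split /=.
by apply: eq_bigr => g _; rewrite mcoeffD mcoeffZ scalerDl scalerA.
Qed.

Lemma lextU f c g : lext f << c *g g >> = c *: f g.
Proof.
rewrite (lextEw (d := [fset g]%fset)) ?msuppU_le // big_seq_fset1.
by rewrite mcoeffUU.
Qed.

Lemma eq_linear_malg (h h' : {malg K[G]} -> W) : linear h -> linear h' ->
  (forall g, h << g >> = h' << g >>) -> h =1 h'.
Proof.
move=> lh lh' e y.
have lS (k : {malg K[G]} -> W) : linear k ->
    k y = \sum_(g <- msupp y) y@_g *: k << g >>.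
  move=> lk; rewrite {1}(monalgE y).
  rewrite lin_sum //; apply: eq_bigr => g _; rewrite -linZ //; congr k.
  exact: malgZU.
by rewrite (lS _ lh) (lS _ lh'); apply: eq_bigr => g _; rewrite e.
Qed.

End LinearExtension.

(** * Descent of an action from the free algebra to U_C *)

Section ModuleOfOperators.
Context (K : fieldType) (I : finType) (s : I -> I -> K) (M : lmodType K).
Context (op : ugen I -> M -> M) (op_linear : forall g, linear (op g)).

Definition opw (w : seq (ugen I)) : M -> M := foldr (fun g h => op g \o h) id w.

Definition fact (y : ufree K I) (v : M) : M :=
  lext (fun w : {fmonom (ugen I)} => opw w v) y.

Lemma opw_linear w : linear (opw w).
Proof. by elim: w => [|g w IH] c v v' //=; rewrite IH op_linear. Qed.

Lemma opw_cat w w' v : opw (w ++ w') v = opw w (opw w' v).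
Proof. by elim: w => //= g w ->. Qed.

Lemma fact_linear v : linear (fact^~ v).
Proof. exact: lext_linear. Qed.

Lemma fact_linearr y : linear (fact y).
Proof.
move=> c v v'; rewrite /fact /lext scaler_sumr -big_split /=.
by apply: eq_bigr => w _; rewrite opw_linear scalerDr !scalerA mulrC.
Qed.

Lemma factD y z v : fact (y + z) v = fact y v + fact z v.
Proof. exact: (linD (fact_linear v)). Qed.
Lemma factB y z v : fact (y - z) v = fact y v - fact z v.
Proof. exact: (linB (fact_linear v)). Qed.
Lemma fact0 v : fact 0 v = 0.
Proof. exact: (lin0 (fact_linear v)). Qed.
Lemma factZ c y v : fact (c *: y) v = c *: fact y v.
Proof. exact: (linZ (fact_linear v)). Qed.

Lemma fact_var g v : fact (uvar K g) v = op g v.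
Proof. by rewrite /fact lextU scale1r fmU. Qed.

Lemma fact1 v : fact 1 v = v.
Proof. by rewrite /fact lextU scale1r fm1. Qed.

(** Both factors are expanded in words; there multiplication is concatenation and the action is
    composition. *)
Lemma factM y z v : fact (y * z) v = fact y (fact z v).
Proof.
have -> : y * z = \sum_(w <- msupp y) \sum_(w' <- msupp z)
    (y@_w * z@_w') *: (<< fmmul w w' >> : ufree K I).
  rewrite [in LHS](monalgE y) mulr_suml; apply: eq_bigr => w _.
  rewrite [in LHS](monalgE z) mulr_sumr; apply: eq_bigr => w' _.
  exact: malgMUU.
rewrite (lin_sum (fact_linear v)) [RHS]/fact /lext; apply: eq_bigr => w _.
rewrite (lin_sum (fact_linear v)) [in RHS]/fact /lext.
rewrite (lin_sum (opw_linear _)) scaler_sumr; apply: eq_bigr => w' _.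
rewrite factZ (linZ (opw_linear _)) scalerA -opw_cat -fmM.
by rewrite /fact lextU scale1r.
Qed.

Section SeriesProducts.
Context (X Y : int -> ufree K I) (oX oY : int -> M -> M) (c : K).
Hypotheses (hX : forall n v, fact (X n) v = oX n v)
  (hY : forall n v, fact (Y n) v = oY n v).
Implicit Types (m n : int) (v : M).

Lemma fact_zw m n v : fact (prod_zw X Y m n) v = oX m (oY n v).
Proof. by rewrite factM hX hY. Qed.

Lemma fact_wz m n v : fact (prod_wz Y X m n) v = oY n (oX m v).
Proof. by rewrite factM hX hY. Qed.

Lemma fact_gzw_zw m n v : fact (gzw c (prod_zw X Y) m n) v =
  oX (m + 1) (oY n v) - c *: oX m (oY (n + 1) v).
Proof.
rewrite factB factZ.
by apply: (congr2 (fun a b => a - c *: b)); exact: fact_zw.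
Qed.

Lemma fact_gwz_zw m n v : fact (gwz c (prod_zw X Y) m n) v =
  oX m (oY (n + 1) v) - c *: oX (m + 1) (oY n v).
Proof.
rewrite factB factZ.
by apply: (congr2 (fun a b => a - c *: b)); exact: fact_zw.
Qed.

Lemma fact_gzw_wz m n v : fact (gzw c (prod_wz Y X) m n) v =
  oY n (oX (m + 1) v) - c *: oY (n + 1) (oX m v).
Proof.
rewrite factB factZ.
by apply: (congr2 (fun a b => a - c *: b)); exact: fact_wz.
Qed.

Lemma fact_gwz_wz m n v : fact (gwz c (prod_wz Y X) m n) v =
  oY (n + 1) (oX m v) - c *: oY n (oX (m + 1) v).
Proof.
rewrite factB factZ.
by apply: (congr2 (fun a b => a - c *: b)); exact: fact_wz.
Qed.

End SeriesProducts.

Hypothesis op_rel : forall y v, urel s y -> fact y v = 0.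

Lemma fact_ideal y v : y \in uideal s -> fact y v = 0.
Proof.
move=> /asboolP h; elim: h v => {y}.
- by move=> y h v; exact: op_rel.
- exact: fact0.
- by move=> y z _ hy _ hz v; rewrite factB hy hz subrr.
- by move=> y z t _ hz v; rewrite !factM hz (lin0 (fact_linearr _)).
Qed.

(** The representative is immaterial, because the ideal acts by zero ([fact_ideal]). *)
Definition uact (y : UC s) (v : M) : M := fact (repr y) v.

Lemma uact_upi y v : uact (upi s y) v = fact y v.
Proof.
apply/eqP; rewrite -subr_eq0 -factB; apply/eqP/fact_ideal.
exact: repr_upi.
Qed.

Lemma uact_module : UC_module uact.
Proof.
split.
- by move=> y; exact: fact_linearr.
- by move=> v; rewrite [1]/(upi s 1) uact_upi fact1.
- move=> y z v; rewrite (_ : y * z = upi s (repr y * repr z)) // uact_upi.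
  exact: factM.
- move=> y z v; rewrite -{1}(upi_repr y) -{1}(upi_repr z).
  by rewrite -upiD uact_upi factD.
- move=> c y v; rewrite (_ : c *: y = upi s (c *: repr y)) // uact_upi.
  exact: factZ.
Qed.

End ModuleOfOperators.

Section ModuleOfSeries.
Context (K : fieldType) (I : finType) (s : I -> I -> K) (M : lmodType K).
Context (E F : I -> int -> M -> M) (Q : bool -> I -> int -> M -> M).
Hypotheses (E_linear : forall i n, linear (E i n))
  (F_linear : forall i n, linear (F i n))
  (Q_linear : forall b i n, linear (Q b i n)).
Hypotheses (Qp0 : forall i n v, n < 0 -> Q true i n v = 0)
  (Qm0 : forall i n v, 0 < n -> Q false i n v = 0).
Hypotheses
  (QQ : forall b b' i j m n v,
     Q b i m (Q b' j n v) = Q b' j n (Q b i m v))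
  (Q0 : forall i v, Q true i 0 (Q false i 0 v) = v)
  (QE : forall b i j m n v,
     Q b i (m + 1) (E j n v) - s i j *: Q b i m (E j (n + 1) v) +
     (E j (n + 1) (Q b i m v) - s i j *: E j n (Q b i (m + 1) v)) = 0)
  (QF : forall b i j m n v,
     Q b i m (F j (n + 1) v) - s i j *: Q b i (m + 1) (F j n v) +
     (F j n (Q b i (m + 1) v) - s i j *: F j (n + 1) (Q b i m v)) = 0)
  (EE : forall i j m n v,
     E i (m + 1) (E j n v) - s i j *: E i m (E j (n + 1) v) -
     (E j (n + 1) (E i m v) - s i j *: E j n (E i (m + 1) v)) = 0)
  (FF : forall i j m n v,
     F i m (F j (n + 1) v) - s i j *: F i (m + 1) (F j n v) -
     (F j n (F i (m + 1) v) - s i j *: F j (n + 1) (F i m v)) = 0)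
  (EE0 : forall i m n v, E i m (E i n v) + E i n (E i m v) = 0)
  (FF0 : forall i m n v, F i m (F i n v) + F i n (F i m v) = 0)
  (EF : forall i j m n v, E i m (F j n v) + F j n (E i m v) =
     if i == j then Q true i (m + n) v - Q false i (m + n) v else 0).

(** The hypotheses are the relations of U_C read on the coefficients of z^-m w^-n. [Qp0] and [Qm0]
    are there because K^+ and K^- have generators on one side only, and [Kser] is zero on the
    other. *)
Theorem UC_module_of_series : exists act : UC s -> M -> M,
  [/\ UC_module act,
      forall b i n v, act (UCK s b i n) v = Q b i n v,
      forall i n v, act (UCF s i n) v = F i n v
    & forall i n v, act (UCE s i n) v = E i n v].
Proof.
(* [UK i false n] is the coefficient of index -n of K^-_i, hence the sign in the last branch. *)
pose op (g : ugen I) : M -> M := match g with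
  | UE i n => E i n
  | UF i n => F i n
  | UK i b n => Q b i (if b then n%:Z else - n%:Z) end.
have op_linear g : linear (op g).
  by case: g => [i n|i n|i b n]; [exact: E_linear|exact: F_linear|exact: Q_linear].
have fE i n v : fact op (Eser K i n) v = E i n v by rewrite fact_var.
have fF i n v : fact op (Fser K i n) v = F i n v by rewrite fact_var.
have fK b i n v : fact op (Kser K b i n) v = Q b i n v.
  case: b => /=; first by case: n => n; rewrite ?fact_var // fact0 Qp0.
  case def_n: (- n) => [p|p]; first by rewrite fact_var /= -def_n opprK.
  rewrite fact0 Qm0 // -oppr_lt0 def_n //.
have op_rel y v : urel s y -> fact op y v = 0.
  case=> [b b' i j m n|i|b i j m n|b i j m n|i j m n|i j m n|i m n|i m n
         |i j m n].
  - rewrite factB; apply: etrans (congr2 (fun a b => a - b)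
      (fact_zw op_linear (fK b i) (fK b' j) m n v) (fact_wz op_linear (fK b i) (fK b' j) m n v)) _.
    by rewrite QQ subrr.
  - have KK := fact_zw op_linear (fK true i) (fK false i) 0 0 v.
    by rewrite factB (etrans KK (Q0 i v)) fact1 subrr.
  - rewrite factD; apply: etrans (congr2 (fun a b => a + b)
      (fact_gzw_zw op_linear _ (fK b i) (fE j) m n v) (fact_gwz_wz op_linear _ (fK b i) (fE j) m n v)) _.
    by rewrite QE.
  - rewrite factD; apply: etrans (congr2 (fun a b => a + b)
      (fact_gwz_zw op_linear _ (fK b i) (fF j) m n v) (fact_gzw_wz op_linear _ (fK b i) (fF j) m n v)) _.
    by rewrite QF.
  - rewrite factB; apply: etrans (congr2 (fun a b => a - b)
      (fact_gzw_zw op_linear _ (fE i) (fE j) m n v) (fact_gwz_wz op_linear _ (fE i) (fE j) m n v)) _.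
    by rewrite EE.
  - rewrite factB; apply: etrans (congr2 (fun a b => a - b)
      (fact_gwz_zw op_linear _ (fF i) (fF j) m n v) (fact_gzw_wz op_linear _ (fF i) (fF j) m n v)) _.
    by rewrite FF.
  - rewrite factD; apply: etrans (congr2 (fun a b => a + b)
      (fact_zw op_linear (fE i) (fE i) m n v) (fact_wz op_linear (fE i) (fE i) m n v)) _.
    by rewrite EE0.
  - rewrite factD; apply: etrans (congr2 (fun a b => a + b)
      (fact_zw op_linear (fF i) (fF i) m n v) (fact_wz op_linear (fF i) (fF i) m n v)) _.
    by rewrite FF0.
  - rewrite factB factD; apply: etrans (congr2 (fun a b => a + b - _)
      (fact_zw op_linear (fE i) (fF j) m n v)
      (fact_wz op_linear (fE i) (fF j) m n v)) _.
    rewrite EF; case: eqP => _; last by rewrite fact0 subrr.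
    by rewrite factB /delta_zw (fK true) (fK false) subrr.
exists (uact (s := s) op); split=> [|b i n v|i n v|i n v]; first exact: uact_module.
- by rewrite uact_upi // fK.
- by rewrite uact_upi // fF.
- by rewrite uact_upi // fE.
Qed.

End ModuleOfSeries.

(** * Modules carried by the vertices of a colored graph *)

Section Correspondences.
Context (K : fieldType) (V : choiceType).
Local Notation M := {malg K[V]}.

Definition functional_rel (e : V -> V -> Prop) : Prop :=
  forall x y y', e x y -> e x y' -> y = y'.

Definition corr (e : V -> V -> Prop) (k : V -> V -> K) (x : V) : M :=
  \sum_(y \in [set y | e x y]%classic) k x y *: << y >>.

Definition corr_op e k : M -> M := lext (corr e k).

Lemma corr_op_linear e k : linear (corr_op e k).
Proof. exact: lext_linear. Qed.

Lemma corr_opU e k x : corr_op e k << x >> = corr e k x.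
Proof. by rewrite /corr_op lextU scale1r. Qed.

Lemma corrE e k x y : functional_rel e -> e x y ->
  corr e k x = k x y *: << y >>.
Proof.
move=> fe exy; rewrite /corr (_ : [set _ | _]%classic = [set y]%classic).
  by rewrite fsbig_set1.
by apply/seteqP; split=> z /=; [move/(fe _ _ _ exy) | move=> ->].
Qed.

Lemma corr0 e k x : (forall y, ~ e x y) -> corr e k x = 0.
Proof. by move=> h; rewrite /corr fsbig1 // => y /h. Qed.

(** Since both relations are functional, at most one path of length two starts at [x], and the
    composition is the weight of that path or zero. *)
Lemma corr_comp e1 e2 k1 k2 x : functional_rel e1 -> functional_rel e2 ->
  (exists y z, [/\ e2 x y, e1 y z &
     corr_op e1 k1 (corr_op e2 k2 << x >>) = (k2 x y * k1 y z) *: << z >>]) \/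
  (forall y z, e2 x y -> e1 y z -> False) /\
     corr_op e1 k1 (corr_op e2 k2 << x >>) = 0.
Proof.
move=> f1 f2; rewrite corr_opU; have lin1 := @corr_op_linear e1 k1.
case: (pselect (exists y, e2 x y)) => [[y exy]|no]; last first.
  right; split=> [y z exy|]; first by case: no; exists y.
  by rewrite corr0 ?lin0 // => y exy; case: no; exists y.
rewrite (corrE k2 f2 exy) linZ // corr_opU.
case: (pselect (exists z, e1 y z)) => [[z eyz]|no].
  by left; exists y, z; split=> //; rewrite (corrE k1 f1 eyz) scalerA.
right; split=> [y' z exy' ey'z|].
  by case: no; exists z; rewrite (f2 _ _ _ exy exy').
by rewrite corr0 ?scaler0 // => z eyz; case: no; exists z.
Qed.

(** The identity is checked path by path. A path either has weight zero after scaling or is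
    cancelled by a path in the other order with the same ends; functionality makes this partner the
    only one. Each order needs its own hypothesis, as a path of either order may have no partner. *)
Lemma corr_comm e1 e2 k1 k2 al be :
  functional_rel e1 -> functional_rel e2 ->
  (forall x y z, e2 x y -> e1 y z -> al * (k2 x y * k1 y z) = 0 \/
     exists y', [/\ e1 x y', e2 y' z &
       al * (k2 x y * k1 y z) + be * (k1 x y' * k2 y' z) = 0]) ->
  (forall x y z, e1 x y -> e2 y z -> be * (k1 x y * k2 y z) = 0 \/
     exists y', [/\ e2 x y', e1 y' z &
       al * (k2 x y' * k1 y' z) + be * (k1 x y * k2 y z) = 0]) ->
  forall v, al *: corr_op e1 k1 (corr_op e2 k2 v) +
            be *: corr_op e2 k2 (corr_op e1 k1 v) = 0.
Proof.
move=> f1 f2 h1 h2; apply: eq_linear_malg.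
- by apply: linear_add; apply: linear_scale; apply: linear_comp; exact: corr_op_linear.
- by move=> c v v'; rewrite scaler0 addr0.
move=> x; case: (corr_comp k1 k2 x f1 f2) => [[y [z [xy yz ->]]]|[n1 ->]];
  case: (corr_comp k2 k1 x f2 f1) => [[y' [z' [xy' yz' ->]]]|[n2 ->]];
  rewrite ?scaler0 ?add0r ?addr0 // !scalerA.
- case: (h1 _ _ _ xy yz) => [z1|[y1 [a1 a2 a3]]].
    case: (h2 _ _ _ xy' yz') => [->|[y1 [a1 a2 a3]]].
      by rewrite z1 !scale0r addr0.
    rewrite -(f2 _ _ _ xy a1) in a2 a3.
    by rewrite -(f1 _ _ _ yz a2) in a3 *; rewrite -scalerDl a3 scale0r.
  rewrite -(f1 _ _ _ xy' a1) in a2 a3.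
  by rewrite -(f2 _ _ _ yz' a2) in a3 *; rewrite -scalerDl a3 scale0r.
- case: (h1 _ _ _ xy yz) => [->|[y1 [a1 a2 _]]]; first by rewrite scale0r.
  by case: (n2 _ _ a1 a2).
- case: (h2 _ _ _ xy' yz') => [->|[y1 [a1 a2 _]]]; first by rewrite scale0r.
  by case: (n1 _ _ a1 a2).
Qed.

Context (T : choiceType) (w : T -> K) (w_neq0 : forall t, w t != 0).
Implicit Types (e : T -> V -> V -> Prop) (k : T -> V -> V -> K) (L : seq T).

(** The coefficient of z^-n in the sum of the moves weighted by delta(w t / z): that of delta(w t /
    z) is [w t ^ n]. *)
Definition delta_corr e k n (x : V) : M :=
  \sum_(p \in [set p : T * V | e p.1 x p.2]%classic)
    (k p.1 x p.2 * w p.1 ^ n) *: << p.2 >>.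

Definition delta_op e k n : M -> M := lext (delta_corr e k n).

Lemma delta_op_linear e k n : linear (delta_op e k n).
Proof. exact: lext_linear. Qed.

Lemma delta_corrE e k n x L : (forall t, functional_rel (e t)) ->
  uniq L -> (forall t y, e t x y -> t \in L) ->
  delta_corr e k n x = \sum_(t <- L) w t ^ n *: corr (e t) (k t) x.
Proof.
move=> fe uL hL; pose tgt t := xget x [set y | e t x y]%classic.
have tgtP t y : e t x y -> tgt t = y.
  by move=> exy; rewrite /tgt; case: xgetP => [y' _ /fe/(_ exy)|/(_ y)].
pose s := [seq (t, tgt t) | t <- L & `[< e t x (tgt t) >]].
rewrite /delta_corr (fsbigE s); first last.
- move=> [t y] /= exy; case/negP; apply/mapP; exists t; last by rewrite (tgtP t y).
  by rewrite mem_filter (hL _ _ exy) andbT; apply/asboolP; rewrite (tgtP t y).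
- by move=> p /= /mapP[t]; rewrite mem_filter => /andP[/asboolP h _] ->.
- by rewrite map_inj_uniq ?filter_uniq // => t t' [].
rewrite /s big_map big_filter_cond big_mkcond; apply: eq_bigr => t _ /=.
case: asboolP => [h|h] /=.
  by rewrite mem_set // (corrE _ (fe t) h) scalerA mulrC.
rewrite corr0 ?scaler0 // => y exy.
by case: h; rewrite (tgtP _ _ exy).
Qed.

(** Only finitely many labels act on a given vector. Any larger list may be used in the sum, so that
    several operators can later be summed over one common list. *)
Lemma delta_opE e k (v : M) : (forall t, functional_rel (e t)) ->
  (forall x, exists L, forall t y, e t x y -> t \in L) ->
  exists L0, (forall t, t \notin L0 -> corr_op (e t) (k t) v = 0) /\
    forall L, uniq L -> {subset L0 <= L} -> forall n,
      delta_op e k n v = \sum_(t <- L) w t ^ n *: corr_op (e t) (k t) v.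
Proof.
move=> fe /choice[lab hlab].
exists (flatten [seq lab x | x <- msupp v]); split=> [t|L uL sL n].
  move=> /flatten_mapP ht; rewrite /corr_op /lext big1_seq // => x /= xv.
  by rewrite corr0 ?scaler0 // => y /hlab hy; case: ht; exists x.
rewrite /delta_op /corr_op /lext.
rewrite [RHS](eq_bigr (fun t => \sum_(x <- msupp v)
  w t ^ n *: (v@_x *: corr (e t) (k t) x))); last by move=> t _; rewrite scaler_sumr.
rewrite exchange_big /=; apply: eq_big_seq => x xv.
rewrite (delta_corrE k n fe uL) ?scaler_sumr => [|t y /hlab hy].
  by apply: eq_bigr => t _; rewrite !scalerA mulrC.
by apply: sL; apply/flatten_mapP; exists x.
Qed.

Section Products.
Context (e e' : T -> V -> V -> Prop) (k k' : T -> V -> V -> K).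
Hypotheses (fe : forall t, functional_rel (e t))
  (fe' : forall t, functional_rel (e' t)).
Hypotheses (le : forall x, exists L, forall t y, e t x y -> t \in L)
  (le' : forall x, exists L, forall t y, e' t x y -> t \in L).

Local Notation O t := (corr_op (e t) (k t)).
Local Notation O' t := (corr_op (e' t) (k' t)).

Lemma delta_op_prod1 v : exists L0, forall L, uniq L -> {subset L0 <= L} ->
  forall m n, delta_op e k m (delta_op e' k' n v) =
    \sum_(t <- L) \sum_(t' <- L) (w t ^ m * w t' ^ n) *: O t (O' t' v).
Proof.
have [L1 [z1 h1]] := delta_opE k' v fe' le'.
have /choice[L2 h2] : forall t', exists L2, forall L, uniq L -> {subset L2 <= L} ->
    forall n, delta_op e k n (O' t' v) = \sum_(t <- L) w t ^ n *: O t (O' t' v).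
  by move=> t'; have [L2 [_ h2]] := delta_opE k (O' t' v) fe le; exists L2.
exists (L1 ++ flatten [seq L2 t' | t' <- L1]) => L uL sL m n.
rewrite (h1 L) => [|//|t ht]; last by apply: sL; rewrite mem_cat ht.
rewrite lin_sum; last exact: delta_op_linear.
rewrite exchange_big /=; apply: eq_bigr => t' _.
rewrite linZ; last exact: delta_op_linear.
have [t'L|t'L] := boolP (t' \in L1).
  rewrite (h2 t' L) => [|//|t ht]; last first.
    by apply: sL; rewrite mem_cat; apply/orP; right; apply/flatten_mapP; exists t'.
  by rewrite scaler_sumr; apply: eq_bigr => t _; rewrite scalerA mulrC.
rewrite z1 // lin0 ?scaler0; last exact: delta_op_linear.
by rewrite big1 // => t _; rewrite lin0 ?scaler0 //; exact: corr_op_linear.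
Qed.

End Products.

(** One list serves both orders and all [m], [n], because the relations compare coefficients with
    shifted indices. [L0] forces chosen labels into it. *)
Lemma delta_op_prod e e' k k' v L0 :
  (forall t, functional_rel (e t)) -> (forall t, functional_rel (e' t)) ->
  (forall x, exists L, forall t y, e t x y -> t \in L) ->
  (forall x, exists L, forall t y, e' t x y -> t \in L) ->
  exists L, [/\ uniq L, {subset L0 <= L} & forall m n,
    delta_op e k m (delta_op e' k' n v) =
      \sum_(t <- L) \sum_(t' <- L) (w t ^ m * w t' ^ n) *:
        corr_op (e t) (k t) (corr_op (e' t') (k' t') v) /\
    delta_op e' k' n (delta_op e k m v) =
      \sum_(t <- L) \sum_(t' <- L) (w t ^ m * w t' ^ n) *:
        corr_op (e' t') (k' t') (corr_op (e t) (k t) v)].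
Proof.
move=> fe fe' le le'.
have [L1 h1] := delta_op_prod1 k k' fe fe' le le' v.
have [L2 h2] := delta_op_prod1 k' k fe' fe le' le v.
pose L := undup (L0 ++ L1 ++ L2).
have sL t : t \in L0 \/ t \in L1 \/ t \in L2 -> t \in L.
  by rewrite mem_undup !mem_cat => -[->|[->|->]]; rewrite ?orbT.
exists L; split=> [|t ht|m n]; first exact: undup_uniq.
  by apply: sL; left.
split; first by apply: h1 (undup_uniq _) _ _ _ => t ht; apply: sL; right; left.
rewrite (h2 L) ?undup_uniq => [|//|t ht]; last by apply: sL; right; right.
rewrite [LHS]exchange_big; apply: eq_bigr => t _; apply: eq_bigr => t' _.
by congr (_ *: _); exact: mulrC.
Qed.

Lemma double_sum_comb (L : seq T) (c : K) (F1 F2 F3 F4 : T -> T -> M) :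
  \sum_(t <- L) \sum_(t' <- L) F1 t t' -
    c *: (\sum_(t <- L) \sum_(t' <- L) F2 t t') -
  (\sum_(t <- L) \sum_(t' <- L) F3 t t' -
    c *: (\sum_(t <- L) \sum_(t' <- L) F4 t t')) =
  \sum_(t <- L) \sum_(t' <- L)
    (F1 t t' - c *: F2 t t' - (F3 t t' - c *: F4 t t')).
Proof.
rewrite 2!scaler_sumr -!sumrB; apply: eq_bigr => t _.
by rewrite 2!scaler_sumr -!sumrB.
Qed.

Lemma sum_comb (W : lmodType K) (L : seq T) (c d d' : K) (F1 F2 F3 F4 : T -> W) :
  \sum_(t <- L) F1 t - c *: (\sum_(t <- L) F2 t) +
  (d *: (\sum_(t <- L) F3 t) - c *: (d' *: (\sum_(t <- L) F4 t))) =
  \sum_(t <- L) (F1 t - c *: F2 t + (d *: F3 t - c *: (d' *: F4 t))).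
Proof. by rewrite !scaler_sumr -!sumrB -big_split. Qed.

Lemma scale_comb4 (W : lmodType K) (A B : W) (x1 x2 x3 x4 c y al be : K) :
  x1 - c * x2 = y * al -> x3 - c * x4 = y * be -> al *: A + - be *: B = 0 ->
  x1 *: A - c *: (x2 *: A) - (x3 *: B - c *: (x4 *: B)) = 0.
Proof.
move=> e1 e2 h; rewrite !scalerA -!scalerBl e1 e2 -!scalerA -scalerBr -scaleNr h.
exact: scaler0.
Qed.

Section QuadraticRelations.
Context (e e' : T -> V -> V -> Prop) (k k' : T -> V -> V -> K) (c : K) (v : M).
Hypotheses (fe : forall t, functional_rel (e t))
  (fe' : forall t, functional_rel (e' t)).
Hypotheses (le : forall x, exists L, forall t y, e t x y -> t \in L)
  (le' : forall x, exists L, forall t y, e' t x y -> t \in L).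

Local Notation O t := (corr_op (e t) (k t)).
Local Notation O' t := (corr_op (e' t) (k' t)).

(** On delta(w t / z) delta(w t' / w), multiplication by z - c w is multiplication by the scalar
    [w t - c * w t']. The relation therefore holds as soon as it holds for each pair of labels;
    [w t ^ m * w t' ^ n] is the common factor. *)
Lemma delta_op_rel_zw m n :
  (forall t t', (w t - c * w t') *: O t (O' t' v) +
     - (w t' - c * w t) *: O' t' (O t v) = 0) ->
  delta_op e k (m + 1) (delta_op e' k' n v) -
    c *: delta_op e k m (delta_op e' k' (n + 1) v) -
  (delta_op e' k' (n + 1) (delta_op e k m v) -
    c *: delta_op e' k' n (delta_op e k (m + 1) v)) = 0.
Proof.
move=> h; have [L [_ _ hL]] := delta_op_prod k k' v [::] fe fe' le le'.
have [[-> _] [-> _]] := (hL (m + 1) n, hL m (n + 1)).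
have [[_ ->] [_ ->]] := (hL (m + 1) n, hL m (n + 1)).
rewrite double_sum_comb big1 // => t _; rewrite big1 // => t' _.
apply: (scale_comb4 (y := w t ^ m * w t' ^ n)) (h t t');
  by rewrite !expfzDr // !expr1z; ring.
Qed.

Lemma delta_op_rel_wz m n :
  (forall t t', (w t' - c * w t) *: O t (O' t' v) +
     - (w t - c * w t') *: O' t' (O t v) = 0) ->
  delta_op e k m (delta_op e' k' (n + 1) v) -
    c *: delta_op e k (m + 1) (delta_op e' k' n v) -
  (delta_op e' k' n (delta_op e k (m + 1) v) -
    c *: delta_op e' k' (n + 1) (delta_op e k m v)) = 0.
Proof.
move=> h; have [L [_ _ hL]] := delta_op_prod k k' v [::] fe fe' le le'.
have [[-> _] [-> _]] := (hL (m + 1) n, hL m (n + 1)).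
have [[_ ->] [_ ->]] := (hL (m + 1) n, hL m (n + 1)).
rewrite double_sum_comb big1 // => t _; rewrite big1 // => t' _.
apply: (scale_comb4 (y := w t ^ m * w t' ^ n)) (h t t');
  by rewrite !expfzDr // !expr1z; ring.
Qed.

Lemma delta_op_anticomm m n :
  (forall t t', O t (O' t' v) + O' t' (O t v) = 0) ->
  delta_op e k m (delta_op e' k' n v) + delta_op e' k' n (delta_op e k m v) = 0.
Proof.
move=> h; have [L [_ _ /(_ m n)[-> ->]]] := delta_op_prod k k' v [::] fe fe' le le'.
rewrite -big_split big1 // => t _; rewrite -big_split big1 // => t' _ /=.
by rewrite -scalerDr h scaler0.
Qed.

End QuadraticRelations.

End Correspondences.

(** * The relations of U_C for an abstract weighted graph with poles and residues *)

Section GraphModule.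
Context (K : fieldType) (I : finType) (s : I -> I -> K).
Context (V T : choiceType) (w : T -> K).
Context (edge : I -> T -> V -> V -> Prop) (lab : I -> V -> seq T).
Context (a : V -> V -> K) (b : I -> T -> V -> V -> K).
Context (rho : I -> V -> T -> K) (c : bool -> I -> V -> int -> K).
Local Notation M := {malg K[V]}.

Hypotheses (w_neq0 : forall t, w t != 0)
  (s_sym : forall i j, s i j = s j i) (s_diag : forall i, s i i = 1).
Hypotheses
  (edge_fun : forall i t, functional_rel (edge i t))
  (edge_inj : forall i t, functional_rel (fun y x => edge i t x y)).
Hypotheses (lab_uniq : forall i x, uniq (lab i x))
  (labP : forall i x t, t \in lab i x ->
     (exists y, edge i t x y) \/ (exists y, edge i t y x))
  (edge_lab : forall i t x y, edge i t x y -> t \in lab i x /\ t \in lab i y)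
  (edge_excl : forall i t x y z, edge i t x y -> edge i t y z -> False).
Hypothesis edge_rho : forall i t x y, edge i t x y ->
  a x y * b i t x y = rho i x t /\ a x y * b i t x y = rho i y t.
Hypotheses
  (c_rho : forall i x (n : int), c true i x (- n) - c false i x (- n) =
     \sum_(t <- lab i x) rho i x t * w t ^ n)
  (c0 : forall i x, c true i x 0 * c false i x 0 = 1)
  (c_oo : forall i x n, 0 < n -> c true i x n = 0)
  (c_at0 : forall i x n, n < 0 -> c false i x n = 0)
  (c_edge : forall d i j t x y n, edge j t x y ->
     c d i x (n - 1) - s i j * w t * c d i x n +
     (w t * c d i y n - s i j * c d i y (n - 1)) = 0).
Hypotheses
  (sqFF : forall i j t t' x y z, i != j -> edge j t' x y -> edge i t y z ->
     w t' - s i j * w t = 0 \/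
     exists y', [/\ edge i t x y', edge j t' y' z &
       (w t' - s i j * w t) * (a x y * a y z) =
       (w t - s i j * w t') * (a x y' * a y' z)])
  (sqEE : forall i j t t' x y z, i != j -> edge j t' y x -> edge i t z y ->
     w t - s i j * w t' = 0 \/
     exists y', [/\ edge i t y' x, edge j t' z y' &
       (w t - s i j * w t') * (b j t' y x * b i t z y) =
       (w t' - s i j * w t) * (b i t y' x * b j t' z y')])
  (sqFF0 : forall i t t' x y z, edge i t' x y -> edge i t y z ->
     exists y', [/\ edge i t x y', edge i t' y' z &
       a x y * a y z + a x y' * a y' z = 0])
  (sqEE0 : forall i t t' x y z, edge i t' y x -> edge i t z y ->
     exists y', [/\ edge i t y' x, edge i t' z y' &
       b i t' y x * b i t z y + b i t y' x * b i t' z y' = 0])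
  (sqEF : forall i j t t' x y z, (i, t) != (j, t') ->
     edge j t' x y -> edge i t z y -> exists y', [/\ edge i t y' x,
       edge j t' y' z & a x y * b i t z y + b i t y' x * a y' z = 0])
  (sqFE : forall i j t t' x y z, (i, t) != (j, t') ->
     edge i t y x -> edge j t' y z -> exists y', [/\ edge j t' x y',
       edge i t z y' & a x y' * b i t z y' + b i t y x * a y z = 0]).

Let eF i t x y := edge i t x y.
Let eE i t x y := edge i t y x.
Let kF (t : T) x y := a x y.
Let kE i t x y := b i t y x.

Definition graphF i n : M -> M := delta_op w (eF i) kF n.
Definition graphE i n : M -> M := delta_op w (eE i) (kE i) n.
(** [c d i x n] stands for the coefficient of z^n in an expansion of f_i, whereas operators are
    indexed by the powers of z^-1. *)
Definition graphK d i n : M -> M := lext (fun x => c d i x (- n) *: << x >>).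

Local Notation OF i t := (corr_op (eF i t) (kF t)).
Local Notation OE i t := (corr_op (eE i t) (kE i t)).

Let fF i t : functional_rel (eF i t). Proof. exact: edge_fun. Qed.
Let fE i t : functional_rel (eE i t). Proof. exact: edge_inj. Qed.
Let lF i x : exists L : seq T, forall t y, eF i t x y -> t \in L.
Proof. by exists (lab i x) => t y /edge_lab[]. Qed.
Let lE i x : exists L : seq T, forall t y, eE i t x y -> t \in L.
Proof. by exists (lab i x) => t y /edge_lab[]. Qed.

Let gF_linear i n : linear (graphF i n). Proof. exact: delta_op_linear. Qed.
Let gE_linear i n : linear (graphE i n). Proof. exact: delta_op_linear. Qed.
Let gK_linear d i n : linear (graphK d i n). Proof. exact: lext_linear. Qed.

Lemma graphKU d i n x : graphK d i n << x >> = c d i x (- n) *: << x >>.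
Proof. by rewrite /graphK lextU scale1r. Qed.

Lemma eq0_linear (f : M -> M) : linear f -> (forall x, f << x >> = 0) ->
  forall v, f v = 0.
Proof.
move=> lf f0; apply: eq_linear_malg => // k v v'.
by rewrite scaler0 addr0.
Qed.

Let FF0t i t t' v : OF i t (OF i t' v) + OF i t' (OF i t v) = 0.
Proof.
rewrite -[X in X + _]scale1r -[X in _ + X]scale1r; move: v.
apply: corr_comm => //; rewrite /eF /kF => x y z h1 h2; right;
  have [y' [h3 h4 h5]] := sqFF0 h1 h2; exists y'; rewrite !mul1r //.
by rewrite addrC.
Qed.

Let FFt i j t t' v : (w t' - s i j * w t) *: OF i t (OF j t' v) +
  - (w t - s i j * w t') *: OF j t' (OF i t v) = 0.
Proof.
have [ij|ij] := eqVneq i j.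
  (* For one color the two scalars agree, and the relation is a multiple of the anticommutation. *)
  by subst j; rewrite s_diag !mul1r opprB -scalerDr FF0t scaler0.
move: v; apply: corr_comm => //; rewrite /eF /kF => x y z h1 h2.
  have [->|[y' [h3 h4 h5]]] := sqFF ij h1 h2; first by left; rewrite mul0r.
  by right; exists y'; rewrite mulNr -h5 subrr.
rewrite eq_sym in ij; have [|[y' [h3 h4 h5]]] := sqFF ij h1 h2; rewrite s_sym.
  by move=> ->; left; rewrite oppr0 mul0r.
by right; exists y'; split=> //; move: h5; rewrite s_sym mulNr => ->; rewrite subrr.
Qed.

Let EE0t i t t' v : OE i t (OE i t' v) + OE i t' (OE i t v) = 0.
Proof.
rewrite -[X in X + _]scale1r -[X in _ + X]scale1r; move: v.
apply: corr_comm => //; rewrite /eE /kE => x y z h1 h2; right;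
  have [y' [h3 h4 h5]] := sqEE0 h1 h2; exists y'; rewrite !mul1r //.
by rewrite addrC.
Qed.

Let EEt i j t t' v : (w t - s i j * w t') *: OE i t (OE j t' v) +
  - (w t' - s i j * w t) *: OE j t' (OE i t v) = 0.
Proof.
have [ij|ij] := eqVneq i j.
  by subst j; rewrite s_diag !mul1r opprB -scalerDr EE0t scaler0.
move: v; apply: corr_comm => //; rewrite /eE /kE => x y z h1 h2.
  have [->|[y' [h3 h4 h5]]] := sqEE ij h1 h2; first by left; rewrite mul0r.
  by right; exists y'; rewrite mulNr -h5 subrr.
rewrite eq_sym in ij; have [|[y' [h3 h4 h5]]] := sqEE ij h1 h2; rewrite s_sym.
  by move=> ->; left; rewrite oppr0 mul0r.
by right; exists y'; split=> //; move: h5; rewrite s_sym mulNr => ->; rewrite subrr.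
Qed.

Let EFt i j t t' v : (i, t) != (j, t') ->
  OE i t (OF j t' v) + OF j t' (OE i t v) = 0.
Proof.
move=> ne; rewrite -[X in X + _]scale1r -[X in _ + X]scale1r; move: v.
apply: corr_comm => //; rewrite /eF /kF /eE /kE => x y z h1 h2; right.
  have [y' [h3 h4 h5]] := sqEF ne h1 h2.
  by exists y'; rewrite !mul1r.
have [y' [h3 h4 h5]] := sqFE ne h1 h2.
by exists y'; rewrite !mul1r.
Qed.

Let EFtt i t x : OE i t (OF i t << x >>) + OF i t (OE i t << x >>) =
  (if t \in lab i x then rho i x t else 0) *: << x >>.
Proof.
case: (corr_comp (kE i t) (kF t) x (@fE i t) (@fF i t))
  => [[y [z [xy yz ->]]]|[n1 ->]];
case: (corr_comp (kF t) (kE i t) x (@fF i t) (@fE i t))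
  => [[y' [z' [xy' yz' ->]]]|[n2 ->]].
- by case: (edge_excl xy' xy).
- rewrite (fE yz xy) addr0 /kF /kE.
  by have [-> _] := edge_rho xy; have [-> _] := edge_lab xy.
- rewrite (fF yz' xy') add0r /kF /kE mulrC.
  by have [_ ->] := edge_rho xy'; have [_ ->] := edge_lab xy'.
- case: ifP => [/labP[[y h]|[y h]]|_]; last by rewrite scale0r addr0.
    by case: (n1 _ _ h h).
  by case: (n2 _ _ h h).
Qed.

(** Pairs of distinct colored labels cancel by [EFt]. For one color the pairs t = t' leave the sum
    of the residues times [w t ^ (m + n)], which is the difference of the two expansions. *)
Lemma graph_EF i j m n v : graphE i m (graphF j n v) + graphF j n (graphE i m v) =
  if i == j then graphK true i (m + n) v - graphK false i (m + n) v else 0.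
Proof.
have [ij|ij] := eqVneq i j; last first.
  rewrite /graphE /graphF.
  have [L [uL _ /(_ m n)[-> ->]]] :=
    delta_op_prod w (kE i) kF v [::] (@fE i) (@fF j) (@lE i) (@lF j).
  rewrite -big_split big1 // => t _; rewrite -big_split big1 // => t' _ /=.
  by rewrite -scalerDr EFt ?scaler0 //; apply: contraNneq ij => -[->].
subst j; move: v; apply: eq_linear_malg => [||x].
- exact: linear_add (linear_comp (gE_linear i m) (gF_linear i n))
                    (linear_comp (gF_linear i n) (gE_linear i m)).
- exact: linear_sub (gK_linear true i _) (gK_linear false i _).
rewrite !graphKU -scalerBl c_rho /graphE /graphF.
have [L [uL sL /(_ m n)[-> ->]]] := delta_op_prod w (kE i) kF << x >> (lab i x)
  (@fE i) (@fF i) (@lE i) (@lF i).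
rewrite -big_split (eq_big_seq (fun t =>
    (if t \in lab i x then rho i x t * w t ^ (m + n) else 0) *: << x >>)) => [|t tL].
  rewrite -scaler_suml -big_mkcond; congr (_ *: _).
  rewrite -big_filter; apply: perm_big; apply: uniq_perm => [||t].
  - exact: filter_uniq.
  - exact: lab_uniq.
  - by rewrite mem_filter andb_idr // => /sL.
rewrite -big_split; apply: etrans (bigD1_seq t tL uL) _.
rewrite big1 => [|t' tt']; last first.
  by rewrite /= -scalerDr EFt ?scaler0 //; apply: contraNneq tt' => -[->].
apply: etrans (addr0 _) _; rewrite /= -scalerDr EFtt scalerA; congr (_ *: _).
by case: ifP => _; rewrite ?mulr0 // expfzDr // mulrC.
Qed.

(** For an edge from x to y of label t, [c_edge] is the coefficient form of (z - s_ij w_t) f_i(x) =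
    (s_ij z - w_t) f_i(y). The relation is this identity times the weight of the edge and [w t ^ n];
    [graph_QE] uses it with the ends exchanged. *)
Lemma graph_QF d i j m n v :
  graphK d i m (graphF j (n + 1) v) - s i j *: graphK d i (m + 1) (graphF j n v) +
  (graphF j n (graphK d i (m + 1) v) - s i j *: graphF j (n + 1) (graphK d i m v)) = 0.
Proof.
move: v; apply: eq0_linear => [|x].
  by apply: linear_add; apply: linear_sub; try apply: linear_scale;
    first [exact: (linear_comp (gK_linear _ _ _) (gF_linear _ _))
          |exact: (linear_comp (gF_linear _ _) (gK_linear _ _ _))].
rewrite !graphKU !(linZ (gF_linear _ _)).
have FE k : graphF j k << x >> =
    \sum_(t <- lab j x) w t ^ k *: corr (eF j t) (kF t) x.
  rewrite /graphF /delta_op lextU scale1r.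
  by apply: delta_corrE => // t y /edge_lab[].
rewrite !FE !(lin_sum (gK_linear _ _ _)) sum_comb big1 // => t _.
case: (pselect (exists y, eF j t x y)) => [[y h]|no]; last first.
  rewrite corr0 => [|y h]; last by case: no; exists y.
  by rewrite !scaler0 !(lin0 (gK_linear _ _ _)) !scaler0 !subrr addr0.
rewrite (corrE _ (@fF j t) h) !scalerA !(linZ (gK_linear _ _ _)) !graphKU.
rewrite !scalerA -!scalerBl -scalerDl; have := c_edge d i (- m) h.
rewrite -opprD => /(congr1 (fun r => kF t x y * w t ^ n * r)); rewrite mulr0 => hc.
rewrite [X in X *: _](_ : _ = 0) ?scale0r // -hc expfzDr // expr1z.
by ring.
Qed.

Lemma graph_QE d i j m n v :
  graphK d i (m + 1) (graphE j n v) - s i j *: graphK d i m (graphE j (n + 1) v) +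
  (graphE j (n + 1) (graphK d i m v) - s i j *: graphE j n (graphK d i (m + 1) v)) = 0.
Proof.
move: v; apply: eq0_linear => [|x].
  by apply: linear_add; apply: linear_sub; try apply: linear_scale;
    first [exact: (linear_comp (gK_linear _ _ _) (gE_linear _ _))
          |exact: (linear_comp (gE_linear _ _) (gK_linear _ _ _))].
rewrite !graphKU !(linZ (gE_linear _ _)).
have EE k : graphE j k << x >> =
    \sum_(t <- lab j x) w t ^ k *: corr (eE j t) (kE j t) x.
  rewrite /graphE /delta_op lextU scale1r.
  by apply: delta_corrE => // t y /edge_lab[].
rewrite !EE !(lin_sum (gK_linear _ _ _)) sum_comb big1 // => t _.
case: (pselect (exists y, eE j t x y)) => [[y h]|no]; last first.
  rewrite corr0 => [|y h]; last by case: no; exists y.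
  by rewrite !scaler0 !(lin0 (gK_linear _ _ _)) !scaler0 !subrr addr0.
rewrite (corrE _ (@fE j t) h) !scalerA !(linZ (gK_linear _ _ _)) !graphKU.
rewrite !scalerA -!scalerBl -scalerDl; have := c_edge d i (- m) h.
rewrite -opprD => /(congr1 (fun r => kE j t x y * w t ^ n * r)); rewrite mulr0 => hc.
rewrite [X in X *: _](_ : _ = 0) ?scale0r // -hc expfzDr // expr1z.
by ring.
Qed.

Theorem graph_module : exists act : UC s -> M -> M,
  [/\ UC_module act,
      forall d i n x, act (UCK s d i n) << x >> = c d i x (- n) *: << x >>,
      forall i n x, act (UCF s i n) << x >> = delta_corr w (edge i) (fun=> a) n x
    & forall i n x, act (UCE s i n) << x >> =
        delta_corr w (fun t x y => edge i t y x) (fun t x y => b i t y x) n x].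
Proof.
have [act [act_mod actK actF actE]] : exists act : UC s -> M -> M,
  [/\ UC_module act,
      forall d i n v, act (UCK s d i n) v = graphK d i n v,
      forall i n v, act (UCF s i n) v = graphF i n v
    & forall i n v, act (UCE s i n) v = graphE i n v].
  apply: (UC_module_of_series gE_linear gF_linear gK_linear).
  - move=> i n v n0; apply: (eq0_linear (gK_linear _ _ _)) => x.
    by rewrite graphKU c_oo ?scale0r // oppr_gt0.
  - move=> i n v n0; apply: (eq0_linear (gK_linear _ _ _)) => x.
    by rewrite graphKU c_at0 ?scale0r // oppr_lt0.
  - move=> d d' i j m n; apply: eq_linear_malg => [||x].
    + exact: (linear_comp (gK_linear _ _ _) (gK_linear _ _ _)).
    + exact: (linear_comp (gK_linear _ _ _) (gK_linear _ _ _)).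
    + rewrite (graphKU d') (graphKU d) (linZ (gK_linear _ _ _)).
      by rewrite (linZ (gK_linear _ _ _)) !graphKU !scalerA mulrC.
  - move=> i; apply: eq_linear_malg => [||x].
    + exact: (linear_comp (gK_linear _ _ _) (gK_linear _ _ _)).
    + by move=> k v v'.
    + rewrite graphKU (linZ (gK_linear _ _ _)) graphKU scalerA mulrC oppr0 c0.
      exact: scale1r.
  - exact: graph_QE.
  - exact: graph_QF.
  - by move=> i j m n v; apply: delta_op_rel_zw => // t t'; exact: EEt.
  - by move=> i j m n v; apply: delta_op_rel_wz => // t t'; exact: FFt.
  - by move=> i m n v; apply: delta_op_anticomm => // t t'; exact: EE0t.
  - by move=> i m n v; apply: delta_op_anticomm => // t t'; exact: FF0t.
  - exact: graph_EF.
exists act; split=> [|d i n x|i n x|i n x].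
- exact: act_mod.
- by rewrite actK graphKU.
- by rewrite actF /graphF /delta_op lextU scale1r.
- by rewrite actE /graphE /delta_op lextU scale1r.
Qed.

End GraphModule.

(** * Expansions of rational functions *)

Section Convolution.
Context (K : fieldType).
Implicit Types (P Q p q : {poly K}) (c d : int -> K) (n : int).

(** [conv Q c] and [lau P] are the two sides of [quotient_series]: the product of a polynomial and a
    two-sided series, and a polynomial seen as such a series. *)
Definition conv p c : int -> K := fun n => \sum_(k < size p) p`_k * c (n - k%:Z).

Definition lau p : int -> K := fun n => if n is Posz k then p`_k else 0.

Lemma convEw N p c n : (size p <= N)%N ->
  conv p c n = \sum_(k < N) p`_k * c (n - k%:Z).
Proof.
move=> le; rewrite /conv (big_ord_widen N (fun k : nat => p`_k * c (n - k%:Z))) //.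
rewrite big_mkcond; apply: eq_bigr => k _.
by case: ltnP => // h; rewrite nth_default // mul0r.
Qed.

Lemma convD p q c n : conv (p + q) c n = conv p c n + conv q c n.
Proof.
pose N := maxn (size (p + q)) (maxn (size p) (size q)).
rewrite !(@convEw N) ?leq_max ?leqnn ?orbT // -big_split /=.
by apply: eq_bigr => k _; rewrite coefD mulrDl.
Qed.

Lemma convZ a p c n : conv (a *: p) c n = a * conv p c n.
Proof.
rewrite !(@convEw (size p)) ?size_scale_leq // mulr_sumr.
by apply: eq_bigr => k _; rewrite coefZ mulrA.
Qed.

Lemma convC a c n : conv a%:P c n = a * c n.
Proof. by rewrite (@convEw 1) ?size_polyC ?leq_b1 // big_ord1 coefC subr0. Qed.

Lemma conv1 c n : conv 1 c n = c n.
Proof. by rewrite convC mul1r. Qed.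

Lemma convMX p c n : conv (p * 'X) c n = conv p c (n - 1).
Proof.
have [->|p0] := eqVneq p 0; first by rewrite mul0r !convC !mul0r.
rewrite /conv size_mulX // big_ord_recl coefMX mul0r add0r.
by apply: eq_bigr => k _; rewrite coefMX /= -addrA -opprD -PoszD.
Qed.

Lemma convX c n : conv 'X c n = c (n - 1).
Proof. by rewrite -['X]mul1r convMX conv1. Qed.

Lemma conv_addr p c d n : conv p (fun k => c k + d k) n = conv p c n + conv p d n.
Proof. by rewrite -big_split; apply: eq_bigr => k _; rewrite mulrDr. Qed.

Lemma conv_scaler p a c n : conv p (fun k => a * c k) n = a * conv p c n.
Proof. by rewrite mulr_sumr; apply: eq_bigr => k _; rewrite mulrCA. Qed.

Lemma conv_sumr p (T : Type) (s : seq T) (c : T -> int -> K) n :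
  conv p (fun k => \sum_(t <- s) c t k) n = \sum_(t <- s) conv p (c t) n.
Proof.
by rewrite exchange_big; apply: eq_bigr => k _; rewrite mulr_sumr.
Qed.

Lemma eq_conv p c d : c =1 d -> conv p c =1 conv p d.
Proof. by move=> e n; apply: eq_bigr => k _; rewrite e. Qed.

Lemma convM p q c : conv (p * q) c =1 conv p (conv q c).
Proof.
elim/poly_ind: p c => [|p a IH] c n; first by rewrite mul0r !convC !mul0r.
by rewrite mulrDl mulrAC !convD !convMX IH mul_polyC convZ convC.
Qed.

Lemma lauD p q n : lau (p + q) n = lau p n + lau q n.
Proof. by case: n => k /=; rewrite ?addr0 // coefD. Qed.

Lemma lauZ a p n : lau (a *: p) n = a * lau p n.
Proof. by case: n => k /=; rewrite ?mulr0 // coefZ. Qed.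

Lemma lauMX p n : lau (p * 'X) n = lau p (n - 1).
Proof.
case: n => [[|k]|k]; last by [].
  by rewrite /lau coefMX.
have -> : k.+1%:Z - 1 = k by lia.
by rewrite /lau coefMX.
Qed.

Lemma conv_lau p q : conv p (lau q) =1 lau (p * q).
Proof.
elim/poly_ind: p q => [|p a IH] q n.
  by rewrite convC !mul0r; case: n => k //=; rewrite coef0.
by rewrite convD convMX IH convC mulrDl mulrAC mul_polyC lauD lauZ lauMX.
Qed.

(** With [b] true the powers of z are bounded above, as at infinity; otherwise they are bounded
    below, as at a finite point. *)
Definition bounded (b : bool) c : Prop :=
  exists N : int, forall n, (if b then N < n else n < N) -> c n = 0.

Lemma conv_bounded b p c : bounded b c -> bounded b (conv p c).
Proof.
case: b => -[N h]; [exists (N + (size p)%:Z) => n hn | exists N => n hn];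
  by rewrite /conv big1 // => k _; rewrite h ?mulr0 //; have := ltn_ord k; lia.
Qed.

Lemma bounded_sub b c d : bounded b c -> bounded b d ->
  bounded b (fun n => c n - d n).
Proof.
case: b => -[N h] [N' h'].
  by exists (`|N| + `|N'|) => n hn; rewrite h ?h' ?subr0 //; lia.
by exists (- `|N| - `|N'|) => n hn; rewrite h ?h' ?subr0 //; lia.
Qed.

Lemma subz_shift (N : int) (k m j : nat) : (j <= m)%N -> (m - j <= k)%N ->
  N - k%:Z + m%:Z - j%:Z = N - (k - (m - j))%N%:Z.
Proof. move=> jm mk; lia. Qed.

Lemma addz_shift (N : int) (k m j : nat) : (j <= m)%N -> (m - j <= k)%N ->
  N + k%:Z + j%:Z - m%:Z = N + (k - (m - j))%N%:Z.
Proof. move=> jm mk; lia. Qed.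

(** The coefficients vanish one after the other, starting from the bound: the leading coefficient of
    [Q] isolates the next one at infinity, its lowest nonzero coefficient at a point. Boundedness is
    essential, as a linear factor kills a delta function. *)
Lemma conv_eq0 b Q d : Q != 0 -> bounded b d -> conv Q d =1 (fun=> 0) -> d =1 (fun=> 0).
Proof.
move=> Q0; case: b => -[N hN] h.
  suff: forall k : nat, d (N - k%:Z) = 0.
    by move=> hk n; case: (lerP n N) => [le|/hN//]; rewrite -(hk `|N - n|%N); congr d; lia.
  elim/ltn_ind => k IH; have := h (N - k%:Z + (size Q).-1%:Z).
  have sQ : size Q = (size Q).-1.+1 by rewrite prednK // size_poly_gt0.
  rewrite /conv sQ big_ord_recr /= addrK big1 ?add0r => [/eqP|j _].
    by rewrite mulf_eq0 -lead_coefE lead_coef_eq0 (negPf Q0) => /eqP.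
  have jlt := ltn_ord j.
  suff -> : d (N - k%:Z + (size Q).-1%:Z - j%:Z) = 0 by rewrite mulr0.
  move: (nat_of_ord j) jlt => j' jm; move: (size Q).-1 jm => m jm.
  case: (leqP (m - j')%N k) => le; last by apply: hN; lia.
  rewrite (subz_shift N (ltnW jm) le).
  apply: (IH (k - (m - j'))%N).
  clear -jm le; lia.
have [j0 Qj0 j0min] : exists2 j, Q`_j != 0 & forall k, (k < j)%N -> Q`_k = 0.
  have ex : exists j, Q`_j != 0 by exists (size Q).-1; rewrite -lead_coefE lead_coef_eq0.
  case: (ex_minnP ex) => j hj jmin; exists j => // k kj.
  by apply/eqP; apply: contraLR kj => /jmin; rewrite -leqNgt.
have j0s : (j0 < size Q)%N by rewrite ltnNge; apply: contra Qj0 => le; rewrite nth_default.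
suff: forall k : nat, d (N + k%:Z) = 0.
  by move=> hk n; case: (lerP N n) => [le|/hN//]; rewrite -(hk `|n - N|%N); congr d; lia.
elim/ltn_ind => k IH; have := h (N + k%:Z + j0%:Z).
rewrite /conv (bigD1 (Ordinal j0s)) //= addrK big1 ?addr0 => [/eqP|j jj0].
  by rewrite mulf_eq0 (negPf Qj0) => /eqP.
have {}jj0 : nat_of_ord j != j0 by apply: contraNneq jj0 => e; apply/eqP/val_inj.
case: (ltngtP j j0) jj0 => // lt _; first by rewrite j0min // mul0r.
suff -> : d (N + k%:Z + j0%:Z - j%:Z) = 0 by rewrite mulr0.
move: (nat_of_ord j) lt => j' lt.
case: (leqP (j' - j0)%N k) => le; last by apply: hN; lia.
rewrite (addz_shift N (ltnW lt) le).
apply: (IH (k - (j' - j0))%N).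
clear -lt le; lia.
Qed.

Lemma conv_inj b Q c d : Q != 0 -> bounded b c -> bounded b d ->
  conv Q c =1 conv Q d -> c =1 d.
Proof.
move=> Q0 hc hd e n; apply/eqP; rewrite -subr_eq0; apply/eqP; move: n.
apply: (conv_eq0 Q0 (bounded_sub hc hd)) => n.
rewrite (@eq_conv _ _ (fun n => c n + (-1) * d n)); last by move=> k; rewrite mulN1r.
by rewrite conv_addr conv_scaler e mulN1r subrr.
Qed.

(* [b] selects the expansion at infinity; [w] is then [0]. *)
Definition expansion_of (b : bool) w (f : {fraction {poly K}}) c : Prop :=
  bounded b c /\ exists P Q, [/\ Q != 0, f = tofrac P / tofrac Q &
    conv (Q \Po ('X + w%:P)) c =1 lau (P \Po ('X + w%:P))].

Lemma frac_eq P Q P' Q' : Q != 0 -> Q' != 0 ->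
  tofrac P / tofrac Q = tofrac P' / tofrac Q' -> P * Q' = P' * Q.
Proof.
move=> Q0 Q'0 /eqP; rewrite eqr_div ?tofrac_eq0 // -!tofracM.
by rewrite tofrac_eq => /eqP.
Qed.

Lemma comp_shift_neq0 w Q : Q != 0 -> Q \Po ('X + w%:P) != 0.
Proof.
move=> Q0; rewrite -size_poly_gt0 size_comp_poly2 ?size_XaddC //.
by rewrite size_poly_gt0.
Qed.

(** The two expansions may come with unrelated denominators. After multiplication by both of them
    the two sides are the same polynomial, and [conv_inj] removes this factor. *)
Lemma expansion_rel b w f g p q c d : expansion_of b w f c -> expansion_of b w g d ->
  tofrac p * f = tofrac q * g ->
  conv (p \Po ('X + w%:P)) c =1 conv (q \Po ('X + w%:P)) d.
Proof.
move=> [bc [P [Q [Q0 ef hc]]]] [bd [P' [Q' [Q'0 eg hd]]]] e.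
set S := _ + _ in hc hd *.
apply: (@conv_inj b ((Q * Q') \Po S)).
- by rewrite comp_shift_neq0 // mulf_neq0.
- exact: conv_bounded.
- exact: conv_bounded.
move: e; rewrite ef eg !mulrA -!tofracM => /frac_eq => /(_ Q0 Q'0) e.
move=> n; rewrite -!convM !comp_polyM.
rewrite (_ : _ * (p \Po S) = (Q' \Po S) * (p \Po S) * (Q \Po S)); last by ring.
rewrite (_ : _ * (q \Po S) = (Q \Po S) * (q \Po S) * (Q' \Po S)); last by ring.
rewrite convM (eq_conv _ hc) conv_lau convM (eq_conv _ hd) conv_lau.
congr (lau _ n); rewrite -!comp_polyM; congr (_ \Po _).
by rewrite -mulrA [LHS]mulrC e; ring.
Qed.

Lemma expansion_unique b w f c d :
  expansion_of b w f c -> expansion_of b w f d -> c =1 d.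
Proof.
move=> hc hd n; have := expansion_rel hc hd (erefl (tofrac 1 * f)) n.
by rewrite -polyC1 comp_polyC !conv1.
Qed.

Lemma expansion_ooP f c : expansion_of true 0 f c <-> is_expansion_oo f c.
Proof.
split=> -[bc [P [Q [Q0 ef hc]]]]; split=> //; exists P, Q; split=> //.
  by move=> n; have := hc n; rewrite addr0 !comp_polyXr.
by rewrite addr0 !comp_polyXr.
Qed.

Lemma expansion_ooE f c : expansion_of true 0 f c -> expansion_oo f = c.
Proof.
move=> h; apply/funext; apply: (expansion_unique (b := true) (w := 0) (f := f)) => //.
rewrite /expansion_oo; case: xgetP => [c' _|/(_ c)]; first by move/expansion_ooP.
by move=> h'; case: h'; apply/expansion_ooP.
Qed.

Lemma expansion_atE w f c : expansion_of false w f c -> expansion_at w f = c.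
Proof.
move=> h; apply/funext; apply: (expansion_unique (b := false) (w := w) (f := f)) => //.
by rewrite /expansion_at; case: xgetP => [c' _ //|/(_ c) h']; case: h'.
Qed.

End Convolution.

(** * Partial fractions *)

Section PartialFractions.
Context (K : fieldType).
Implicit Types (P : {poly K}) (S : seq K) (s w d : K) (n : int).

Definition polef S : {poly K} := \prod_(s <- S) ('X - s%:P).

(** For a duplicate-free [S] containing [s], this is the residue of P / [polef S] at [s]. *)
Definition pfcoef P S s : K := P.[s] / (polef (rem s S)).[s].

Lemma polef_neq0 S : polef S != 0.
Proof. exact/monic_neq0/monic_prod_XsubC. Qed.

Lemma polef_rem S s : s \in S -> polef S = polef (rem s S) * ('X - s%:P).
Proof. by move=> sS; rewrite /polef (big_rem s) //= mulrC. Qed.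

Lemma size_polef S : size (polef S) = (size S).+1.
Proof. exact: size_prod_XsubC. Qed.

Lemma polef_root S s : s \in S -> (polef S).[s] = 0.
Proof. by move=> /polef_rem ->; rewrite hornerM hornerXsubC subrr mulr0. Qed.

Lemma polef_nroot S s : s \notin S -> (polef S).[s] != 0.
Proof.
move=> sS; rewrite /polef horner_prod prodf_seq_neq0; apply/allP => t tS /=.
by rewrite hornerXsubC subr_eq0; apply: contraNneq sS => ->.
Qed.

Lemma polef_rem_nroot S s : uniq S -> (polef (rem s S)).[s] != 0.
Proof. by move=> uS; rewrite polef_nroot // mem_rem_uniq // !inE eqxx. Qed.

(** Lagrange interpolation: the difference of the two sides vanishes at all points of [S], and the
    first term cancels its coefficient of degree [size S]. *)
Lemma partial_fractions P S : uniq S -> (size P <= (size S).+1)%N ->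
  P = P`_(size S) *: polef S + \sum_(s <- S) pfcoef P S s *: polef (rem s S).
Proof.
move=> uS sP; apply/eqP; rewrite -subr_eq0; apply/eqP.
apply: (roots_geq_poly_eq0 _ uS).
  apply/allP => s sS; rewrite rootE hornerD hornerN hornerD hornerZ polef_root //.
  rewrite mulr0 add0r horner_sum (bigD1_seq s) //= big1_seq => [|t /andP[ts tS]].
    by rewrite addr0 hornerZ /pfcoef divfK ?polef_rem_nroot // subrr.
  by rewrite hornerZ polef_root ?mulr0 // mem_rem_uniq // inE eq_sym ts.
apply/leq_sizeP => j jS; rewrite coefB coefD coefZ coef_sum big1_seq => [|s /andP[_ sS]].
  have [->|ne] := eqVneq j (size S).
    have /monicP := monic_prod_XsubC S predT id.
    by rewrite /lead_coef -/(polef S) size_polef => ->; rewrite mulr1 addr0 subrr.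
  have lt : (size S < j)%N by rewrite ltn_neqAle eq_sym ne.
  rewrite [P`_j]nth_default ?(leq_trans sP) //.
  by rewrite [(polef S)`_j]nth_default ?size_polef // mulr0 addr0 subrr.
rewrite coefZ [X in _ * X]nth_default ?mulr0 // size_polef size_rem //.
by rewrite prednK //; case: S sS {uS sP jS}.
Qed.

(* The coefficients of [1 / (z - d)], expanded in the powers of [z] and of
   [z^-1]. *)
Definition pole_at d n : K :=
  if d == 0 then (n == -1)%:R else if 0 <= n then - d ^ (- n - 1) else 0.
Definition pole_oo d n : K := if n < 0 then d ^ (- n - 1) else 0.

Lemma conv_pole_at d : conv ('X - d%:P) (pole_at d) =1 lau 1.
Proof.
move=> n; rewrite -polyCN convD convX convC /pole_at.
have [->|d0] := eqVneq d 0.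
  rewrite oppr0 mul0r addr0 (_ : (n - 1 == -1) = (n == 0)); last by lia.
  by case: n => [[|k]|k] //=; rewrite coef1.
have [hn|[->|hn]] : n < 0 \/ n = 0 \/ 0 < n by lia.
- have [-> ->] : (0 <= n - 1) = false /\ (0 <= n) = false by lia.
  by rewrite mulr0 addr0; case: n hn.
- have -> : - 0 - 1 = -1 :> int by [].
  by rewrite /= add0r mulrNN exprN1 mulfV //= coef1.
- have [-> ->] : (0 <= n - 1) = true /\ (0 <= n) = true by lia.
  rewrite mulrNN -{2}[d]expr1z -expfzDr // (_ : - (n - 1) - 1 = 1 + (- n - 1)) //; last by lia.
  by rewrite addNr; case: n hn => [[|k]|k] // _; rewrite /lau coef1.
Qed.

Lemma conv_pole_oo d : conv ('X - d%:P) (pole_oo d) =1 lau 1.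
Proof.
move=> n; rewrite -polyCN convD convX convC /pole_oo.
have [hn|[->|hn]] : n < 0 \/ n = 0 \/ 0 < n by lia.
- have [-> ->] : (n - 1 < 0) = true /\ (n < 0) = true by lia.
  case: n hn => [//|k _].
  have -> : - (Negz k - 1) - 1 = k.+1 by lia.
  have -> : - Negz k - 1 = k by lia.
  by rewrite -!exprnP exprS mulNr subrr.
- by rewrite /= mulr0 addr0 coef1.
- have [-> ->] : (n - 1 < 0) = false /\ (n < 0) = false by lia.
  by rewrite mulr0 addr0; case: n hn => [[|k]|k] // _; rewrite /lau coef1.
Qed.

Section Expansion.
Context (P : {poly K}) (S : seq K).
Hypotheses (uS : uniq S) (sP : (size P <= (size S).+1)%N).

(** Expanding at [w] shifts every pole by [w]. The point [w] may itself be a pole, which is the case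
    d = 0 of [pole_at]. *)
Lemma pf_expansion_at w : expansion_of false w (tofrac P / tofrac (polef S))
  (fun n => P`_(size S) * (n == 0)%:R + \sum_(s <- S) pfcoef P S s * pole_at (s - w) n).
Proof.
split.
  exists (-1) => n n1; rewrite (_ : (n == 0) = false) ?mulr0 ?add0r; last by lia.
  rewrite big1 // => s _; rewrite /pole_at (_ : (n == -1) = false); last by lia.
  by rewrite (_ : (0 <= n) = false) ?if_same ?mulr0 //; lia.
exists P, (polef S); split=> // [|n]; first exact: polef_neq0.
rewrite conv_addr conv_scaler conv_sumr.
rewrite [X in _ = lau (X \Po _) _](partial_fractions uS sP).
rewrite comp_polyD comp_polyZ lauD lauZ raddf_sum /=; congr (_ * _ + _).
  transitivity (conv (polef S \Po ('X + w%:P)) (lau 1) n).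
    by apply: eq_conv; case=> [[|k]|k] //=; rewrite coef1.
  by rewrite conv_lau mulr1.
rewrite (big_morph (fun p : {poly K} => lau p n) (fun p q => lauD p q n) (id1 := 0)) => [|]; last first.
  by case: n => k //=; rewrite coef0.
apply: eq_big_seq => s sS; rewrite comp_polyZ lauZ conv_scaler; congr (_ * _).
rewrite {1}(polef_rem sS) comp_polyM comp_polyB comp_polyX comp_polyC.
have -> : 'X + w%:P - s%:P = 'X - (s - w)%:P by rewrite polyCB; ring.
by rewrite convM (eq_conv _ (conv_pole_at (s - w))) conv_lau mulr1.
Qed.

Lemma pf_expansion_oo : expansion_of true 0 (tofrac P / tofrac (polef S))
  (fun n => P`_(size S) * (n == 0)%:R + \sum_(s <- S) pfcoef P S s * pole_oo s n).
Proof.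
split.
  exists 0 => n n0; rewrite (_ : (n == 0) = false) ?mulr0 ?add0r; last by lia.
  by rewrite big1 // => s _; rewrite /pole_oo ltNge ltW ?mulr0.
exists P, (polef S); split=> // [|n]; first exact: polef_neq0.
rewrite addr0 !comp_polyXr.
rewrite conv_addr conv_scaler conv_sumr.
rewrite [X in _ = lau X _](partial_fractions uS sP).
rewrite lauD lauZ; congr (_ * _ + _).
  transitivity (conv (polef S) (lau 1) n).
    by apply: eq_conv; case=> [[|k]|k] //=; rewrite coef1.
  by rewrite conv_lau mulr1.
rewrite (big_morph (fun p : {poly K} => lau p n) (fun p q => lauD p q n) (id1 := 0)) => [|]; last first.
  by case: n => k //=; rewrite coef0.
apply: eq_big_seq => s sS; rewrite lauZ conv_scaler; congr (_ * _).
rewrite {1}(polef_rem sS) convM (eq_conv _ (conv_pole_oo s)) conv_lau mulr1 //.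
Qed.

End Expansion.

(** The residues are those of f dz/z, and dividing f by z adds the pole 0. *)
Lemma pfcoef_cons0 P S s : 0 \notin S -> s \in S ->
  pfcoef P (0%R :: S) s = pfcoef P S s / s.
Proof.
move=> S0 sS; have s0 : s != 0 by apply: contraNneq S0 => <-.
rewrite /pfcoef /= eq_sym (negPf s0) /polef big_cons hornerM hornerXsubC subr0.
by rewrite invfM mulrA mulrAC.
Qed.

End PartialFractions.

(** * Rational functions with simple nonzero poles, regular at zero and infinity *)

Section RationalFunction.
Context (K : fieldType).

Definition simple_frac (P : {poly K}) (S : seq K) (f : {fraction {poly K}}) : Prop :=
  [/\ uniq S, 0 \notin S, (size P <= (size S).+1)%N
    & f = tofrac P / tofrac (polef S)].

Context (P : {poly K}) (S : seq K) (f : {fraction {poly K}}).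
Hypothesis sf : simple_frac P S f.

Lemma residue_simple s : s \in S -> residue s (f / tofrac 'X) = pfcoef P S s / s.
Proof.
case: sf => uS S0 sP -> sS.
have u0S : uniq (0%R :: S) by rewrite /= S0.
have sP' : (size P <= (size (0%R :: S)).+1)%N by apply: leq_trans sP _.
rewrite -mulrA -invfM -tofracM.
have -> : polef S * 'X = polef (0%R :: S) by rewrite /polef big_cons subr0 mulrC.
rewrite /residue (expansion_atE (pf_expansion_at u0S sP' s)) mulr0 add0r.
(* Only the pole at [s] contributes to the coefficient of index -1; the other terms are regular at
   [s]. *)
rewrite (bigD1_seq s) /= ?inE ?sS ?orbT // subrr /pole_at eqxx eqxx mulr1.
rewrite big1 ?addr0 => [|t ts]; last by rewrite subr_eq0 (negPf ts) mulr0.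
exact: pfcoef_cons0.
Qed.

(** The constant terms of the two expansions cancel, and those of 1/(z - s) differ by s^(-n-1) in
    every degree n, that is by a delta function. One factor 1/s is absorbed in the residue of f
    dz/z, which leaves s^(-n). *)
Lemma expansions_simple :
  [/\ forall n : int, expansion_oo f n - expansion_at 0 f n =
        \sum_(s <- S) residue s (f / tofrac 'X) * s ^ (- n),
      forall n : int, 0 < n -> expansion_oo f n = 0,
      forall n : int, n < 0 -> expansion_at 0 f n = 0,
      expansion_oo f 0 = P`_(size S)
    & expansion_at 0 f 0 = P.[0] / (polef S).[0]].
Proof.
have res := residue_simple; case: (sf) => uS S0 sP ef.
have Sn0 s : s \in S -> s != 0 by apply: contraTneq => ->.
have hoo := pf_expansion_oo uS sP; have hat := pf_expansion_at uS sP 0.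
rewrite -ef in hoo hat; rewrite (expansion_ooE hoo) (expansion_atE hat).
split=> [n|n n0|n n0||].
- rewrite opprD addrACA subrr add0r -sumrB; apply: eq_big_seq => s sS.
  rewrite -mulrBr res // subr0 /pole_at /pole_oo (negPf (Sn0 s sS)).
  rewrite -mulrA [s^-1 * _]mulrC -exprN1 -expfzDr ?Sn0 //.
  by case: ltrP; rewrite ?subr0 ?sub0r ?opprK.
- rewrite (_ : (n == 0) = false) ?mulr0 ?add0r; last by lia.
  by rewrite big1 // => s _; rewrite /pole_oo ltNge ltW ?mulr0.
- rewrite (_ : (n == 0) = false) ?mulr0 ?add0r; last by lia.
  rewrite big1_seq // => s /= sS; rewrite /pole_at subr0 (negPf (Sn0 s sS)).
  by rewrite leNgt n0 mulr0.
- by rewrite eqxx mulr1 big1 ?addr0 // => s _; rewrite /pole_oo ltxx mulr0.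
rewrite eqxx mulr1 [X in _ = X.[0] / _](partial_fractions uS sP).
rewrite hornerD hornerZ mulrDl mulfK ?polef_nroot //; congr (_ + _).
rewrite horner_sum mulr_suml; apply: eq_big_seq => s sS.
rewrite hornerZ -mulrA; congr (_ * _).
rewrite subr0 /pole_at (negPf (Sn0 s sS)) lexx oppr0 add0r.
rewrite (polef_rem sS) hornerM hornerXsubC sub0r invfM mulrA mulfV ?polef_nroot //.
  by rewrite mul1r invrN.
by apply: contra S0 => /mem_rem.
Qed.

End RationalFunction.

Section Comparison.
Context (K : fieldType) (P P' : {poly K}) (S S' : seq K) (f f' : {fraction {poly K}}).
Hypotheses (sf : simple_frac P S f) (sf' : simple_frac P' S' f').
Context (A B : {poly K}).
Hypothesis AB : tofrac A * f = tofrac B * f'.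

Lemma conv_simple : conv A (expansion_oo f) =1 conv B (expansion_oo f') /\
  conv A (expansion_at 0 f) =1 conv B (expansion_at 0 f').
Proof.
case: (sf) (sf') => uS _ sP ef [uS' _ sP' ef'].
have hoo := pf_expansion_oo uS sP; have hat := pf_expansion_at uS sP 0.
have hoo' := pf_expansion_oo uS' sP'; have hat' := pf_expansion_at uS' sP' 0.
rewrite -ef in hoo hat; rewrite -ef' in hoo' hat'.
rewrite (expansion_ooE hoo) (expansion_atE hat).
rewrite (expansion_ooE hoo') (expansion_atE hat'); split.
  by have := expansion_rel hoo hoo' AB; rewrite addr0 !comp_polyXr.
by have := expansion_rel hat hat' AB; rewrite addr0 !comp_polyXr.
Qed.

(** The cross-multiplied identity contains X - s once on each side; it is cancelled and the rest is
    evaluated at [s]. *)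
Lemma residue_rel s : s \in S -> s \in S' ->
  A.[s] * residue s (f / tofrac 'X) = B.[s] * residue s (f' / tofrac 'X).
Proof.
move=> sS sS'; rewrite (residue_simple sf sS) (residue_simple sf' sS') !mulrA.
congr (_ / _); case: (sf) (sf') => uS _ _ ef [uS' _ _ ef'].
move: AB; rewrite ef ef' !mulrA -!tofracM => /frac_eq.
move=> /(_ (polef_neq0 _) (polef_neq0 _)); rewrite (polef_rem sS) (polef_rem sS').
rewrite !mulrA => /(mulIf (negbT (polyXsubC_eq0 s)))/(congr1 (horner^~ s)).
rewrite !hornerM => e; rewrite /pfcoef.
rewrite ?mulrA; apply/eqP; rewrite eqr_div ?polef_rem_nroot //; exact/eqP.
Qed.

End Comparison.

(** * Monomials and affine roots *)

Section MalgSums.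
Context (G : choiceType) (W : zmodType) (F : G -> int -> W).
Hypothesis F_sub : forall g, {morph F g : y z / y - z}.
Implicit Types (m : {malg int[G]}).

(** The additive extension of a family of additive maps. [ymap], [ydeg] and the evaluation used for
    the independence of the affine roots are instances. *)
Definition msum m : W := \sum_(g <- msupp m) F g m@_g.

Let F0 g : F g 0 = 0.
Proof. by have := F_sub g 0 0; rewrite !subrr. Qed.

Lemma msumEw (d : {fset G}) m : (msupp m `<=` d)%fset ->
  msum m = \sum_(g <- d) F g m@_g.
Proof.
move=> le; rewrite /msum (big_fset_incl _ le) // => g _ /mcoeff_outdom ->.
exact: F0.
Qed.

Lemma msumB m m' : msum (m - m') = msum m - msum m'.
Proof.
pose d := (msupp m `|` msupp m' `|` msupp (m - m'))%fset.
have h1 : (msupp m `<=` d)%fset by rewrite /d -fsetUA fsubsetUl.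
have h2 : (msupp m' `<=` d)%fset by rewrite /d fsubsetU // fsubsetUr.
have h3 : (msupp (m - m') `<=` d)%fset by rewrite /d fsubsetUr.
rewrite (msumEw h1) (msumEw h2) (msumEw h3) -sumrB.
by apply: eq_bigr => g _; rewrite mcoeffB F_sub.
Qed.

Lemma msum0 : msum 0 = 0.
Proof. by have := msumB 0 0; rewrite !subrr. Qed.

Lemma msumD m m' : msum (m + m') = msum m + msum m'.
Proof. by rewrite -[m']opprK msumB -[- m' in LHS]sub0r msumB msum0 sub0r !opprK. Qed.

Lemma msumU z g : msum << z *g g >> = F g z.
Proof.
rewrite (msumEw (d := [fset g]%fset)) ?msuppU_le // big_seq_fset1.
by rewrite mcoeffUU.
Qed.

Lemma msum_sum (T : Type) (s : seq T) (P : pred T) (f : T -> {malg int[G]}) :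
  msum (\sum_(t <- s | P t) f t) = \sum_(t <- s | P t) msum (f t).
Proof. exact: (big_morph msum msumD msum0). Qed.

End MalgSums.

Section YMonomialTheory.
Context (I : finType).

Lemma Y_coef (G : zmodType) (i : I) (s : G) p : (Y i s)@_p = ((i, s) == p)%:R.
Proof. by rewrite /Y mcoeffU. Qed.

Lemma sum_Y_coef_gt0P (G : zmodType) (i : I) (e : nat -> G) (n j : nat) t :
  0 < (\sum_(0 <= l < n | l != j) Y i (e l) : ymon I G)@_(i, t) <->
  exists l, [/\ (l < n)%N, l != j & t = e l].
Proof.
rewrite raddf_sum big_mkord /=; split=> [pos|[l [ln lj ->]]].
  apply: contrapT => no; move: pos; rewrite big1 ?ltxx // => l lj.
  rewrite Y_coef xpair_eqE eqxx; case: eqP => // el.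
  by case: no; exists l.
rewrite (bigD1 (Ordinal ln)) //= Y_coef eqxx ltr_wpDr // sumr_ge0 // => l' _.
by rewrite Y_coef ler0n.
Qed.

Section Maps.
Context (G H : zmodType) (f : G -> H).
Implicit Types (i : I) (s : G) (m : ymon I G).

Let F (p : I * G) (z : int) : ymon I H := << z *g (p.1, f p.2) >>.
Let FB p : {morph F p : y z / y - z}. Proof. exact: monalgUB. Qed.

Lemma ymapB m m' : ymap f (m - m') = ymap f m - ymap f m'.
Proof. exact: (msumB FB). Qed.
Lemma ymap_sum (T : Type) (s : seq T) (P : pred T) (g : T -> ymon I G) :
  ymap f (\sum_(t <- s | P t) g t) = \sum_(t <- s | P t) ymap f (g t).
Proof. exact: (msum_sum FB). Qed.
Lemma ymapY (i : I) (s : G) : ymap f (Y i s) = Y i (f s).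
Proof. exact: (msumU FB 1). Qed.

Lemma ymap_coef m p :
  (ymap f m)@_p = \sum_(p' <- msupp m | (p'.1, f p'.2) == p) m@_p'.
Proof.
rewrite /ymap raddf_sum /= [RHS]big_mkcond; apply: eq_bigr => p' _.
by rewrite mcoeffU; case: eqP; rewrite ?mulr1n ?mulr0n.
Qed.

End Maps.

Section Roots.
Context (G : zmodType) (sg : I -> I -> G).

Lemma affine_rootE j s :
  root sg j s = \sum_i (Y i (s + sg i j) - Y i (s - sg i j)).
Proof.
rewrite /root /yshift ymap_sum; apply: eq_bigr => i _.
by rewrite ymapB ymapY ymapY.
Qed.

Lemma root_coef j s i t : (root sg j s)@_(i, t) =
  (s + sg i j == t)%:R - (s - sg i j == t)%:R.
Proof.
rewrite affine_rootE raddf_sum /= (bigD1 i) //= big1 ?addr0 => [|l li].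
  by rewrite mcoeffB /Y !mcoeffU !xpair_eqE eqxx.
by rewrite mcoeffB /Y !mcoeffU !xpair_eqE (negPf li) subrr.
Qed.

Lemma root_diag_neq0 j s : s - sg j j != s + sg j j -> root sg j s != 0.
Proof.
move=> ne; apply/eqP => /(congr1 (mcoeff (j, s + sg j j))).
by rewrite root_coef eqxx (negPf ne) subr0 mcoeff0 => /eqP; rewrite oner_eq0.
Qed.

Lemma root_diag_add_neq0 j s t : s - sg j j != s + sg j j ->
  t - sg j j != s + sg j j -> root sg j s + root sg j t != 0.
Proof.
move=> ne ne'; apply/eqP => /(congr1 (mcoeff (j, s + sg j j))).
rewrite mcoeffD !root_coef eqxx (negPf ne) (negPf ne') !subr0 mcoeff0.
by case: (_ == _).
Qed.

Lemma yshift_root s j t : yshift s (root sg j t) = root sg j (s + t).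
Proof.
rewrite !affine_rootE /yshift ymap_sum; apply: eq_bigr => i _.
by rewrite ymapB !ymapY !addrA.
Qed.

Lemma yshiftB s (m m' : ymon I G) : yshift s (m - m') = yshift s m - yshift s m'.
Proof. exact: ymapB. Qed.

Lemma yshift_coef s (m : ymon I G) i t : (yshift s m)@_(i, t) = m@_(i, t - s).
Proof.
rewrite /yshift ymap_coef (eq_bigl (fun p => p == (i, t - s))) => [|[j t']]; last first.
  by rewrite !xpair_eqE /= [t' == _]eq_sym subr_eq [t == _]eq_sym addrC.
case: (msuppP m (i, t - s)) => [h|h].
  by rewrite -big_filter filter_pred1_uniq ?fset_uniq // big_seq1.
by rewrite big1_seq // => p /andP[/eqP ->]; rewrite (negPf h).
Qed.

End Roots.

Lemma ymap_root (G H : zmodType) (f : G -> H) (sg : I -> I -> G) j s :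
  {morph f : t t' / t + t'} -> {morph f : t t' / t - t'} ->
  ymap f (root sg j s) = root (fun i j => f (sg i j)) j (f s).
Proof.
move=> fD fB; rewrite !affine_rootE ymap_sum; apply: eq_bigr => i _.
by rewrite ymapB ymapY ymapY fD fB.
Qed.

Lemma ydeg_ymap (G H : zmodType) (f : G -> H) i (m : ymon I G) :
  ydeg i (ymap f m) = ydeg i m.
Proof.
pose F (T : zmodType) (p : I * T) (z : int) : int := if p.1 == i then z else 0.
have FB (T : zmodType) p : {morph F T p : y z / y - z}.
  by move=> y z; rewrite /F; case: ifP; rewrite ?subrr.
have degE (T : zmodType) (m' : ymon I T) : ydeg i m' = msum (F T) m'.
  by rewrite /ydeg big_mkcond.
rewrite !degE /ymap (msum_sum (FB H)) /msum; apply: eq_bigr => p _.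
by rewrite -/(msum _ _) (msumU (FB H)).
Qed.

Lemma yspec_root (r : nat) (sigma : I -> I -> qmon r) j s :
  yspec (root sigma j s) = root (sigma1 sigma) j s.2.
Proof. exact: (@ymap_root _ _ snd). Qed.

End YMonomialTheory.

Lemma mon_opp_eq (r : nat) (s : mon r) : s = - s -> s = 0.
Proof.
move=> e; apply/ffunP => i; rewrite ffunE.
have /= := congr1 (fun g : mon r => g i) e; rewrite ffunE.
by move: (s i) => z hz; lia.
Qed.

Section MonomialValues.
Context (r : nat) (K : fieldType) (x : 'I_r -> K).
Hypothesis x_neq0 : forall i, x i != 0.
Implicit Types (e : mon r).

Lemma hmonvalD e e' : hmonval x (e + e') = hmonval x e * hmonval x e'.
Proof.
by rewrite /hmonval -big_split; apply: eq_bigr => i _; rewrite ffunE expfzDr.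
Qed.

Lemma hmonval0 : hmonval x 0 = 1.
Proof. by rewrite /hmonval big1 // => i _; rewrite ffunE. Qed.

Lemma hmonval_neq0 e : hmonval x e != 0.
Proof. by rewrite /hmonval; apply/prodf_neq0 => i _; rewrite expfz_neq0. Qed.

Lemma hmonvalN e : hmonval x (- e) = (hmonval x e)^-1.
Proof.
by apply: (mulfI (hmonval_neq0 e)); rewrite -hmonvalD subrr hmonval0 mulfV ?hmonval_neq0.
Qed.

Lemma monvalE e : monval x e = hmonval x e ^+ 2.
Proof.
rewrite /monval /hmonval -prodrXl; apply: eq_bigr => i _.
by rewrite !expr2 expfzMl.
Qed.

End MonomialValues.

Section VariableIndependence.
Import mpoly.
Context (n : nat) (A : idomainType).

Definition frac_var (i : 'I_n) : {fraction (mpoly n A)} := tofrac 'X_i.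

Lemma frac_var_neq0 i : frac_var i != 0.
Proof.
rewrite tofrac_eq0; apply/eqP => /(congr1 (fun p : mpoly n A => p@_U_(i))).
by rewrite mcoeffXU eqxx mcoeff0 => /eqP; rewrite oner_eq0.
Qed.

(** It suffices to treat the value 1. Separating positive and negative exponents turns it into the
    equality of two monomials of the polynomial ring. *)
Lemma hmonval_frac_inj : injective (hmonval frac_var).
Proof.
suff h (e : mon n) : hmonval frac_var e = 1 -> e = 0.
  move=> e e' ee'; apply/eqP; rewrite -subr_eq0; apply/eqP/h.
  rewrite hmonvalD ?hmonvalN ?ee' ?mulfV ?hmonval_neq0 //; exact: frac_var_neq0.
pose pos (z : int) : nat := if z is Posz k then k else 0%N.
have posE (z : int) : z = (pos z)%:Z - (pos (- z))%:Z by case: z => [[|k]|k] //=; lia.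
pose mp (e : mon n) : 'X_{1..n} := [multinom pos (e i) | i < n].
have mpX (e' : mon n) : tofrac 'X_[mp e'] = \prod_i frac_var i ^+ pos (e' i).
  rewrite mpolyXE_id rmorph_prod; apply: eq_bigr => i _.
  by rewrite mnmE rmorphXn.
move=> he; have e1 : tofrac ('X_[mp e] : mpoly n A) = tofrac ('X_[mp (- e)] : mpoly n A).
  rewrite !mpX; apply: etrans (mul1r _); rewrite -[X in _ = X * _]he -big_split.
  apply: eq_bigr => i _ /=.
  rewrite ffunE [X in _ ^ X * _]posE expfzDr ?frac_var_neq0 // -exprnP -exprnN.
  by rewrite divfK // expf_neq0 // frac_var_neq0.
have /eqP : mp e == mp (- e).
  move/eqP: e1; rewrite tofrac_eq => /eqP /(congr1 (fun p : mpoly n A => p@_(mp e))).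
  by rewrite !mcoeffX eqxx eq_sym; case: eqP => // _ /eqP; rewrite oner_eq0.
move=> me; apply/ffunP => i; have := congr1 (fun m : 'X_{1..n} => m i) me.
by rewrite !mnmE !ffunE => pe; rewrite (posE (e i)) pe subrr.
Qed.

End VariableIndependence.

Lemma fracR_var_neq0 r i : fracR_var (r := r) i != 0.
Proof. exact: frac_var_neq0. Qed.

(** * Independence of the affine roots at q = 1 *)

Section RootIndependence.
Context (I : finType) (r : nat) (sigma : I -> I -> qmon r).
Hypothesis cartan : is_cartan sigma.
Local Notation sg := (sigma1 sigma).
Implicit Types (i j l : I) (nu tau : mon r).

Let F : fieldType := fracR r.
Let y (k : 'I_r) : F := fracR_var (lift ord0 k).
(** Here [y] consists of the variables q_k themselves, so that [hmonval] gives the value of the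
    monomial and not of its square root. *)
Let val (e : mon r) : F := hmonval y e.

Let y_neq0 k : y k != 0. Proof. exact: fracR_var_neq0. Qed.

Lemma sigma1C i j : sg i j = sg j i.
Proof. by case: cartan => sC _ _ _; rewrite /sigma1 sC. Qed.

Lemma sigma1_diag i : sg i i = 0.
Proof. by case: cartan => _ si _ _; rewrite /sigma1 si. Qed.

Let C : 'M[F]_#|I| := cartan_mx 1 y sigma.

Let CE i j : C (enum_rank i) (enum_rank j) = val (sg i j) - val (- sg i j).
Proof.
rewrite mxE !enum_rankK /qmonval exp1rz mul1r.
by rewrite /val hmonvalN.
Qed.

Let detC : \det C != 0. Proof. by case: cartan. Qed.

(* The determinant is used through the evaluation of the variables of one
   color, which sends [root sg j s] to [val s] times an entry of row [j]. *)
Let ev l (p : I * mon r) (z : int) : F := if p.1 == l then z%:~R * val p.2 else 0.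

Let evB l p : {morph ev l p : z z' / z - z'}.
Proof. by move=> z z'; rewrite /ev; case: eqP; rewrite ?subrr // intrB mulrBl. Qed.

Let ev_root l j s : msum (ev l) (root sg j s) = val s * C (enum_rank l) (enum_rank j).
Proof.
rewrite affine_rootE (msum_sum (evB l)) (bigD1 l) //= big1 => [|k kl].
  rewrite (msumB (evB l)) !(msumU (evB l)) /ev /= eqxx !mul1r addr0 CE.
  by rewrite /val !hmonvalD // mulrBr.
by rewrite (msumB (evB l)) !(msumU (evB l)) /ev /= (negPf kl) subrr.
Qed.

Let rows_free i j (c d : F) : i != j ->
  (forall l, c * C (enum_rank l) (enum_rank i) + d * C (enum_rank l) (enum_rank j) = 0) ->
  c = 0.
Proof.
move=> ij h; apply/eqP; apply: contraNT detC; move: C h => A h c0.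
rewrite -det_tr; apply/det0P.
exists (c *: delta_mx 0 (enum_rank i) + d *: delta_mx 0 (enum_rank j)).
  apply: contra_neq c0 => /rowP/(_ (enum_rank i)).
  rewrite !mxE !eqxx (inj_eq enum_rank_inj) (negPf ij) andbF.
  by rewrite mulr1 mulr0 addr0.
rewrite mulmxDl -!scalemxAl -!rowE; apply/rowP => k.
by rewrite !mxE -[k]enum_valK h.
Qed.

(** Otherwise a column of C would be zero. The color [l] cannot be [i]; it provides two variables in
    which A_i has exponents 1 and -1, by which moves of color i are detected. *)
Lemma exists_sigma1_neq0 i : exists l, sg l i != 0.
Proof.
apply/existsP; apply: contraNT detC; rewrite negb_exists => /forallP h.
have h0 l : C (enum_rank l) (enum_rank i) = 0.
  by rewrite CE; have := h l; rewrite negbK => /eqP ->; rewrite oppr0 subrr.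
move: C h0 => A h0; rewrite -det_tr; apply/det0P.
exists (delta_mx 0 (enum_rank i)).
  apply/eqP => /rowP/(_ (enum_rank i)); rewrite !mxE !eqxx.
  by move/eqP; rewrite oner_eq0.
by rewrite -rowE; apply/rowP => k; rewrite !mxE -[k]enum_valK h0.
Qed.

Lemma root_coef_add l i nu : sg l i != 0 -> (root sg i nu)@_(l, nu + sg l i) = 1.
Proof.
move=> s0; rewrite root_coef eqxx (_ : (_ == _) = false) ?subr0 //.
apply/negbTE; apply: contra s0 => /eqP/addrI e.
by apply/eqP/mon_opp_eq; rewrite e.
Qed.

Lemma root_coef_sub l i nu : sg l i != 0 -> (root sg i nu)@_(l, nu - sg l i) = -1.
Proof.
move=> s0; rewrite root_coef eqxx (_ : (_ == _) = false) ?sub0r //.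
by apply/negbTE; apply: contra s0 => /eqP/addrI/mon_opp_eq ->.
Qed.

Lemma root_neq0 i nu : root sg i nu != 0.
Proof.
have [l s0] := exists_sigma1_neq0 i; apply/eqP => /(congr1 (mcoeff (l, nu + sg l i))).
by rewrite root_coef_add // mcoeff0 => /eqP; rewrite oner_eq0.
Qed.

(** For two colors, evaluation would make two columns of C proportional. For one color the position
    of the exponent 1 determines the label. *)
Lemma root_inj i j nu tau : root sg i nu = root sg j tau -> (i, nu) = (j, tau).
Proof.
move=> e; have [ij|ij] := eqVneq i j.
  subst j; congr (_, _); have [l s0] := exists_sigma1_neq0 i.
  have := congr1 (mcoeff (l, nu + sg l i)) e; rewrite root_coef_add // root_coef.
  case: eqP => [/addIr -> //|_]; case: eqP => _; rewrite ?subrr ?sub0r; lia.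
have c0 : val nu = 0.
  apply: (rows_free (d := - val tau) ij) => l.
  by rewrite mulNr -!ev_root e subrr.
by have := hmonval_neq0 y_neq0 nu; rewrite -/(val nu) c0 eqxx.
Qed.

(** For one color, cancelling both variables of color l requires tau + s = nu - s and tau - s = nu +
    s, hence s = -s, against the choice of l. *)
Lemma root_add_neq0 i j nu tau : root sg i nu + root sg j tau != 0.
Proof.
apply/eqP => e; have [ij|ij] := eqVneq i j.
  subst j; have [l s0] := exists_sigma1_neq0 i.
  have := congr1 (mcoeff (l, nu + sg l i)) e.
  have := congr1 (mcoeff (l, nu - sg l i)) e.
  rewrite !mcoeffD root_coef_sub // root_coef_add // !root_coef !mcoeff0.
  case: (tau + sg l i =P nu - sg l i) => [e1|_]; last by case: (_ == _); lia.
  case: (tau - sg l i =P nu + sg l i) => [e2 _ _|_]; last first.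
    by move=> _; case: (_ == _); lia.
  case/eqP: s0; apply: mon_opp_eq.
  apply/ffunP => k; move: e1 e2 => /ffunP/(_ k) + /ffunP/(_ k).
  by rewrite !ffunE; move: (tau k) (nu k) (sg l i k) => a b c; lia.
have c0 : val nu = 0.
  apply: (rows_free (d := val tau) ij) => l.
  by rewrite -!ev_root -(msumD (evB l)) e (msum0 (evB l)).
by have := hmonval_neq0 y_neq0 nu; rewrite -/(val nu) c0 eqxx.
Qed.

End RootIndependence.

(** * The functions f_i *)

Section MonomialFunctions.
Context (K : fieldType) (I : finType) (r : nat) (x : 'I_r -> K) (u : K).
Hypotheses (x_neq0 : forall k, x k != 0) (u_neq0 : u != 0).
Implicit Types (i j l : I) (t : mon r) (m : ymon I (mon r)).

Let hm_neq0 := hmonval_neq0 x_neq0.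

Definition ylin t : {poly K} := (hmonval x t)^-1 *: 'X - (hmonval x t * u)%:P.
Definition ypole t : K := monval x t * u.

Lemma ylinE t : ylin t = (hmonval x t)^-1 *: ('X - (ypole t)%:P).
Proof.
rewrite /ylin scalerBr -[_ *: (ypole t)%:P]mul_polyC -polyCM; congr (_ - _%:P).
by rewrite /ypole monvalE expr2 !mulrA mulVf ?hm_neq0 // mul1r.
Qed.

Lemma ylin_neq0 t : ylin t != 0.
Proof.
by rewrite ylinE scaler_eq0 invr_eq0 (negPf (hm_neq0 t)) polyXsubC_eq0.
Qed.

Lemma ypole_neq0 t : ypole t != 0.
Proof. by rewrite mulf_neq0 // monvalE expf_neq0. Qed.

Let g t : {fraction {poly K}} := (tofrac (ylin t))^-1.

Let g_neq0 t : g t != 0.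
Proof. by rewrite invr_neq0 // tofrac_eq0 ylin_neq0. Qed.

Lemma fYEw i (d : {fset (I * mon r)%type}) m : (msupp m `<=` d)%fset ->
  fY x u i m = \prod_(p <- d | p.1 == i) g p.2 ^ m@_p.
Proof.
move=> le; rewrite /fY -/g big_mkcond [RHS]big_mkcond (big_fset_incl _ le) //=.
by move=> p _ /mcoeff_outdom ->; rewrite expr0z if_same.
Qed.

Lemma fYD i m m' : fY x u i (m + m') = fY x u i m * fY x u i m'.
Proof.
pose d := (msupp m `|` msupp m' `|` msupp (m + m'))%fset.
have h1 : (msupp m `<=` d)%fset by rewrite /d -fsetUA fsubsetUl.
have h2 : (msupp m' `<=` d)%fset by rewrite /d fsubsetU // fsubsetUr.
have h3 : (msupp (m + m') `<=` d)%fset by rewrite /d fsubsetUr.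
rewrite (fYEw i h1) (fYEw i h2) (fYEw i h3) -big_split /=.
by apply: eq_bigr => p _; rewrite mcoeffD expfzDr.
Qed.

Lemma fY_neq0 i m : fY x u i m != 0.
Proof.
rewrite /fY prodf_seq_neq0; apply/allP => p _; apply/implyP => _.
by rewrite expfz_neq0 // g_neq0.
Qed.

Lemma fY0 i : fY x u i 0 = 1.
Proof. by apply: (mulfI (fY_neq0 i 0)); rewrite -fYD addr0 mulr1. Qed.

Lemma fYN i m : fY x u i (- m) = (fY x u i m)^-1.
Proof. by apply: (mulfI (fY_neq0 i m)); rewrite -fYD subrr fY0 mulfV ?fY_neq0. Qed.

Lemma fY_Y i l t : fY x u i (Y l t) = if l == i then g t else 1.
Proof.
rewrite (fYEw i (d := [fset (l, t)]%fset)) ?msuppU_le //.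
by rewrite big_mkcond big_seq_fset1 /= mcoeffUU expr1z.
Qed.

(** Only two variables of A_{j,t} are seen by f_i, those at t sigma_ij and t / sigma_ij. The square
    roots in their normalizations combine to the factor sigma_ij. *)
Lemma fY_root (sg : I -> I -> mon r) i j t m :
  tofrac ('X - (monval x (sg i j) * ypole t)%:P) * fY x u i (m + root sg j t) =
  tofrac (monval x (sg i j) *: 'X - (ypole t)%:P) * fY x u i m.
Proof.
set s := sg i j.
have -> : fY x u i (m + root sg j t) =
    fY x u i m * (tofrac (ylin (t - s)) / tofrac (ylin (t + s))).
  rewrite fYD affine_rootE; congr (_ * _).
  rewrite (big_morph (fY x u i) (fYD i) (fY0 i)) (bigD1 i) //= big1 => [|l li].
    by rewrite fYD fYN !fY_Y eqxx mulr1 /g invrK mulrC.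
  by rewrite fYD fYN !fY_Y (negPf li) divr1.
rewrite mulrCA [RHS]mulrC; congr (_ * _).
have D0 : tofrac (ylin (t + s)) != 0 by rewrite tofrac_eq0 ylin_neq0.
rewrite mulrA -tofracM; apply: (canLR (mulfK D0)); rewrite -tofracM; congr tofrac.
have [hs0 ht0] := (hm_neq0 s, hm_neq0 t).
have -> : monval x s *: 'X - (ypole t)%:P = monval x s *: ('X - (ypole (t - s))%:P).
  rewrite scalerBr -[_ *: (ypole _)%:P]mul_polyC -polyCM; congr (_ - _%:P).
  by rewrite /ypole !monvalE hmonvalD // hmonvalN //; field.
have -> : monval x s * ypole t = ypole (t + s).
  by rewrite /ypole !monvalE hmonvalD //; ring.
rewrite !ylinE -scalerAl -!scalerAr scalerA; congr (_ *: _); last exact: mulrC.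
by rewrite monvalE !hmonvalD // hmonvalN //; field; rewrite hs0 ht0.
Qed.

Definition ylab i m (z : int) : seq (mon r) :=
  [seq p.2 | p <- msupp m & (p.1 == i) && (m@_p == z)].

Lemma ylab_uniq i m z : uniq (ylab i m z).
Proof.
rewrite map_inj_in_uniq ?filter_uniq ?fset_uniq // => -[j t] [j' t'].
by rewrite !mem_filter /= => /andP[/andP[/eqP -> _] _] /andP[/andP[/eqP -> _] _] ->.
Qed.

Lemma mem_ylab i m z t : z != 0 -> (t \in ylab i m z) = (m@_(i, t) == z).
Proof.
move=> z0; apply/mapP/eqP => [[[j t']]|e].
  by rewrite mem_filter /= => /andP[/andP[/eqP -> /eqP <-] _] ->.
by exists (i, t) => //; rewrite mem_filter eqxx e eqxx -mcoeff_neq0 e.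
Qed.

Lemma prod_ylin (L : seq (mon r)) : \prod_(t <- L) tofrac (ylin t) =
  tofrac ((\prod_(t <- L) hmonval x t)^-1 *: polef [seq ypole t | t <- L]).
Proof.
rewrite -rmorph_prod /polef big_map; congr tofrac.
elim: L => [|t L IH]; first by rewrite !big_nil invr1 scale1r.
by rewrite !big_cons IH ylinE invfM -scalerAl -scalerAr scalerA.
Qed.

Section Generic.
Context (i : I) (m : ymon I (mon r)).
Hypotheses (gen_m : generic m) (deg_m : ydeg i m = 0).

Let gen_split (p : I * mon r) : p \in msupp m -> m@_p != 1 -> m@_p = -1.
Proof.
by rewrite -mcoeff_neq0; move: (gen_m p); rewrite !inE => /or3P[]/eqP ->.
Qed.

Lemma fY_generic : fY x u i m =
  (\prod_(t <- ylab i m 1) tofrac (ylin t))^-1 * \prod_(t <- ylab i m (-1)) tofrac (ylin t).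
Proof.
rewrite /fY -/g (bigID (fun p => m@_p == 1)) /= -prodfV /ylab !big_map !big_filter.
congr (_ * _); first by apply: eq_bigr => p /andP[_ /eqP ->]; rewrite expr1z.
rewrite big_seq_cond [RHS]big_seq_cond; apply: eq_big => p.
  case: (boolP (p \in msupp m)) => //= pm; case: eqP => //= _.
  by apply/idP/eqP => [/gen_split -> //|->].
move=> /and3P[pm _ /gen_split ->] //.
by rewrite /g exprN1 invrK.
Qed.

(** Degree zero enters here: f_i(m) has as many zeros as poles and is therefore finite at
    infinity. *)
Lemma size_ylab_generic : size (ylab i m 1) = size (ylab i m (-1)).
Proof.
have sz z : (size (ylab i m z))%:Z =
    \sum_(p <- msupp m | (p.1 == i) && (m@_p == z)) 1.
  by rewrite size_map size_filter -sum1_count -[Posz _]natz natr_sum.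
move: deg_m; rewrite /ydeg (bigID (fun p => m@_p == 1)) /=.
rewrite (eq_bigr (fun=> 1)) => [|p /andP[_ /eqP //]].
rewrite -sz [X in _ + X](_ : _ = - (size (ylab i m (-1)))%:Z); first by lia.
rewrite sz -sumrN big_seq_cond [RHS]big_seq_cond; apply: eq_big => p.
  case: (boolP (p \in msupp m)) => //= pm; case: eqP => //= _.
  by apply/idP/eqP => [/gen_split -> //|->].
by move=> /and3P[pm _ /gen_split ->].
Qed.

Let cst : K := (\prod_(t <- ylab i m 1) hmonval x t) /
  (\prod_(t <- ylab i m (-1)) hmonval x t).

Definition fYnum : {poly K} := cst *: polef [seq ypole t | t <- ylab i m (-1)].
Definition fYpoles : seq K := [seq ypole t | t <- ylab i m 1].

Hypothesis ypole_inj : injective ypole.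

Lemma fY_simple : simple_frac fYnum fYpoles (fY x u i m).
Proof.
have prod_neq0 (L : seq (mon r)) : \prod_(t <- L) hmonval x t != 0.
  by rewrite prodf_seq_neq0; apply/allP => t _; apply: hm_neq0.
split.
- by rewrite map_inj_uniq // ylab_uniq.
- by apply/negP => /mapP[t _] /esym/eqP; rewrite (negPf (ypole_neq0 t)).
- rewrite (leq_trans (size_scale_leq _ _)) // size_polef.
  by rewrite (size_map ypole (ylab i m (-1))) (size_map ypole) size_ylab_generic.
have invC (c : K) : c != 0 -> tofrac (c^-1)%:P = (tofrac c%:P)^-1.
  move=> c0; have c0' : tofrac c%:P != 0 by rewrite tofrac_eq0 polyC_eq0.
  by apply: (mulfI c0'); rewrite -tofracM -polyCM !mulfV // tofrac1.
rewrite fY_generic !prod_ylin /fYnum /cst -!mul_polyC polyCM !tofracM !invC //.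
by rewrite invfM invrK mulrACA [_^-1 * tofrac (polef _)]mulrC !mulrA.
Qed.

(** The value at infinity times the value at 0 is one, which becomes the relation K^+_{i,0}
    K^-_{i,0} = 1. This is the effect of the half powers of sigma in f_i, which occur inversely in
    the two limits. *)
Lemma fY_simple_limits :
  fYnum`_(size fYpoles) * (fYnum.[0] / (polef fYpoles).[0]) = 1.
Proof.
have prod_neq0 (L : seq (mon r)) : \prod_(t <- L) hmonval x t != 0.
  by rewrite prodf_seq_neq0; apply/allP => t _; apply: hm_neq0.
have e0 (L : seq (mon r)) : (polef [seq ypole t | t <- L]).[0] =
    (- u) ^+ size L * (\prod_(t <- L) hmonval x t) ^+ 2.
  rewrite /polef big_map; elim: L => [|t L IH].
    by rewrite !big_nil expr0 expr1n hornerC mulr1.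
  rewrite !big_cons hornerM IH hornerXsubC sub0r /ypole monvalE /= [(- u) ^+ _.+1]exprS; ring.
have lead (L : seq (mon r)) : (polef [seq ypole t | t <- L])`_(size L) = 1.
  have /monicP := monic_prod_XsubC [seq ypole t | t <- L] predT id.
  by rewrite /lead_coef -/(polef _) size_polef size_map.
rewrite /fYnum /fYpoles coefZ hornerZ (size_map ypole) size_ylab_generic lead !e0 size_ylab_generic.
rewrite /cst; set a := \prod_(t <- _) _; set b := \prod_(t <- _) _.
have v0 : (- u) ^+ size (ylab i m (-1)) != 0 by rewrite expf_neq0 // oppr_eq0.
have [a0 b0] : a != 0 /\ b != 0 by split; exact: prod_neq0.
move: (_ ^+ size _) v0 => v v0; clearbody a b.
by field; rewrite b0 a0 v0.
Qed.

End Generic.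
End MonomialFunctions.

(** * Products of blocks *)

Section FiniteSums.
Context (T : eqType) (c : T -> int) (v : int).
Hypothesis (cv : is_fin_sum c v) (c_ge0 : forall t, 0 <= c t).

Lemma fin_sum_ge0 : 0 <= v.
Proof. by case: cv => s [_ _ ->]; apply: sumr_ge0. Qed.

Lemma fin_sum_ge1 t : c t <= v.
Proof.
have [->|ct0] := eqVneq (c t) 0; first exact: fin_sum_ge0.
case: cv => s [us hs ->]; rewrite (bigD1_seq t) ?hs //= lerDl.
exact: sumr_ge0.
Qed.

Lemma fin_sum_ge2 t t' : t != t' -> c t + c t' <= v.
Proof.
move=> tt'; have [->|ct0] := eqVneq (c t) 0; first by rewrite add0r fin_sum_ge1.
have [->|ct'0] := eqVneq (c t') 0; first by rewrite addr0 fin_sum_ge1.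
case: cv => s [us hs ->]; rewrite (bigD1_seq t) ?hs //= lerD2l -big_filter.
rewrite (bigD1_seq t') ?filter_uniq //= ?lerDl ?sumr_ge0 //.
by rewrite mem_filter eq_sym tt' hs.
Qed.

Lemma fin_sum_neq0 : v != 0 -> exists t, c t != 0.
Proof.
case: cv => s [_ _ ->] v0; apply/not_existsP => h; move/eqP: v0; case.
by apply: big1 => t _; apply/eqP; apply: contra_notT (h t).
Qed.

End FiniteSums.

Section Choices.
Context (I : finType) (r : nat).
Local Notation ymon := (ymon I (qmon r)).
Implicit Types (P : seq (seq ymon)) (c : seq ymon) (B : seq ymon) (m : ymon).

Lemma choicesP P c : reflect
  (size c = size P /\ forall b, (b < size P)%N -> nth 0 c b \in nth [::] P b)
  (c \in choices P).
Proof.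
elim: P c => [|B P IH] c /=.
  rewrite inE; apply: (iffP eqP) => [->|[/size0nil ->]] //.
apply: (iffP allpairsP) => [[[m c'] /= [mB /IH[sc hc] ->]]|[]].
  by split=> [|[|b]] //=; [rewrite sc | apply: hc].
case: c => [//|m c] /= [sc] h; exists (m, c); split=> //=; first exact: (h 0%N).
by apply/IH; split=> // b bP; apply: (h b.+1).
Qed.

Lemma ymonofE c : ymonof c = \sum_(b < size c) nth 0 c b.
Proof. by rewrite /ymonof (big_nth 0) big_mkord. Qed.

Lemma ymonof_coef c p : (ymonof c)@_p = \sum_(b < size c) (nth 0 c b)@_p.
Proof. by rewrite ymonofE raddf_sum. Qed.

Lemma ymonof_set c b m : (b < size c)%N ->
  ymonof (set_nth 0 c b m) = ymonof c - nth 0 c b + m.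
Proof.
move=> bc; rewrite !ymonofE size_set_nth (maxn_idPr _) //.
rewrite (bigD1 (Ordinal bc)) //= [in RHS](bigD1 (Ordinal bc)) //=.
rewrite nth_set_nth /= eqxx addrC [X in _ = X - _ + _]addrC addrK.
congr (_ + _); apply: eq_bigr => b' bb'.
by rewrite nth_set_nth /= ifN.
Qed.

Lemma choices_set P c b m : c \in choices P -> (b < size P)%N ->
  m \in nth [::] P b -> set_nth 0 c b m \in choices P.
Proof.
move=> /choicesP[sc hc] bP mP; apply/choicesP; split=> [|b' b'P].
  by rewrite size_set_nth sc (maxn_idPr _).
by rewrite nth_set_nth /=; case: eqP => [->|_] //; apply: hc.
Qed.

Section Products.
Context (sigma : I -> I -> qmon r) (i : I) (P : seq (seq ymon)) (c : seq ymon).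
Hypotheses (prodP : block_product sigma i P) (cP : c \in choices P).

Lemma product_disjoint b b' p : (b < size P)%N -> (b' < size P)%N -> b <> b' ->
  (nth 0 c b)@_p = 0 \/ (nth 0 c b')@_p = 0.
Proof.
case: prodP => _ gen; have /choicesP[_ hc] := cP.
move=> bP b'P bb'; case: (ltngtP b b') => // lt.
- have lt2 : (b < b' < size P)%N by rewrite lt b'P.
  by have [_ _] := gen _ _ lt2 _ _ (hc b bP) (hc b' b'P); apply.
- have lt2 : (b' < b < size P)%N by rewrite lt bP.
  have [_ _] := gen _ _ lt2 _ _ (hc b' b'P) (hc b bP).
  by move=> /(_ p)[]; [right|left].
Qed.

(** By mutual genericity a variable occurs in one factor only, so that nothing is added to its
    exponent or cancelled. *)
Lemma product_coefE b p : (b < size P)%N -> (nth 0 c b)@_p != 0 ->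
  (ymonof c)@_p = (nth 0 c b)@_p.
Proof.
move=> bP h; have /choicesP[sc _] := cP; rewrite ymonof_coef sc.
rewrite (bigD1 (Ordinal bP)) //= big1 ?addr0 // => b' bb'.
have ne : b <> b' by move=> e; case/eqP: bb'; apply: val_inj.
by case: (product_disjoint p bP (ltn_ord b') ne) => // e; rewrite e eqxx in h.
Qed.

Lemma product_coef_neq0 p : (ymonof c)@_p != 0 ->
  exists2 b, (b < size P)%N & (ymonof c)@_p = (nth 0 c b)@_p.
Proof.
move=> h; have /choicesP[sc _] := cP.
case: (pselect (exists b : 'I_(size P), (nth 0 c b)@_p != 0)) => [[b hb]|no].
  by exists b => //; apply: product_coefE.
move/eqP: h; case; rewrite ymonof_coef sc big1 // => b _.
by apply/eqP; apply: contra_notT no => hb; exists b.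
Qed.

End Products.
End Choices.

Section BlockPositivity.
Context (I : finType) (r : nat) (sigma : I -> I -> qmon r).
Local Notation ymon := (ymon I (qmon r)).
Implicit Types (i : I) (s t : qmon r) (B : seq ymon) (m : ymon).

(** Positive powers of color i come from the product of the Y_{i,q^(2l-k)} alone: [mb] has negative
    powers and avoids these variables, and [mbj] has no variable of color i. *)
Lemma block_positive i B : block sigma i B -> exists k s,
  [/\ size B = k.+1,
      forall j t, (j <= k)%N -> (0 < (nth 0 B j)@_(i, t)) <->
        (exists l, [/\ (l <= k)%N, l != j & t = s + qexp (2 * l%:Z - k%:Z)])
    & forall j, (j < k)%N ->
        nth 0 B j.+1 = nth 0 B j - root sigma i (s + qexp (2 * j%:Z + 1 - k%:Z))].
Proof.
case=> s [B0 [[k [mb [mbj [sB [_ hmb] hmbj hB hroot]]]] ->]].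
have nthE j : (j <= k)%N -> nth 0 (map (yshift s) B0) j = yshift s (nth 0 B0 j).
  by move=> jk; rewrite (nth_map 0) // sB.
exists k, s; split; first by rewrite size_map.
  move=> j t jk; rewrite (nthE j jk) yshift_coef (hB j jk) 2!mcoeffD.
  have -> : (mbj j)@_(i, t - s) = 0.
    by have [_ h] := hmbj j jk; apply/eqP/negPn/negP => /h /(_ erefl).
  have mb_le0 : mb@_(i, t - s) <= 0.
    by have [->|/hmb[_ /ltW]] := eqVneq mb@_(i, t - s) 0.
  have posP := sum_Y_coef_gt0P i (fun l => qexp (2 * l%:Z - k%:Z) : qmon r) k.+1 j (t - s).
  rewrite addr0; split=> [pos|[l [lk lj et]]].
    have := lt_le_trans pos (lerD mb_le0 (lexx _)); rewrite add0r.
    move=> /posP[l [lk lj e]].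
    by exists l; split=> //; rewrite -e addrC subrK.
  have e : t - s = qexp (2 * l%:Z - k%:Z) by rewrite et addrC addKr.
  have -> : mb@_(i, t - s) = 0.
    by rewrite e; apply/eqP/negPn/negP => /hmb[_ _ /(_ l lk erefl)].
  by rewrite add0r; apply/posP; exists l.
move=> j jk; rewrite (nthE j.+1 jk) (nthE j (ltnW jk)) (hroot j jk).
by rewrite yshiftB yshift_root.
Qed.

(** The blocks that carry edges: [s] is the label of the edge, and the only positive variables of
    color i are the dominant one of [m0] and the anti-dominant one of [m1]. *)
Definition pair_block i (B : seq ymon) s m0 m1 : Prop :=
  [/\ B = [:: m0; m1], m1 = m0 - root sigma i s,
      forall t, 0 < m0@_(i, t) <-> t = s + qexp 1
    & forall t, 0 < m1@_(i, t) <-> t = s - qexp 1].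

(* After the specialization q = 1, a block of length at least 3 has monomials
   that contain the square of a variable. *)
Lemma block_cases i B m : block sigma i B -> m \in B ->
  (forall t t', 0 < m@_(i, t) -> 0 < m@_(i, t') -> t.2 = t'.2 -> t = t') ->
  (forall t, ~ 0 < m@_(i, t)) \/ exists s m0 m1, pair_block i B s m0 m1.
Proof.
move=> /block_positive[k [s [sB posB rootB]]] mB inj.
have := mB; rewrite -index_mem sB ltnS; set j := index m B => jk.
have mE : m = nth 0 B j by rewrite nth_index.
have pos l : (l <= k)%N -> l != j -> 0 < m@_(i, s + qexp (2 * l%:Z - k%:Z)).
  by move=> lk lj; rewrite mE; apply/posB => //; exists l.
have inj' l l' : (l <= k)%N -> (l' <= k)%N -> l != j -> l' != j -> l = l'.
  move=> lk l'k lj l'j; have /addrI/(congr1 fst) /= := inj _ _ (pos l lk lj) (pos l' l'k l'j) erefl.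
  by lia.
case: k => [|[|k]] in sB posB rootB jk pos inj' *.
- left=> t; rewrite mE => /posB[] // l []; move: jk; rewrite !leqn0.
  by move=> /eqP -> /eqP ->.
- right; case: B => [//|m0 [//|m1 [|//]]] in sB posB rootB mB {mE j jk pos inj'} *.
  have e1 : m1 = m0 - root sigma i s.
    by have := rootB 0%N isT; rewrite /= => ->; congr (_ - root _ _ _); rewrite addr0.
  exists s, m0, m1; split=> // t.
    have := posB 0%N t isT; rewrite /= => ->; split=> [[[|[|l]] [] //]|->].
    by exists 1%N.
  have qN1 : s - qexp 1 = s + qexp (2 * 0%:Z - 1%:Z) :> qmon r.
    by congr (_ + (_, _)); rewrite oppr0.
  have := posB 1%N t isT; rewrite qN1 /= => ->.
  by split=> [[[|[|l]] [] //]|->]; exists 0%N.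
(* Among at least three indices two differ from [j]; their variables become equal at q = 1, which
   [inj'] forbids. *)
- have [l [l' [h1 h2 h3 h4 h5]]] : exists l l', [/\ (l <= k.+2)%N, (l' <= k.+2)%N, l != j, l' != j & l != l'].
    case: (j) => [|[|j']]; first by exists 1%N, 2%N.
      by exists 0%N, 2%N.
    by exists 0%N, 1%N.
  by move/eqP: h5; case; apply: inj'.
Qed.

End BlockPositivity.

(** * The graph of an admissible series *)

Lemma subr_id_eq0 (W : zmodType) (y z : W) : y - z = y -> z = 0.
Proof. by move/eqP; rewrite subr_eq -{1}[y]addr0 => /eqP/addrI. Qed.

Section Graph.
Context (I : finType) (r : nat) (sigma : I -> I -> qmon r).
Context (chi : series I (qmon r)) (chi1 : series I (mon r)).
Context (D : forall i, decomposition sigma chi i).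
Hypotheses (cartan : is_cartan sigma) (adm : admissible sigma chi chi1).
Local Notation sg := (sigma1 sigma).
Implicit Types (i j : I) (s : qmon r) (tau nu : mon r) (M N : ymon I (qmon r))
  (m n : ymon I (mon r)).

Local Notation prod t := (dec_product t).

Let coef_ge0 i (t : dec_index (D i)) M : 0 <= product_coef (prod t) M.
Proof. by []. Qed.

Let chi_ge0 i M : 0 <= chi M.
Proof. exact: (fin_sum_ge0 (dec_sum (D i) M)). Qed.

Let spec_ge0 i m M : 0 <= (if yspec M == m then chi M else 0).
Proof. by case: ifP => // _; apply: (chi_ge0 i). Qed.

Let coef_ge1 i (t : dec_index (D i)) c : c \in choices (prod t) ->
  1 <= product_coef (prod t) (ymonof c).
Proof.
move=> cP; rewrite /product_coef lez_nat -has_count; apply/hasP.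
by exists c => //=.
Qed.

Lemma choice_chi i (t : dec_index (D i)) c : c \in choices (prod t) ->
  1 <= chi (ymonof c).
Proof.
move=> cP; apply: le_trans (coef_ge1 cP) _.
exact: (fin_sum_ge1 (dec_sum (D i) (ymonof c))).
Qed.

Lemma choice_vertex i (t : dec_index (D i)) c : c \in choices (prod t) ->
  vertex chi1 (yspec (ymonof c)).
Proof.
move=> cP; have [_ _ sp _ _] := adm.
have := fin_sum_ge1 (sp (yspec (ymonof c))) (spec_ge0 i _) (ymonof c).
rewrite /= eqxx => /(le_trans (choice_chi cP)); rewrite /vertex.
by case: eqP => // ->.
Qed.

Lemma vertex_chi1 m : vertex chi1 m -> chi1 m = 1.
Proof. by have [_ _ _ h _] := adm => /h[]. Qed.

Lemma vertex_generic m : vertex chi1 m -> generic m.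
Proof. by have [_ _ _ h _] := adm => /h[]. Qed.

Lemma vertex_lift i m : vertex chi1 m ->
  exists (t : dec_index (D i)) c, c \in choices (prod t) /\ yspec (ymonof c) = m.
Proof.
have [_ _ sp _ _] := adm => /(fin_sum_neq0 (sp m))[M].
case: ifP => [/eqP Mm chiM|_ /eqP //].
have [t] := fin_sum_neq0 (dec_sum (D i) M) chiM.
rewrite /product_coef eqz_nat -lt0n -has_count => /hasP[c cP /eqP cM].
by exists t, c; rewrite cM Mm.
Qed.

(** All multiplicities are nonnegative and that of a vertex is one. Two lifts would differ in the
    monomial, in the product or in the choice within one product, and each possibility would give
    multiplicity at least two. *)
Lemma lift_unique i (t t' : dec_index (D i)) c c' :
  c \in choices (prod t) -> c' \in choices (prod t') ->
  yspec (ymonof c) = yspec (ymonof c') ->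
  existT (fun=> seq (ymon I (qmon r))) t c = existT (fun=> seq (ymon I (qmon r))) t' c'.
Proof.
move=> cP c'P e; have chi1m := vertex_chi1 (choice_vertex cP).
have [_ _ sp _ _] := adm; have {}sp := sp (yspec (ymonof c)).
have [eM|neM] := eqVneq (ymonof c) (ymonof c'); last first.
  have := fin_sum_ge2 sp (spec_ge0 i _) neM; rewrite /= eqxx -e eqxx chi1m.
  by have := choice_chi cP; have := choice_chi c'P; lia.
have chiM1 : chi (ymonof c) <= 1.
  by have := fin_sum_ge1 sp (spec_ge0 i _) (ymonof c); rewrite /= eqxx chi1m.
have [et|net] := eqVneq t t'; last first.
  have := fin_sum_ge2 (dec_sum (D i) (ymonof c)) (fun t => coef_ge0 t _) net.
  by have := coef_ge1 cP; have := coef_ge1 c'P; rewrite -eM; lia.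
subst t'; congr existT; apply: contrapT => cc'.
have := fin_sum_ge1 (dec_sum (D i) (ymonof c)) (fun t => coef_ge0 t _) t.
suff : (2 <= count (fun d => ymonof d == ymonof c) (choices (prod t)))%N.
  by rewrite /product_coef; lia.
rewrite -size_filter; set L := filter _ _.
have cL : c \in L by rewrite mem_filter eqxx.
have c'L : c' \in L by rewrite mem_filter eM eqxx.
case: L cL c'L => [|d [|d' L]] //; rewrite !inE => /eqP ed /eqP e'.
by case: cc'; rewrite ed e'.
Qed.

Section Specialization.
Context (M : ymon I (qmon r)) (chiM : chi M != 0) (vM : vertex chi1 (yspec M)).

Let spec_sum i tau : is_fin_sum
  (fun p => if (p.1, p.2.2) == (i, tau) then M@_p else 0) (yspec M)@_(i, tau).
Proof.
exists (msupp M); split; first exact: fset_uniq.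
  by move=> p; case: ifP => // _; rewrite ?eqxx // mcoeff_neq0.
by rewrite -big_mkcond; apply: ymap_coef.
Qed.

Let no_cancel i s p : 0 < M@_(i, s) ->
  0 <= (if (p.1, p.2.2) == (i, s.2) then M@_p else 0).
Proof.
case: p => j s' pos; case: eqP => //= -[ji es]; rewrite leNgt; apply/negP => neg.
have [_ _ _ _ h] := adm; apply: (h M i s s' chiM pos _ (esym es)).
by rewrite -ji.
Qed.

Let spec_le1 p : (yspec M)@_p <= 1.
Proof. by have := vertex_generic vM p; rewrite !inE => /or3P[]/eqP ->. Qed.

(** Since no variables cancel, everything specializing to the same variable has a nonnegative
    exponent; genericity bounds the sum by one. For the same reason only one such variable occurs,
    which is [positive_inj]. *)
Lemma positive_spec i s : 0 < M@_(i, s) -> (yspec M)@_(i, s.2) = 1.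
Proof.
move=> pos; apply/le_anti; rewrite spec_le1 /=.
apply: le_trans (fin_sum_ge1 (spec_sum i s.2) (fun p => no_cancel p pos) (i, s)).
by rewrite /= eqxx.
Qed.

Lemma positive_inj i s s' : 0 < M@_(i, s) -> 0 < M@_(i, s') -> s.2 = s'.2 -> s = s'.
Proof.
move=> pos pos' es; apply: contrapT => ne.
have nep : (i, s) != (i, s') by apply/eqP => -[].
have := fin_sum_ge2 (spec_sum i s.2) (fun p => no_cancel p pos) nep.
move: (spec_le1 (i, s.2)); rewrite /= -es !eqxx /=.
move: (M@_(i, s)) (M@_(i, s')) ((yspec M)@_(i, s.2)) pos pos' => z z' y; lia.
Qed.

Lemma spec_positive i tau : 0 < (yspec M)@_(i, tau) ->
  exists2 s, s.2 = tau & 0 < M@_(i, s).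
Proof.
case: (spec_sum i tau) => L [_ _ ->] pos; apply: contrapT => no.
move: pos; rewrite ltNge; case/negP; apply: sumr_le0 => -[j s] _ /=.
case: eqP => //= -[ji st]; rewrite leNgt; apply/negP => pos; case: no.
by exists s => //; rewrite -ji.
Qed.

End Specialization.

Section Color.
Context (i : I).
Implicit Types (t : dec_index (D i)) (c : seq (ymon I (qmon r))) (b : nat).

Lemma choice_chi_neq0 t c : c \in choices (prod t) -> chi (ymonof c) != 0.
Proof. by move=> /choice_chi; case: eqP => // ->. Qed.

Let cvx t c (cP : c \in choices (prod t)) := choice_vertex cP.

Lemma choice_positive t c b s : c \in choices (prod t) -> (b < size (prod t))%N ->
  0 < (nth 0 c b)@_(i, s) -> 0 < (ymonof c)@_(i, s).
Proof.
move=> cP bP pos; rewrite (product_coefE (dec_productP t) cP bP) //.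
by rewrite gt_eqF.
Qed.

Lemma choice_block t c b : c \in choices (prod t) -> (b < size (prod t))%N ->
  (forall s, ~ 0 < (nth 0 c b)@_(i, s)) \/
  exists s M0 M1, pair_block sigma i (nth [::] (prod t) b) s M0 M1.
Proof.
move=> cP bP; have /choicesP[_ hc] := cP; have [hb _] := dec_productP t.
apply: (block_cases (hb _ (mem_nth _ bP)) (hc b bP)) => s s' pos pos'.
apply: (positive_inj (choice_chi_neq0 cP) (cvx cP));
  exact: (choice_positive cP bP).
Qed.

(** The situation at the source of an edge: [c] picks the upper monomial of the factor [b]. The edge
    replaces it by the lower one ([top_flip]). *)
Definition top t c b s M0 M1 : Prop :=
  [/\ c \in choices (prod t), (b < size (prod t))%N,
      pair_block sigma i (nth [::] (prod t) b) s M0 M1 & nth 0 c b = M0].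

Lemma top_flip t c b s M0 M1 : top t c b s M0 M1 ->
  [/\ set_nth 0 c b M1 \in choices (prod t), nth 0 (set_nth 0 c b M1) b = M1
    & ymonof (set_nth 0 c b M1) = ymonof c - root sigma i s].
Proof.
move=> [cP bP [eB e1 _ _] e0]; have /choicesP[sc _] := cP; split.
- by apply: choices_set => //; rewrite eB !inE eqxx orbT.
- by rewrite nth_set_nth /= eqxx.
- by rewrite ymonof_set ?sc // e0 e1 addrA subrK.
Qed.

(** The definition of an edge asks for a dominant variable in some factor; this identifies that
    factor as a pair block with label [s] from which [c] picks the upper monomial. *)
Lemma qedgeP s M N : qedge D i s M N <->
  exists t c b M0 M1, [/\ top t c b s M0 M1, M = ymonof c
    & N = ymonof (set_nth 0 c b M1)].
Proof.
split=> [[t [c [c' [[cP c'P] [eM eN] eMN [_ [b bP [pos mB mB']]] _]]]]|].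
  exists t, c, b.
  have [/(_ (s + qexp 1))//|[s0 [M0 [M1 hB]]]] := choice_block cP bP.
  exists M0, M1; have [eB e1 p0 p1] := hB.
  have sE : s + qexp 1 - qexp 1 = s by rewrite addrK.
  move: mB mB'; rewrite eB sE !inE => /orP[]/eqP e.
    move: pos; rewrite e => /p0 /addIr es _; subst s0.
    have ht : top t c b s M0 M1 by [].
    by split=> //; have [_ _ ->] := top_flip ht; rewrite -eM.
  (* If [c] picked the lower monomial M1, then M1 A_{i,s}^{-1} would be M0 or M1, so that a root or
     a sum of two roots would vanish. *)
  move: pos; rewrite e => /p1 es /orP[]/eqP; last first.
    move=> /subr_id_eq0/eqP; rewrite (negPf (root_diag_neq0 _)) //.
    have [_ -> _ _] := cartan.
    by apply/eqP => /addrI/(congr1 fst) /=; lia.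
  rewrite e1 -addrA -opprD => /subr_id_eq0/eqP.
  rewrite (negPf (root_diag_add_neq0 _ _)) //; have [_ -> _ _] := cartan.
    by apply/eqP => /addrI/(congr1 fst) /=; lia.
  by apply/eqP => /(congr1 fst) /=; move: es => /(congr1 fst) /=; lia.
case=> t [c [b [M0 [M1 [ht -> ->]]]]].
have [c'P nc' ec'] := top_flip ht; have [cP bP [eB e1 p0 p1] e0] := ht.
exists t, c, (set_nth 0 c b M1); split=> //.
  split; first by apply: (choice_positive cP bP); rewrite e0; apply/p0.
  exists b => //; split; rewrite ?e0 ?eB ?inE ?eqxx //; first by apply/p0.
  by rewrite addrK -e1 eqxx orbT.
split; first by apply: (choice_positive c'P bP); rewrite nc'; apply/p1.
exists b => //; split; rewrite ?nc' ?eB ?inE ?eqxx ?orbT //; first by apply/p1.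
by rewrite subrK e1 subrK eqxx.
Qed.

Lemma edgeP tau m n : edge D i tau m n <-> exists t c b s M0 M1,
  [/\ top t c b s M0 M1, s.2 = tau, m = yspec (ymonof c)
    & n = yspec (ymonof (set_nth 0 c b M1))].
Proof.
split=> [[s [M [N [/qedgeP[t [c [b [M0 [M1 [ht -> ->]]]]]] st <- <-]]]]|].
  by exists t, c, b, s, M0, M1.
case=> t [c [b [s [M0 [M1 [ht st -> ->]]]]]].
exists s, (ymonof c), (ymonof (set_nth 0 c b M1)); split=> //.
by apply/qedgeP; exists t, c, b, M0, M1.
Qed.

Let add_spec s : (s + qexp 1).2 = s.2.
Proof. exact: addr0. Qed.
Let sub_spec s : (s - qexp 1).2 = s.2.
Proof. by rewrite -[RHS](subr0 s.2). Qed.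

Lemma edge_vertex tau m n : edge D i tau m n -> vertex chi1 m /\ vertex chi1 n.
Proof.
move=> /edgeP[t [c [b [s [M0 [M1 [ht _ -> ->]]]]]]].
have [c'P _ _] := top_flip ht; have [cP _ _ _] := ht.
by split; [exact: choice_vertex cP | exact: choice_vertex c'P].
Qed.

Lemma edge_root tau m n : edge D i tau m n -> n = m - root sg i tau.
Proof.
move=> /edgeP[t [c [b [s [M0 [M1 [ht <- -> ->]]]]]]].
have [_ _ ->] := top_flip ht.
by rewrite -yspec_root; apply: ymapB.
Qed.

Lemma edge_source_coef tau m n : edge D i tau m n -> m@_(i, tau) = 1.
Proof.
move=> /edgeP[t [c [b [s [M0 [M1 [[cP bP [eB e1 p0 p1] e0] <- -> _]]]]]]].
rewrite -add_spec; apply: (positive_spec (choice_chi_neq0 cP) (cvx cP)).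
by apply: (choice_positive cP bP); rewrite e0; apply/p0.
Qed.

Lemma edge_target_coef tau m n : edge D i tau m n -> n@_(i, tau) = 1.
Proof.
move=> /edgeP[t [c [b [s [M0 [M1 [ht <- _ ->]]]]]]].
have [c'P e1 _] := top_flip ht; have [_ bP [_ _ _ p1] _] := ht.
rewrite -sub_spec; apply: (positive_spec (choice_chi_neq0 c'P) (cvx c'P)).
by apply: (choice_positive c'P bP); rewrite e1; apply/p1.
Qed.

(** The variable lifts to one factor of the product, which must be a pair block. It is dominant or
    anti-dominant there according to the monomial that the lift picks. *)
Lemma edge_source_or_target tau m : vertex chi1 m -> m@_(i, tau) = 1 ->
  edge D i tau m (m - root sg i tau) \/ edge D i tau (m + root sg i tau) m.
Proof.
move=> vm; have [t [c [cP cm]]] := vertex_lift i vm; rewrite -cm => m1.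
have pos0 : 0 < (yspec (ymonof c))@_(i, tau) by rewrite m1.
have [s st pos] := spec_positive pos0.
have [|b bP e] := product_coef_neq0 (dec_productP t) cP (p := (i, s)).
  by rewrite gt_eqF.
rewrite e in pos; have [/(_ s)//|[s0 [M0 [M1 hB]]]] := choice_block cP bP.
have [eB e1 p0 p1] := hB; have /choicesP[sc /(_ b bP)] := cP.
rewrite eB !inE => /orP[]/eqP eb; rewrite eb in pos.
  move/p0: pos => es; left.
  have ht : top t c b s0 M0 M1 by [].
  have ed : edge D i tau (yspec (ymonof c)) (yspec (ymonof (set_nth 0 c b M1))).
    by apply/edgeP; exists t, c, b, s0, M0, M1; split; rewrite // -st es add_spec.
  by rewrite -(edge_root ed).
move/p1: pos => es; right.
(* The source of the incoming edge: the same choice with the factor [b] moved back to its upper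
   monomial. *)
pose c0 := set_nth 0 c b M0.
have c0P : c0 \in choices (prod t) by apply: choices_set => //; rewrite eB inE eqxx.
have ht : top t c0 b s0 M0 M1.
  by split=> //; rewrite nth_set_nth /= eqxx.
have cE : set_nth 0 c0 b M1 = c.
  rewrite set_set_nth eqxx; apply: (@eq_from_nth _ 0) => [|b' _].
    by rewrite size_set_nth sc (maxn_idPr _).
  by rewrite nth_set_nth /=; case: eqP => [->|].
have ed : edge D i tau (yspec (ymonof c0)) (yspec (ymonof c)).
  by apply/edgeP; exists t, c0, b, s0, M0, M1; split; rewrite ?cE // -st es sub_spec.
by rewrite {1}(edge_root ed) subrK.
Qed.

Let lift_transfer (Q : dec_index (D i) -> seq (ymon I (qmon r)) -> Prop) t c t' c' :
  c \in choices (prod t) -> c' \in choices (prod t') ->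
  yspec (ymonof c) = yspec (ymonof c') -> Q t' c' -> Q t c.
Proof.
move=> cP c'P e; have := lift_unique cP c'P e.
by move=> /(congr1 (fun z => Q (projT1 z) (projT2 z))) /= ->.
Qed.

Lemma edge_source_lift tau m n t c : edge D i tau m n ->
  c \in choices (prod t) -> yspec (ymonof c) = m ->
  exists b s M0 M1, top t c b s M0 M1 /\ s.2 = tau.
Proof.
move=> /edgeP[t' [c' [b [s [M0 [M1 [ht st em _]]]]]]] cP cm.
have [c'P _ _ _] := ht.
apply: (lift_transfer (Q := fun t c => exists b s M0 M1, top t c b s M0 M1 /\ s.2 = tau) cP c'P).
  by rewrite cm em.
by exists b, s, M0, M1.
Qed.

Definition bottom t c b s M0 M1 : Prop :=
  [/\ c \in choices (prod t), (b < size (prod t))%N,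
      pair_block sigma i (nth [::] (prod t) b) s M0 M1 & nth 0 c b = M1].

Lemma edge_target_lift tau m n t c : edge D i tau m n ->
  c \in choices (prod t) -> yspec (ymonof c) = n ->
  exists b s M0 M1, bottom t c b s M0 M1 /\ s.2 = tau.
Proof.
move=> /edgeP[t' [c' [b [s [M0 [M1 [ht st _ em]]]]]]] cP cm.
have [c''P e1 _] := top_flip ht; have [_ bP hB _] := ht.
apply: (lift_transfer (Q := fun t c => exists b s M0 M1, bottom t c b s M0 M1 /\ s.2 = tau) cP c''P).
  by rewrite cm em.
by exists b, s, M0, M1.
Qed.

(** Both edges would use the same variable at q = 1, hence the same variable of the lift and the
    same factor. But the dominant and the anti-dominant variable of a pair block differ by q^2. *)
Lemma edge_excl tau m n p : edge D i tau m n -> edge D i tau p m -> False.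
Proof.
move=> e1 e2; have [vm _] := edge_vertex e1.
have [t [c [cP cm]]] := vertex_lift i vm.
have [b [s [M0 [M1 [[_ bP hB eb] st]]]]] := edge_source_lift e1 cP cm.
have [b' [s' [M0' [M1' [[_ b'P hB' eb'] st']]]]] := edge_target_lift e2 cP cm.
have [eB em1 p0 p1] := hB; have [eB' em1' p0' p1'] := hB'.
have pos : 0 < (nth 0 c b)@_(i, s + qexp 1) by rewrite eb; apply/p0.
have pos' : 0 < (nth 0 c b')@_(i, s' - qexp 1) by rewrite eb'; apply/p1'.
have es : s + qexp 1 = s' - qexp 1.
  apply: (positive_inj (choice_chi_neq0 cP) (cvx cP)).
  - exact: (choice_positive cP bP pos).
  - exact: (choice_positive cP b'P pos').
  - by rewrite add_spec sub_spec st st'.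
have bb' : b = b'.
  apply: contrapT => bb'; rewrite -es in pos'.
  by case: (product_disjoint (dec_productP t) cP (i, s + qexp 1) bP b'P bb') => z;
    [rewrite z in pos | rewrite z in pos'].
subst b'; move: eB'; rewrite eB => -[_ e11].
have /p1 e : 0 < M1@_(i, s + qexp 1) by rewrite e11 -eb' eb; apply/p0.
by have /addrI/(congr1 fst) /= := e; lia.
Qed.

(** The edge [nu] changes one factor of the product only. An edge with another label flips another
    factor, and is available before and after this change. *)
Lemma edge_parallel tau nu m n : tau <> nu -> edge D i nu m n ->
  edge D i tau m (m - root sg i tau) <-> edge D i tau n (n - root sg i tau).
Proof.
move=> tn /edgeP[t [c [b [s [M0 [M1 [ht st em en]]]]]]].
have [cP bP hB eb] := ht; have [c1P e1 ec1] := top_flip ht.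
have [eB em1 p0 p1] := hB.
set c1 := set_nth 0 c b M1 in c1P e1 ec1 en.
have goal c0 b' s' M0' M1' m0 : top t c0 b' s' M0' M1' -> s'.2 = tau ->
    yspec (ymonof c0) = m0 -> edge D i tau m0 (m0 - root sg i tau).
  move=> ht' st' em0.
  have ed : edge D i tau m0 (yspec (ymonof (set_nth 0 c0 b' M1'))).
    by apply/edgeP; exists t, c0, b', s', M0', M1'.
  by rewrite -(edge_root ed).
split=> ed.
  have [b' [s' [M0' [M1' [[_ b'P hB' eb'] st']]]]] := edge_source_lift ed cP (esym em).
  apply: (goal c1 b' s' M0' M1') => //; split=> //.
  rewrite nth_set_nth /=; case: eqP => // bb'; subst b'; case: tn.
  have [eB' _ p0' _] := hB'; move: eB'; rewrite eB => -[e00 _].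
  by rewrite -st -st'; have /p0' /addIr -> : 0 < M0'@_(i, s + qexp 1) by rewrite -e00; apply/p0.
have [b' [s' [M0' [M1' [[_ b'P hB' eb'] st']]]]] := edge_source_lift ed c1P (esym en).
apply: (goal c b' s' M0' M1') => //; split=> //.
move: eb'; rewrite nth_set_nth /=; case: eqP => // bb' e10; subst b'; case: tn.
have [_ _ p0' _] := hB'.
have /p0' e : 0 < M0'@_(i, s - qexp 1) by rewrite -e10; apply/p1.
by rewrite -st -st' -(add_spec s') -e sub_spec.
Qed.

End Color.
End Graph.

(** * Squares in the graph *)

Section Squares.
Context (I : finType) (r : nat) (sigma : I -> I -> qmon r).
Context (chi : series I (qmon r)) (chi1 : series I (mon r)).
Context (D : forall i, decomposition sigma chi i).
Hypotheses (cartan : is_cartan sigma) (adm : admissible sigma chi chi1).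
Hypothesis (nosq : no_incomplete_squares chi1 D).
Local Notation sg := (sigma1 sigma).
Local Notation vertex := (vertex chi1).
Local Notation edge := (edge D).
Local Notation A := (root sg).
Implicit Types (i j : I) (tau nu : mon r) (m n : ymon I (mon r)).

Let vertexL i tau m n (e : edge i tau m n) := proj1 (edge_vertex cartan adm e).
Let vertexR i tau m n (e : edge i tau m n) := proj2 (edge_vertex cartan adm e).

Lemma vertex_bound m p : vertex m -> -1 <= m@_p <= 1.
Proof. by move=> /(vertex_generic adm)/(_ p); rewrite !inE => /or3P[]/eqP ->. Qed.

(** At q = 1 the variables of color i cancel in A_i, so that edges of color i preserve all exponents
    of color i. *)
Lemma root_own_coef i nu tau : (A i nu)@_(i, tau) = 0.
Proof. by rewrite root_coef sigma1_diag // subr0 addr0 subrr. Qed.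

(* Otherwise m + A, m, m - A and m - 2A would all be vertices, so that the
   exponents of some variable in them would take four consecutive values. *)
Lemma edge_of_vertices i tau m : vertex m -> vertex (m - A i tau) ->
  m@_(i, tau) = 1 -> edge i tau m (m - A i tau).
Proof.
move=> vm vn m1; have [//|e] := edge_source_or_target D cartan adm vm m1.
have n1 : (m - A i tau)@_(i, tau) = 1 by rewrite mcoeffB root_own_coef subr0.
have [e'|] := edge_source_or_target D cartan adm vn n1; last by rewrite subrK.
have [l s0] := exists_sigma1_neq0 cartan i.
have b1 := vertex_bound (l, tau + sg l i) (vertexL e).
have b2 := vertex_bound (l, tau + sg l i) (vertexR e').
exfalso; move: b1 b2; rewrite mcoeffD 2!mcoeffB root_coef_add //.
by move: (m@__) => z; lia.
Qed.

(** Regular labels do not disturb each other: a move along one edge keeps the exponent of the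
    variable that carries the other. *)
Lemma regular_coef i j nu tau : regular sigma i j nu tau ->
  (A i nu)@_(j, tau) = 0 /\ (A j tau)@_(i, nu) = 0.
Proof.
rewrite !root_coef (sigma1C cartan j i).
case=> [->|[ne ne']]; first by rewrite !addr0 !subr0 !subrr.
rewrite (_ : (nu + _ == tau) = false); last first.
  by apply/eqP => e; case: ne'; rewrite -e addrK.
rewrite (_ : (nu - _ == tau) = false); last first.
  by apply/eqP => e; case: ne; rewrite -e subrK.
rewrite (_ : (tau + _ == nu) = false); last by apply/eqP => e; case: ne.
rewrite (_ : (tau - _ == nu) = false); last by apply/eqP => e; case: ne'.
by rewrite subrr.
Qed.

Lemma regular_diag i nu tau : regular sigma i i nu tau.
Proof. by left; rewrite sigma1_diag. Qed.

Let edgeE i tau m n (e : edge i tau m n) := edge_root cartan adm e.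

Let edge_vertices i tau m n : n = m - A i tau -> vertex m -> vertex n ->
  m@_(i, tau) = 1 -> edge i tau m n.
Proof. by move=> ->; apply: edge_of_vertices. Qed.

Let edge_par i tau nu m n m' n' : tau <> nu -> edge i nu m n ->
  m' = m - A i tau -> n' = n - A i tau -> edge i tau m m' <-> edge i tau n n'.
Proof. by move=> tn e -> ->; exact: (edge_parallel cartan adm tn e). Qed.

Let no_incomplete i j nu tau m1 m2 m3 m4 :
  m2 = m1 - A i nu -> m3 = m1 - A j tau -> m4 = m2 - A j tau ->
  i <> j -> regular sigma i j nu tau ->
  (vertex m1 + vertex m2 + vertex m3 + vertex m4 = 3)%N ->
  (`[< edge i nu m1 m2 >] + `[< edge j tau m1 m3 >]
    + `[< edge j tau m2 m4 >] + `[< edge i nu m3 m4 >] = 2)%N -> False.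
Proof. by move=> -> -> -> ij reg hv he; apply: (@nosq i j nu tau m1); split. Qed.

Lemma regular_sym i j nu tau : regular sigma i j nu tau -> regular sigma j i tau nu.
Proof.
rewrite /regular (sigma1C cartan j i) => -[->|[ne ne']]; first by left.
right; split=> e; first by case: ne'; rewrite e addrK.
by case: ne; rewrite e subrK.
Qed.

Section Completion.
Context (i j : I) (nu tau : mon r).
Hypotheses (reg : regular sigma i j nu tau) (ne : (i, nu) != (j, tau)).
Let A1 := (regular_coef reg).1.
Let A2 := (regular_coef reg).2.

Let sub_swap m1 m2 m3 m4 : m2 = m1 - A i nu -> m3 = m1 - A j tau ->
  m4 = m2 - A j tau <-> m4 = m3 - A i nu.
Proof.
by move=> -> ->; split=> ->; [|symmetry]; exact: (addrAC m1 (- A i nu) (- A j tau)).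
Qed.

(** For one color the other two sides are parallel edges. For two colors, without the vertex [m3]
    there would be three vertices and exactly the two given edges, an incomplete square; with it,
    the exponents preserved by [regular_coef] produce the edges. *)
Lemma square_path m1 m2 m4 : edge i nu m1 m2 -> edge j tau m2 m4 ->
  exists m3, edge j tau m1 m3 /\ edge i nu m3 m4.
Proof.
move=> e12 e24; have m2E := edgeE e12; have m4E := edgeE e24.
have [m3 m3E] : exists m3, m3 = m1 - A j tau.
  exact: (ex_intro _ _ erefl).
have /(sub_swap _ m2E m3E) m4E' := m4E; exists m3.
have [ij|/eqP ij] := eqVneq i j.
  subst j; have nt : nu <> tau by move=> nt; move: ne; rewrite nt eqxx.
  have e13 : edge i tau m1 m3 by apply/(edge_par (nesym nt) e12 m3E m4E).
  by split=> //; apply/(edge_par nt e13 m2E m4E').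
have c1 : m1@_(j, tau) = 1.
  by have := edge_source_coef cartan adm e24; rewrite m2E mcoeffB A1 subr0.
case: (boolP (vertex m3)) => [v3|nv3]; last first.
  case: (no_incomplete m2E m3E m4E ij reg).
    by rewrite (vertexL e12) (vertexR e12) (vertexR e24) (negPf nv3).
  rewrite (asboolT e12) (asboolT e24) !asboolF //.
    by move=> /vertexL; rewrite (negPf nv3).
  by move=> /vertexR; rewrite (negPf nv3).
split; first exact: edge_vertices m3E (vertexL e12) v3 c1.
apply: edge_vertices m4E' v3 (vertexR e24) _.
by rewrite m3E mcoeffB A2 subr0 (edge_source_coef cartan adm e12).
Qed.

Lemma square_out m1 m2 m3 : edge i nu m1 m2 -> edge j tau m1 m3 ->
  exists m4, edge j tau m2 m4 /\ edge i nu m3 m4.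
Proof.
move=> e12 e13; have m2E := edgeE e12; have m3E := edgeE e13.
have [m4 m4E] : exists m4, m4 = m2 - A j tau.
  exact: (ex_intro _ _ erefl).
have /(sub_swap _ m2E m3E) m4E' := m4E; exists m4.
have [ij|/eqP ij] := eqVneq i j.
  subst j; have nt : nu <> tau by move=> nt; move: ne; rewrite nt eqxx.
  split; first by apply/(edge_par (nesym nt) e12 m3E m4E).
  by apply/(edge_par nt e13 m2E m4E').
case: (boolP (vertex m4)) => [v4|nv4]; last first.
  case: (no_incomplete m2E m3E m4E ij reg).
    by rewrite (vertexL e12) (vertexR e12) (vertexR e13) (negPf nv4).
  rewrite (asboolT e12) (asboolT e13) !asboolF //.
    by move=> /vertexR; rewrite (negPf nv4).
  by move=> /vertexR; rewrite (negPf nv4).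
split.
  apply: edge_vertices m4E (vertexR e12) v4 _.
  by rewrite m2E mcoeffB A1 subr0 (edge_source_coef cartan adm e13).
apply: edge_vertices m4E' (vertexR e13) v4 _.
by rewrite m3E mcoeffB A2 subr0 (edge_source_coef cartan adm e12).
Qed.

Lemma square_in m2 m3 m4 : edge j tau m2 m4 -> edge i nu m3 m4 ->
  exists m1, edge i nu m1 m2 /\ edge j tau m1 m3.
Proof.
move=> e24 e34; have m4E := edgeE e24; have m4E' := edgeE e34.
have [m1 m1E] : exists m1, m1 = m2 + A i nu.
  exact: (ex_intro _ _ erefl).
have m2E : m2 = m1 - A i nu by rewrite m1E; exact: esym (addrK (A i nu) m2).
have m3E : m3 = m1 - A j tau.
  rewrite m1E; apply: etrans _ (addrAC m2 (- A j tau) (A i nu)).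
  apply: etrans _ (congr1 (fun z => z + A i nu) m4E).
  by rewrite m4E'; exact: esym (subrK (A i nu) m3).
exists m1.
have c2 : m2@_(i, nu) = 1.
  have := edge_target_coef cartan adm e34; rewrite m4E mcoeffB A2 subr0 //.
have [ij|/eqP ij] := eqVneq i j.
  subst j; have nt : nu <> tau by move=> nt; move: ne; rewrite nt eqxx.
  (* If the label [nu] left [m2], it would by parallelism also leave [m4], which it enters; so it
     enters [m2], from the vertex sought. *)
  have [e|e12] := edge_source_or_target D cartan adm (vertexL e24) c2.
    have [e4 _] := edge_parallel cartan adm nt e24.
    by case: (edge_excl cartan adm (e4 e) e34).
  rewrite -m1E in e12.
  by split=> //; apply/(edge_par (nesym nt) e12 m3E m4E).
case: (boolP (vertex m1)) => [v1|nv1]; last first.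
  case: (no_incomplete m2E m3E m4E ij reg).
    by rewrite (vertexL e24) (vertexR e24) (vertexL e34) (negPf nv1).
  rewrite (asboolT e24) (asboolT e34) !asboolF //.
    by move=> /vertexL; rewrite (negPf nv1).
  by move=> /vertexL; rewrite (negPf nv1).
split.
  apply: edge_vertices m2E v1 (vertexL e24) _.
  by rewrite m1E mcoeffD root_own_coef addr0.
apply: edge_vertices m3E v1 (vertexL e34) _.
by rewrite m1E mcoeffD A1 addr0 (edge_source_coef cartan adm e24).
Qed.

Lemma square_uniq m1 m2 m3 m4 : edge i nu m1 m2 -> edge j tau m1 m3 ->
  edge j tau m2 m4 -> edge i nu m3 m4 -> uniq [:: m1; m2; m3; m4].
Proof.
move=> /edgeE m2E /edgeE m3E /edgeE m4E /edgeE m4E'.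
have sub_neq m n k t : n = m - A k t -> m != n.
  move=> ->; apply/eqP => /esym/subr_id_eq0/eqP.
  by rewrite (negPf (root_neq0 cartan _ _)).
rewrite /= !inE !negb_or (sub_neq _ _ _ _ m2E) (sub_neq _ _ _ _ m3E).
rewrite (sub_neq _ _ _ _ m4E) (sub_neq _ _ _ _ m4E') /= !andbT; apply/andP; split.
  apply/eqP => e; have := subr_id_eq0 (z := A i nu + A j tau) (y := m1).
  rewrite opprD addrA -m2E -m4E => /(_ (esym e))/eqP.
  by rewrite (negPf (root_add_neq0 cartan _ _ _ _)).
apply/eqP => e; case/eqP: ne; apply: (root_inj cartan).
apply: oppr_inj; apply: (@addrI _ m1).
exact: etrans (esym m2E) (etrans e m3E).
Qed.

End Completion.

(* The squares that are not regular cannot occur, since the power of some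
   variable in one of their monomials would be 2. *)
Lemma path_regular i j nu tau m1 m2 m4 : i != j -> edge j tau m1 m2 ->
  edge i nu m2 m4 -> regular sigma i j nu tau \/ tau = sg i j + nu.
Proof.
move=> ij e12 e24; have [s0|s0] := eqVneq (sg i j) 0; first by left; left.
have b := vertex_bound (i, nu) (vertexL e12).
have c2 := edge_source_coef cartan adm e24.
(* Genericity does not exclude this position; it is harmless because the factor of the quadratic
   relation vanishes there. *)
have [e|ne] := eqVneq nu (tau - sg i j).
  by right; rewrite e addrC subrK.
left; right; split; last exact/eqP.
move=> e; move: c2 b; rewrite (edgeE e12) mcoeffB e root_coef_add //.
by move: (m1@__) => z; lia.
Qed.

Lemma in_regular i j nu tau m2 m3 m4 : i != j -> edge j tau m2 m4 ->
  edge i nu m3 m4 -> regular sigma i j nu tau.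
Proof.
move=> ij e24 e34; have [s0|s0] := eqVneq (sg i j) 0; first by left.
have b2 := vertex_bound (i, nu) (vertexL e24).
have b3 := vertex_bound (j, tau) (vertexL e34).
have ci := edge_target_coef cartan adm e34.
have cj := edge_target_coef cartan adm e24.
right; split=> e.
  move: ci b2; rewrite (edgeE e24) mcoeffB e root_coef_add //.
  by move: (m2@__) => z; lia.
have e' : tau = nu + sg j i by rewrite (sigma1C cartan j i) e subrK.
rewrite (sigma1C cartan) in s0.
move: cj b3; rewrite (edgeE e34) mcoeffB e' root_coef_add //.
by move: (m3@__) => z; lia.
Qed.

Lemma out_regular i j nu tau m1 m2 m3 : i != j -> edge i nu m1 m2 ->
  edge j tau m1 m3 -> regular sigma i j nu tau.
Proof.
move=> ij e12 e13; have [s0|s0] := eqVneq (sg i j) 0; first by left.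
have b2 := vertex_bound (j, tau) (vertexR e12).
have b3 := vertex_bound (i, nu) (vertexR e13).
have ci := edge_source_coef cartan adm e12.
have cj := edge_source_coef cartan adm e13.
right; split=> e.
  have e' : tau = nu - sg j i by rewrite (sigma1C cartan j i) e addrK.
  rewrite (sigma1C cartan) in s0.
  have h : (A i nu)@_(j, tau) = -1 by rewrite e' root_coef_sub.
  by move: b2; rewrite (edgeE e12) mcoeffB h cj.
have h : (A j tau)@_(i, nu) = -1 by rewrite e root_coef_sub.
by move: b3; rewrite (edgeE e13) mcoeffB h ci.
Qed.

End Squares.

(** * Weights around a square *)

Section GraphWeights.
Context (I : finType) (r : nat) (sigma : I -> I -> qmon r).
Context (chi : series I (qmon r)) (chi1 : series I (mon r)).
Context (D : forall i, decomposition sigma chi i).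
Context (K : fieldType) (x : 'I_r -> K) (u : K).
Context (a : ymon I (mon r) -> ymon I (mon r) -> K).
Hypotheses (cartan : is_cartan sigma) (adm : admissible sigma chi chi1).
Hypothesis (nosq : no_incomplete_squares chi1 D).
Hypotheses (x_neq0 : forall k, x k != 0) (monval_inj : injective (monval x)).
Hypotheses (suppl : supplement D x a) (u_neq0 : u != 0).
Local Notation sg := (sigma1 sigma).
Local Notation vertex := (vertex chi1).
Local Notation edge := (edge D).
Local Notation A := (root sg).
Local Notation w := (ypole x u).
Local Notation s i j := (monval x (sg i j)).
Implicit Types (i j : I) (tau nu : mon r) (m n : ymon I (mon r)).

Let w_inj : injective w.
Proof. by move=> t t' /(mulIf u_neq0)/monval_inj. Qed.

Let monvalD e e' : monval x (e + e') = monval x e * monval x e'.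
Proof. by rewrite !monvalE hmonvalD // exprMn. Qed.

Let monval0 : monval x 0 = 1.
Proof. by rewrite monvalE hmonval0 // expr1n. Qed.

Lemma vertex_degree i m : vertex m -> ydeg i m = 0.
Proof.
move=> /(vertex_lift D adm i)[t [c [cP <-]]]; rewrite /yspec ydeg_ymap.
have [_ h _ _ _] := adm; apply: h; apply: (choice_chi_neq0 cP).
Qed.

Definition fres i t m : K := residue (w t) (fY x u i m / tofrac 'X).

Lemma vertex_simple i m : vertex m ->
  simple_frac (fYnum x u i m) (fYpoles x u i m) (fY x u i m).
Proof.
move=> vm; apply: fY_simple => //; first exact: (vertex_generic adm vm).
exact: vertex_degree.
Qed.

Let pole_mem i t m : m@_(i, t) = 1 -> w t \in fYpoles x u i m.
Proof. by move=> m1; apply: map_f; rewrite mem_ylab // m1. Qed.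

Lemma edge_fY i j t m n : edge j t m n ->
  tofrac ('X - (s i j * w t)%:P) * fY x u i m =
  tofrac (s i j *: 'X - (w t)%:P) * fY x u i n.
Proof.
move=> /(edge_root cartan adm) ->; rewrite -(fY_root u x_neq0 sg i j t).
by rewrite subrK.
Qed.

(** The exponents make [w t] a simple pole of f_i at both ends, so that [edge_fY] can be compared
    there. *)
Lemma fres_edge i j t tau m n : edge j tau m n -> m@_(i, t) = 1 -> n@_(i, t) = 1 ->
  (w t - s i j * w tau) * fres i t m = (s i j * w t - w tau) * fres i t n.
Proof.
move=> e m1 n1; have [vm vn] := edge_vertex cartan adm e.
have := residue_rel (vertex_simple i vm) (vertex_simple i vn) (edge_fY i e)
  (pole_mem m1) (pole_mem n1).
by rewrite !hornerE.
Qed.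

(** If sigma_ij = 1, f_i does not change along the edge. This covers t = tau, where [fres_edge] only
    says 0 = 0. *)
Lemma fres_edge0 i j t tau m n : edge j tau m n -> sg i j = 0 ->
  fres i t m = fres i t n.
Proof.
move=> e s0; have := edge_fY i e; rewrite s0 monval0 mul1r scale1r.
have h : tofrac ('X - (w tau)%:P) != 0 by rewrite tofrac_eq0 polyXsubC_eq0.
by move=> /(mulfI h); rewrite /fres => ->.
Qed.

Definition bweight i t m n : K := (a m n)^-1 * fres i t m.

Let a_neq0 i t m n : edge i t m n -> a m n != 0.
Proof. by case: suppl => h _ /h. Qed.

Section CompleteSquare.
Context (i j : I) (nu tau : mon r) (m1 m2 m3 m4 : ymon I (mon r)).
Hypotheses (reg : regular sigma i j nu tau) (ne : (i, nu) != (j, tau)).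
Hypotheses (e12 : edge i nu m1 m2) (e13 : edge j tau m1 m3)
  (e24 : edge j tau m2 m4) (e34 : edge i nu m3 m4).

Let a12 := a_neq0 e12.
Let a13 := a_neq0 e13.
Let a24 := a_neq0 e24.
Let a34 := a_neq0 e34.

Let const : a m1 m3 * a m3 m4 = square_const sigma x i j nu tau * (a m1 m2 * a m2 m4).
Proof.
case: suppl => _; apply; split=> //.
exact: (square_uniq cartan adm ne e12 e13 e24 e34).
Qed.

Lemma square_a0 : sg i j = 0 -> a m1 m3 * a m3 m4 + a m1 m2 * a m2 m4 = 0.
Proof. by move=> s0; rewrite const /square_const s0 eqxx mulN1r addNr. Qed.

Let cnu := edge_source_coef cartan adm e12.
Let cnu' := edge_source_coef cartan adm e34.
Let ctau := edge_source_coef cartan adm e13.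
Let ctau' := edge_source_coef cartan adm e24.

Let p := w nu - s i j * w tau.
Let q := w tau - s i j * w nu.

Let q_neq0 : sg i j != 0 -> q != 0.
Proof.
move=> s0; case: reg => [/eqP|[_ ntau]]; first by rewrite (negPf s0).
rewrite subr_eq0; apply/eqP; rewrite /ypole mulrA -monvalD => /(mulIf u_neq0)/monval_inj e.
by case: ntau; rewrite e addrC addKr.
Qed.

Let p_neq0 : sg i j != 0 -> p != 0.
Proof.
move=> s0; case: reg => [/eqP|[ntau _]]; first by rewrite (negPf s0).
rewrite subr_eq0; apply/eqP; rewrite /ypole mulrA -monvalD => /(mulIf u_neq0)/monval_inj e.
by case: ntau; rewrite e addrC.
Qed.

(** The constant of the square is p / q. Cleared of its denominator, the identity also makes sense
    for sigma_ij = 1 and nu = tau, where p and q both vanish. *)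
Lemma square_a : q * (a m1 m3 * a m3 m4) = p * (a m1 m2 * a m2 m4).
Proof.
have [s0|s0] := eqVneq (sg i j) 0.
  have /eqP := square_a0 s0; rewrite addr_eq0 => /eqP ->.
  by rewrite /p /q s0 monval0 !mul1r mulrN -mulNr opprB.
rewrite const /square_const (negPf s0).
have -> : p = (monval x nu - s i j * monval x tau) * u by rewrite /p /ypole; ring.
have := q_neq0 s0; have -> : q = (monval x tau - s i j * monval x nu) * u.
  by rewrite /q /ypole; ring.
rewrite mulf_eq0 negb_or => /andP[q0 _].
by move: (a m1 m2 * _) => z; field.
Qed.

Let r_tau0 : sg i j = 0 -> fres j tau m1 = fres j tau m2.
Proof. by move=> s0; apply: fres_edge0 e12 _; rewrite (sigma1C cartan). Qed.
Let r_nu0 : sg i j = 0 -> fres i nu m1 = fres i nu m3.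
Proof. by move=> s0; apply: fres_edge0 e13 _. Qed.

Let r_tau : q * fres j tau m1 = - (p * fres j tau m2).
Proof.
have := fres_edge e12 ctau ctau'; rewrite (sigma1C cartan j i) -/q => ->.
by rewrite /p; ring.
Qed.
Let r_nu : p * fres i nu m1 = - (q * fres i nu m3).
Proof. by have := fres_edge e13 cnu cnu'; rewrite -/p => ->; rewrite /q; ring. Qed.

(** The supplement contributes p/q and the passage of the residue from [m3] to [m1] contributes
    -q/p; their product is the sign -1. *)
Lemma square_ab : a m2 m4 * bweight i nu m3 m4 + bweight i nu m1 m2 * a m1 m3 = 0.
Proof.
rewrite /bweight; have [s0|s0] := eqVneq (sg i j) 0.
  rewrite (r_nu0 s0); have := square_a0 s0; move: (fres i nu m3) => z h.
  apply: (mulfI (mulf_neq0 a12 a34)); rewrite mulr0.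
  rewrite -[RHS](mulr0 z) -h; field.
  by rewrite a12 a34.
apply: (mulfI (mulf_neq0 (p_neq0 s0) (mulf_neq0 a12 a34))); rewrite mulr0.
have h := square_a; move: r_nu h; move: (fres i nu m1) (fres i nu m3) => y z.
move: (p) (q) => P Q hr ha.
transitivity (z * (P * (a m1 m2 * a m2 m4)) + (P * y) * (a m1 m3 * a m3 m4)).
  by field; rewrite a12 a34.
by rewrite -ha hr; ring.
Qed.

Lemma square_bb0 : sg i j = 0 ->
  bweight j tau m2 m4 * bweight i nu m1 m2 + bweight i nu m3 m4 * bweight j tau m1 m3 = 0.
Proof.
move=> s0; rewrite /bweight (r_nu0 s0) (r_tau0 s0).
have := square_a0 s0; move: (fres i nu m3) (fres j tau m2) => y z h.
apply: (mulfI (mulf_neq0 (mulf_neq0 a12 a24) (mulf_neq0 a13 a34))).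
rewrite mulr0 -[RHS](mulr0 (y * z)) -h; field.
by rewrite a12 a24 a13 a34.
Qed.

(** Two residues pass along an edge, which gives (q/p)^2, and the inverted supplement values give
    p/q, leaving q/p. *)
Lemma square_bb : p * (bweight j tau m2 m4 * bweight i nu m1 m2) =
  q * (bweight i nu m3 m4 * bweight j tau m1 m3).
Proof.
have [s0|s0] := eqVneq (sg i j) 0.
  have /eqP := square_bb0 s0; rewrite addr_eq0 => /eqP ->.
  by rewrite /p /q s0 monval0 !mul1r mulrN -mulNr opprB.
rewrite /bweight; have := square_a; move: r_nu r_tau.
move: (fres i nu m1) (fres i nu m3) (fres j tau m1) (fres j tau m2) => y y' z z'.
move: (p) (q) => P Q h1 h2 ha.
apply: (mulfI (mulf_neq0 (mulf_neq0 a12 a24) (mulf_neq0 a13 a34))).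
transitivity ((a m1 m3 * a m3 m4) * (P * y) * z').
  by field; rewrite a12 a24.
transitivity ((a m1 m2 * a m2 m4) * y' * (Q * z)); last first.
  by field; rewrite a13 a34.
rewrite h1 h2.
transitivity (- (Q * (a m1 m3 * a m3 m4)) * y' * z'); first by ring.
by rewrite ha; ring.
Qed.

End CompleteSquare.
End GraphWeights.

(** * The module of an untangled series *)

Lemma convXsubC (K : fieldType) (d : K) (f : int -> K) n :
  conv ('X - d%:P) f n = f (n - 1) - d * f n.
Proof. by rewrite -polyCN convD convX convC mulNr. Qed.

Lemma convZXsubC (K : fieldType) (d e : K) (f : int -> K) n :
  conv (d *: 'X - e%:P) f n = d * f (n - 1) - e * f n.
Proof. by rewrite -polyCN convD convZ convX convC mulNr. Qed.

Section UntangledModule.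
Context (I : finType) (r : nat) (sigma : I -> I -> qmon r).
Context (chi : series I (qmon r)) (chi1 : series I (mon r)).
Context (D : forall i, decomposition sigma chi i).
Context (K : fieldType) (x : 'I_r -> K) (u : K).
Context (a : ymon I (mon r) -> ymon I (mon r) -> K).
Hypotheses (cartan : is_cartan sigma) (adm : admissible sigma chi chi1).
Hypothesis (nosq : no_incomplete_squares chi1 D).
Hypotheses (x_neq0 : forall k, x k != 0) (monval_inj : injective (monval x)).
Hypotheses (suppl : supplement D x a) (u_neq0 : u != 0).
Local Notation sg := (sigma1 sigma).
Local Notation w := (ypole x u).
Local Notation s i j := (monval x (sg i j)).
Local Notation V := {m : ymon I (mon r) | vertex chi1 m}.

Let vedge i t (m n : V) : Prop := edge D i t (val m) (val n).
Let lab i (m : V) : seq (mon r) := ylab i (val m) 1.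
Let wa (m n : V) : K := a (val m) (val n).
Let wb i t (m n : V) : K := bweight x u a i t (val m) (val n).
Let rho i (m : V) t : K := fres x u i t (val m).
Let c d i (m : V) (n : int) : K := fpm x u d i (val m) n.

Let simple i (m : V) := vertex_simple D adm x_neq0 monval_inj u_neq0 i (valP m).

Let target i t m n : edge D i t m n -> exists n' : V, val n' = n.
Proof. by move=> /(edge_vertex cartan adm)[_ vn]; exists (exist _ n vn). Qed.
Let source i t m n : edge D i t m n -> exists m' : V, val m' = m.
Proof. by move=> /(edge_vertex cartan adm)[vm _]; exists (exist _ m vm). Qed.

Let s_sym i j : s i j = s j i.
Proof. by rewrite (sigma1C cartan). Qed.

Let edge_fres i t m n : edge D i t m n -> fres x u i t m = fres x u i t n.
Proof. by move=> e; exact: (fres_edge0 u cartan adm x_neq0 t e (sigma1_diag cartan i)). Qed.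

Let shift_weight i j t : w (sg i j + t) = s i j * w t.
Proof. by rewrite /ypole !monvalE hmonvalD // exprMn mulrA. Qed.

Let pair_neq (i j : I) (t t' : mon r) : i != j -> (i, t) != (j, t').
Proof. by apply: contraNneq => -[->]. Qed.

Let sqFF i j t t' (m n p : V) : i != j -> vedge j t' m n -> vedge i t n p ->
  w t' - s i j * w t = 0 \/
  exists n', [/\ vedge i t m n', vedge j t' n' p &
    (w t' - s i j * w t) * (wa m n * wa n p) =
    (w t - s i j * w t') * (wa m n' * wa n' p)].
Proof.
move=> ij e1 e2; case: (path_regular cartan adm ij e1 e2) => [reg|->]; last first.
  by left; rewrite shift_weight subrr.
right; have ji : j != i by rewrite eq_sym.
have [n' [e3 e4]] :=
  square_path cartan adm nosq (regular_sym cartan reg) (pair_neq _ _ ji) e1 e2.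
have [n1 en1] := target e3; exists n1; rewrite /vedge /wa en1; split=> //.
exact: (square_a cartan adm x_neq0 monval_inj suppl u_neq0 reg (pair_neq _ _ ij) e3 e1 e4 e2).
Qed.

Let sqEE i j t t' (m n p : V) : i != j -> vedge j t' n m -> vedge i t p n ->
  w t - s i j * w t' = 0 \/
  exists n', [/\ vedge i t n' m, vedge j t' p n' &
    (w t - s i j * w t') * (wb j t' n m * wb i t p n) =
    (w t' - s i j * w t) * (wb i t n' m * wb j t' p n')].
Proof.
move=> ij e1 e2; have ji : j != i by rewrite eq_sym.
case: (path_regular cartan adm ji e2 e1) => [/(regular_sym cartan) reg|->]; last first.
  by left; rewrite shift_weight s_sym subrr.
right; have [n' [e3 e4]] := square_path cartan adm nosq reg (pair_neq _ _ ij) e2 e1.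
have [n1 en1] := target e3; exists n1; rewrite /vedge /wb en1; split=> //.
exact: (square_bb cartan adm x_neq0 monval_inj suppl u_neq0 reg (pair_neq _ _ ij) e2 e3 e1 e4).
Qed.

Let path_neq i t t' m n p : edge D i t' m n -> edge D i t n p -> (i, t) != (i, t').
Proof.
move=> e1 e2; apply/eqP => -[tt']; rewrite tt' in e2.
exact: (edge_excl cartan adm e2 e1).
Qed.

Let sqFF0 i t t' (m n p : V) : vedge i t' m n -> vedge i t n p ->
  exists n', [/\ vedge i t m n', vedge i t' n' p &
    wa m n * wa n p + wa m n' * wa n' p = 0].
Proof.
move=> e1 e2; have ne := path_neq e1 e2; have ne' := ne; rewrite eq_sym in ne'.
have [n' [e3 e4]] :=
  square_path cartan adm nosq (regular_diag cartan i t' t) ne' e1 e2.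
have [n1 en1] := target e3; exists n1; rewrite /vedge /wa en1; split=> //.
exact: (square_a0 cartan adm suppl (regular_diag cartan i t t') ne e3 e1 e4 e2 (sigma1_diag cartan i)).
Qed.

Let sqEE0 i t t' (m n p : V) : vedge i t' n m -> vedge i t p n ->
  exists n', [/\ vedge i t n' m, vedge i t' p n' &
    wb i t' n m * wb i t p n + wb i t n' m * wb i t' p n' = 0].
Proof.
move=> e1 e2; have ne := path_neq e2 e1; rewrite eq_sym in ne.
have [n' [e3 e4]] :=
  square_path cartan adm nosq (regular_diag cartan i t t') ne e2 e1.
have [n1 en1] := target e3; exists n1; rewrite /vedge /wb en1; split=> //.
exact: (square_bb0 u cartan adm x_neq0 suppl (regular_diag cartan i t t') ne e2 e3 e1 e4 (sigma1_diag cartan i)).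
Qed.

Let sqEF i j t t' (m n p : V) : (i, t) != (j, t') -> vedge j t' m n -> vedge i t p n ->
  exists n', [/\ vedge i t n' m, vedge j t' n' p &
    wa m n * wb i t p n + wb i t n' m * wa n' p = 0].
Proof.
move=> ne e1 e2; have reg : regular sigma i j t t'.
  have [ij|ij] := eqVneq i j; first by subst j; exact: regular_diag.
  exact: (in_regular cartan adm ij e1 e2).
have [n' [e3 e4]] := square_in cartan adm nosq reg ne e1 e2.
have [n1 en1] := source e3; exists n1; rewrite /vedge /wa /wb en1; split=> //.
exact: (square_ab cartan adm x_neq0 monval_inj suppl u_neq0 reg ne e3 e4 e1 e2).
Qed.

Let sqFE i j t t' (m n p : V) : (i, t) != (j, t') -> vedge i t n m -> vedge j t' n p ->
  exists n', [/\ vedge j t' m n', vedge i t p n' &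
    wa m n' * wb i t p n' + wb i t n m * wa n p = 0].
Proof.
move=> ne e1 e2; have reg : regular sigma i j t t'.
  have [ij|ij] := eqVneq i j; first by subst j; exact: regular_diag.
  exact: (out_regular cartan adm ij e1 e2).
have [n' [e3 e4]] := square_out cartan adm nosq reg ne e1 e2.
have [n1 en1] := target e3; exists n1; rewrite /vedge /wa /wb en1; split=> //.
exact: (square_ab cartan adm x_neq0 monval_inj suppl u_neq0 reg ne e1 e2 e3 e4).
Qed.

Theorem untangled_module : exists act : UC (fun i j => s i j) -> {malg K[V]} -> {malg K[V]},
  [/\ UC_module act,
      forall d i n (m : V), act (UCK _ d i n) << m >> = fpm x u d i (val m) (- n) *: << m >>,
      forall i n (m : V), act (UCF _ i n) << m >> =
        delta_corr w (fun t (m n : V) => edge D i t (val m) (val n))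
          (fun _ (m n : V) => a (val m) (val n)) n m
    & forall i n (m : V), act (UCE _ i n) << m >> =
        delta_corr w (fun t (m n : V) => edge D i t (val n) (val m))
          (fun t (m n : V) => bweight x u a i t (val n) (val m)) n m].
Proof.
apply: (@graph_module K I (fun i j => s i j) V _ w vedge lab wa wb rho c).
- exact: ypole_neq0.
- exact: s_sym.
- by move=> i; rewrite sigma1_diag // monvalE hmonval0 // expr1n.
- move=> i t m n n' /(edge_root cartan adm) e /(edge_root cartan adm) e'.
  by apply: val_inj; exact: etrans e (esym e').
- move=> i t n m m' /(edge_root cartan adm) e /(edge_root cartan adm) e'.
  apply: val_inj; apply: (@addIr _ (- Defs.root sg i t)).
  exact: etrans (esym e) e'.
- by move=> i m; exact: ylab_uniq.
- move=> i m t; rewrite mem_ylab // => /eqP m1.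
  case: (edge_source_or_target D cartan adm (valP m) m1) => e.
    by left; have [n' en] := target e; exists n'; rewrite /vedge en.
  by right; have [n' en] := source e; exists n'; rewrite /vedge en.
- move=> i t m n e; rewrite !mem_ylab //.
  by rewrite (edge_source_coef cartan adm e) (edge_target_coef cartan adm e).
- by move=> i t m n p e e'; apply: (edge_excl cartan adm e' e).
- move=> i t m n e; have a0 : a (val m) (val n) != 0 by case: suppl => h _; exact: h e.
  by rewrite /wa /wb /bweight mulVKf // /rho (edge_fres e).
- move=> i m n; have [h _ _ _ _] := expansions_simple (simple i m).
  by rewrite /c /fpm h opprK /fYpoles big_map.
- move=> i m; have [_ _ _ h1 h2] := expansions_simple (simple i m).
  rewrite /c /fpm h1 h2; apply: fY_simple_limits => //.
    exact: (vertex_generic adm (valP m)).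
  exact: (vertex_degree D adm i (valP m)).
- by move=> i m n n0; have [_ h _ _ _] := expansions_simple (simple i m); exact: h.
- by move=> i m n n0; have [_ _ h _ _] := expansions_simple (simple i m); exact: h.
- move=> d i j t m n k e.
  have [h1 h2] := conv_simple (simple i m) (simple i n) (edge_fY u cartan adm x_neq0 i e).
  (* The hypothesis [c_edge] is the coefficient of z^k in [edge_fY], for either expansion. *)
  suff : conv ('X - (s i j * w t)%:P) (c d i m) k = conv (s i j *: 'X - (w t)%:P) (c d i n) k.
    by rewrite convXsubC convZXsubC => ->; ring.
  by case: d; [exact: h1 | exact: h2].
- exact: sqFF.
- exact: sqEE.
- exact: sqFF0.
- exact: sqEE0.
- exact: sqEF.
- exact: sqFE.
Qed.

End UntangledModule.

Theorem theorem5p2 (R : realType) (I : finType) (r : nat)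
    (sigma : I -> I -> qmon r)
    (chi : series I (qmon r)) (chi1 : series I (mon r))
    (D : forall i : I, decomposition sigma chi i)
    (a : ymon I (mon r) -> ymon I (mon r) -> Rtilde R r)
    (u : Rtilde R r) :
  let K : fieldType := Rtilde R r in
  let x : 'I_r -> K := @Rtilde_sqrt R r in
  is_cartan sigma ->
  admissible sigma chi chi1 ->
  no_incomplete_squares chi1 D ->
  supplement D x a ->
  u != 0 ->
  let U := UC (fun i j => monval x (sigma1 sigma i j)) in
  let E (i : I) (n : int) : U := UCE _ i n in
  let F (i : I) (n : int) : U := UCF _ i n in
  let Kpm (pm : bool) (i : I) (n : int) : U := UCK _ pm i n in
  let V := {m : ymon I (mon r) | vertex chi1 m} in
  let M := {malg K[V]} in
  let v (m : V) : M := << m >> in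
  let b (i : I) (tau : mon r) (m n : V) : K :=
    (a (val m) (val n))^-1 *
    residue (monval x tau * u) (fY x u i (val m) / tofrac 'X) in
  exists act : U -> M -> M,
    [/\ UC_module act,
        forall pm i n m,
          act (Kpm pm i n) (v m) = fpm x u pm i (val m) (- n) *: v m,
        forall i n m,
          act (F i n) (v m) =
            \sum_(e \in [set e : mon r * V | edge D i e.1 (val m) (val e.2)]%classic)
              (a (val m) (val e.2) * (monval x e.1 * u) ^ n) *: v e.2
      & forall i n m,
          act (E i n) (v m) =
            \sum_(e \in [set e : mon r * V | edge D i e.1 (val e.2) (val m)]%classic)
              (b i e.1 e.2 m * (monval x e.1 * u) ^ n) *: v e.2].
Proof.
move=> K x cartan adm nosq suppl u_neq0 U E F Kpm V M v b.
have x_neq0 k : x k != 0 by exact: frac_var_neq0.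
have monval_inj : injective (monval x).
  (* The value of a monomial is the product of the square roots with doubled exponents, and doubling
     is injective. *)
  move=> e e'; rewrite !monvalE !expr2 -!hmonvalD //.
  move=> /hmonval_frac_inj/ffunP h; apply/ffunP => k.
  by move: (h k); rewrite !ffunE; move: (e k) (e' k) => y z; lia.
exact: (untangled_module cartan adm nosq x_neq0 monval_inj suppl u_neq0).
Qed.
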